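(* Let $D\subset\mathbb C^n$ be a Kobayashi hyperbolic convex (possibly unbounded) domain and let $\mathcal Q$ be a family of automorphisms of $D$. Then the fixed point set $$D^{\mathcal Q}=\{z\in D : g\cdot z=z \text{ for all } g\in\mathcal Q\}$$ is either empty or a connected complex submanifold of $D$.
   Context: Automorphisms of $D$ are biholomorphic maps $D\to D$. $D$ is Kobayashi hyperbolic if its Kobayashi pseudodistance is a distance. *)

(* Defs.v *)
From HB Require Import structures.
From mathcomp Require Import all_boot all_order all_algebra.
From mathcomp Require Import complex.
From mathcomp Require Import all_classical all_reals all_analysis.

Set Implicit Arguments.
Unset Strict Implicit.
Unset Printing Implicit Defensive.

Import Order.TTheory GRing.Theory Num.Theory.
Import numFieldNormedType.Exports.

Local Open Scope classical_set_scope.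
Local Open Scope ring_scope.

(* MathComp-Analysis puts the norm topology of a numFieldType on variables of
   that type; R[i] is a concrete type, so it needs its own instance.  With it,
   R[i] and 'rV[R[i]]_n are normed spaces over the field R[i]. *)
HB.instance Definition _ (R : rcfType) := NormedModule.copy R[i] R[i]^o.

Section Holomorphy.
Context {R : realType}.

(* The modules are over R[i], so [differentiable] is complex differentiability.
   Maps are total functions whose values outside U are irrelevant; U is open
   in every use below. *)
Definition holomorphic_on {V W : normedModType R[i]} (U : set V)
    (f : V -> W) : Prop :=
  forall z, U z -> differentiable f z.

Definition biholomorphic {n : nat} (U V : set 'rV[R[i]]_n)
    (f : 'rV[R[i]]_n -> 'rV[R[i]]_n) : Prop :=
  holomorphic_on U f /\ set_fun U V f /\
  exists g : 'rV[R[i]]_n -> 'rV[R[i]]_n,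
    [/\ holomorphic_on V g, set_fun V U g,
        forall z, U z -> g (f z) = z & forall w, V w -> f (g w) = w].

Definition automorphism {n : nat} (D : set 'rV[R[i]]_n)
    (g : 'rV[R[i]]_n -> 'rV[R[i]]_n) : Prop :=
  biholomorphic D D g.

Definition domain {n : nat} (D : set 'rV[R[i]]_n) : Prop :=
  [/\ D !=set0, open D & connected D].

(* The barycentric parameters of [convex_set] are the t : R[i] with
   0 <= t <= 1; such t are real, so this is the usual real convexity. *)
Definition convex_in_Cn {n : nat} (D : set 'rV[R[i]]_n) : Prop :=
  convex_set (M := 'rV[R[i]]_n) D.

End Holomorphy.

Section Kobayashi.
Context {R : realType}.

Definition unit_disc : set R[i] := [set z | Normc.normc z < 1].

(* artanh |(a - b) / (1 - a^* b)|, the distance of the metric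
   |dz| / (1 - |z|^2). *)
Definition poincare_dist (a b : R[i]) : R :=
  let d := Normc.normc ((a - b) / (1 - conjc a * b)) in
  2^-1 * ln ((1 + d) / (1 - d)).

Context {n : nat}.
Implicit Types (D : set 'rV[R[i]]_n) (z w : 'rV[R[i]]_n).

(* [:: (f_1, (a_1, b_1)); ...; (f_m, (a_m, b_m))] with f_j : unit disc -> D
   holomorphic, f_1 a_1 = z, f_j b_j = f_(j+1) a_(j+1) and f_m b_m = w. *)
Fixpoint disc_chain D z w
    (c : seq ((R[i] -> 'rV[R[i]]_n) * (R[i] * R[i]))) : Prop :=
  if c is (f, (a, b)) :: c' then
    [/\ holomorphic_on unit_disc f, set_fun unit_disc D f,
        unit_disc a /\ unit_disc b, f a = z & disc_chain D (f b) w c']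
  else z = w.

Definition chain_length
    (c : seq ((R[i] -> 'rV[R[i]]_n) * (R[i] * R[i]))) : R :=
  \sum_(p <- c) poincare_dist p.2.1 p.2.2.

Definition kobayashi_pseudodist D z w : \bar R :=
  ereal_inf [set (chain_length c)%:E | c in disc_chain D z w].

(* A pseudodistance is a distance when it separates points. *)
Definition kobayashi_hyperbolic D : Prop :=
  forall z w, D z -> D w -> kobayashi_pseudodist D z w = 0%E -> z = w.

End Kobayashi.

Section FixedPoints.
Context {R : realType} {n : nat}.

(* Embedded complex submanifold of dimension k of the open set D: near each of
   its points, a holomorphic chart phi of D maps M onto the slice
   { z_k = ... = z_(n-1) = 0 } (coordinates are numbered from 0). *)
Definition complex_submanifold (D M : set 'rV[R[i]]_n) (k : nat) : Prop :=
  M `<=` D /\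
  forall p, M p ->
    exists (U V : set 'rV[R[i]]_n) (phi : 'rV[R[i]]_n -> 'rV[R[i]]_n),
      [/\ open U /\ U p, U `<=` D, open V, biholomorphic U V phi &
          forall z, U z ->
            (M z <-> forall j : 'I_n, (k <= j)%N -> phi z ord0 j = 0)].

Definition fixed_points (D : set 'rV[R[i]]_n)
    (Q : set ('rV[R[i]]_n -> 'rV[R[i]]_n)) : set 'rV[R[i]]_n :=
  [set z | D z /\ forall g, Q g -> g z = z].

End FixedPoints.

(* Main.v *)
(* Let M be the fixed point set, p a point of M, and S the set of holomorphic
   maps D -> D that fix M pointwise.  A convex hyperbolic domain contains no
   complex line, so Harnack's inequality in the supporting half-spaces of D
   makes S compact for pointwise convergence.  The group G of automorphisms
   fixing M acts on S by composition, and Zorn's lemma gives a minimal nonempty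
   closed, midpoint-convex, G-invariant subset of S.  It has a single element
   (see [minimal_singleton]), which is therefore G-invariant, that is, a
   holomorphic retraction rho of D onto M.  Hence M is connected.  At q in M,
   with P the projection D rho(q), the map
   z |-> P (rho z - q) + (1 - P) (z - rho z) is a chart which flattens M. *)
Require Import Defs.
From mathcomp Require Import all_boot all_order all_algebra.
From mathcomp Require Import complex ring lra.
From mathcomp Require Import all_classical all_reals all_analysis.

Set Implicit Arguments.
Unset Strict Implicit.
Unset Printing Implicit Defensive.

Import Order.TTheory GRing.Theory Num.Theory.
Import numFieldNormedType.Exports.

Local Open Scope classical_set_scope.
Local Open Scope ring_scope.

Local Notation normc := Normc.normc.
Local Notation cRe := complex.Re.
Local Notation cIm := complex.Im.
Local Notation "x %:C" := (real_complex _ x) : ring_scope.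

Local Arguments Normc.normc {R} x : simpl never.

(** Averaging over [G] by Haar measure would need a compact topological group; the minimal set
    stands in for the average and uses only orbits in [S]. The obstacle is that a difference of two
    self-maps is a function, with no strictly convex norm at hand on which [G] acts well. The
    finite-dimensional substitute is the leading coefficient of the difference at [p] along a
    complex line: on it [G] acts linearly through derivatives at [p], and these are uniformly
    bounded together with their inverses, because [G] itself embeds into the compact set [S].

    Convexity of [D] enters through midpoints of self-maps, through half-spaces for Harnack, and
    through the segments along which the identity theorem is run.

    The function theory avoids power series and contour integrals. Holomorphic maps are treated as
    locally bounded maps differentiable on every complex line, a condition that survives the
    pointwise limits in question and that Cauchy's estimate upgrades to Frechet differentiability
    with explicit remainders. *)

Lemma le_of_eq (R : realType) (x y : R) : x = y -> x <= y.
Proof. by move=> ->. Qed.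

(** * Modulus, real and imaginary parts of complex numbers *)

Section ComplexModulus.
Context {R : realType}.
Implicit Types (z w : R[i]) (x y : R).

Lemma normcE z : normc z = Num.sqrt (cRe z ^+ 2 + cIm z ^+ 2).
Proof. by case: z. Qed.

Lemma normc_ge0 z : 0 <= normc z.
Proof. by rewrite normcE sqrtr_ge0. Qed.

Lemma sqr_normcE z : normc z ^+ 2 = cRe z ^+ 2 + cIm z ^+ 2.
Proof. by rewrite normcE sqr_sqrtr // addr_ge0 ?sqr_ge0. Qed.

Lemma normc_real x : normc (x%:C) = `|x|.
Proof. by rewrite normcE /= expr0n /= addr0 sqrtr_sqr. Qed.

Lemma normr_normc z : `|z| = (normc z)%:C.
Proof. by []. Qed.

Lemma normc_gt0 z : (0 < normc z) = (z != 0).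
Proof.
rewrite lt_neqAle normc_ge0 andbT eq_sym; congr negb.
by apply/eqP/eqP => [/Normc.eq0_normc //|->]; rewrite Normc.normc0.
Qed.

Lemma normcD z w : normc (z + w) <= normc z + normc w.
Proof. exact: le_normcD. Qed.

Lemma normcB z w : normc (z - w) <= normc z + normc w.
Proof. by rewrite -(normcN w) normcD. Qed.

Lemma distcC z w : normc (z - w) = normc (w - z).
Proof. by rewrite -normcN opprB. Qed.

Lemma distc_triangle u z w : normc (z - w) <= normc (z - u) + normc (u - w).
Proof. by rewrite (le_trans _ (normcD _ _)) // addrA subrK. Qed.

Lemma normc_sub_le z w : normc z - normc w <= normc (z - w).
Proof. by rewrite lerBlDr (le_trans _ (normcD _ _)) // subrK. Qed.

Lemma normcX z n : normc (z ^+ n) = normc z ^+ n.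
Proof.
elim: n => [|n IH]; first by rewrite !expr0 Normc.normc1.
by rewrite !exprS Normc.normcM IH.
Qed.

Lemma Re_le_normc z : `|cRe z| <= normc z.
Proof.
by rewrite normcE -sqrtr_sqr ler_wsqrtr // lerDl sqr_ge0.
Qed.

Lemma Im_le_normc z : `|cIm z| <= normc z.
Proof.
by rewrite normcE -sqrtr_sqr ler_wsqrtr // lerDr sqr_ge0.
Qed.

Lemma normc_le_ReIm z : normc z <= `|cRe z| + `|cIm z|.
Proof.
rewrite normcE -(ler_pXn2r (n := 2)) ?nnegrE ?sqrtr_ge0 ?addr_ge0 //.
rewrite sqr_sqrtr ?addr_ge0 ?sqr_ge0 // sqrrD !real_normK ?num_real //.
have := mulr_ge0 (normr_ge0 (cRe z)) (normr_ge0 (cIm z)).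
lra.
Qed.

Lemma realcD x y : (x + y)%:C = x%:C + y%:C. Proof. exact: rmorphD. Qed.
Lemma realcB x y : (x - y)%:C = x%:C - y%:C. Proof. exact: rmorphB. Qed.
Lemma realcN x : (- x)%:C = - x%:C. Proof. exact: rmorphN. Qed.
Lemma realcM x y : (x * y)%:C = x%:C * y%:C. Proof. exact: rmorphM. Qed.
Lemma realcV x : (x^-1)%:C = (x%:C)^-1. Proof. exact: fmorphV. Qed.
Lemma realc0 : (0 : R)%:C = 0. Proof. exact: rmorph0. Qed.
Lemma realc1 : (1 : R)%:C = 1. Proof. exact: rmorph1. Qed.
Lemma realc_nat n : (n%:R : R)%:C = n%:R. Proof. exact: rmorph_nat. Qed.
Definition realcE := (realcD, realcB, realcN, realcM, realcV, realc0, realc1, realc_nat).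

Lemma ReD z w : cRe (z + w) = cRe z + cRe w. Proof. by case: z w => [? ?] []. Qed.
Lemma ImD z w : cIm (z + w) = cIm z + cIm w. Proof. by case: z w => [? ?] []. Qed.
Lemma ReN z : cRe (- z) = - cRe z. Proof. by case: z. Qed.
Lemma ImN z : cIm (- z) = - cIm z. Proof. by case: z. Qed.
Lemma ReB z w : cRe (z - w) = cRe z - cRe w. Proof. by rewrite ReD ReN. Qed.
Lemma ImB z w : cIm (z - w) = cIm z - cIm w. Proof. by rewrite ImD ImN. Qed.
Lemma ReM z w : cRe (z * w) = cRe z * cRe w - cIm z * cIm w.
Proof. by case: z w => [? ?] []. Qed.
Lemma ImM z w : cIm (z * w) = cRe z * cIm w + cIm z * cRe w.
Proof. by case: z w => [? ?] []. Qed.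

Lemma complex_ext z w : cRe z = cRe w -> cIm z = cIm w -> z = w.
Proof. by case: z w => [a b] [c d] /= -> ->. Qed.

(** Epsilon arguments for equalities end here, with whatever constant [K] they have accumulated. *)
Lemma normc_le_small z (K : R) :
  (forall e, 0 < e -> normc z <= K * e) -> z = 0.
Proof.
move=> H; apply: Normc.eq0_normc; apply/eqP; rewrite eq_le normc_ge0 andbT.
apply/ler_addgt0Pl => e e0; rewrite addr0.
have K0 : 0 < `|K| + 1 by rewrite ltr_wpDl.
apply: le_trans (H (e / (`|K| + 1)) _) _; first by rewrite divr_gt0.
rewrite mulrCA ler_piMr ?(ltW e0) // ler_pdivrMr // mul1r.
by rewrite (le_trans (ler_norm _)) // lerDl.
Qed.

End ComplexModulus.

(** * Limits obtained from pairwise estimates *)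

Section NestedLimits.
Context {R : realType}.

(** The intervals of centre [u i] and radius [e i] meet pairwise, so the supremum of their left ends
    lies in all of them. No order or filter on [T] is required: the index can be a step number or a
    complex increment. *)
Lemma real_limit (T : Type) (u e : T -> R) :
  (forall i j, `|u i - u j| <= e i + e j) ->
  exists L, forall i, `|u i - L| <= e i.
Proof.
move=> H; have [[i0 _]|no] := pselect (exists i : T, True); last first.
  by exists 0 => i; exfalso; apply: no; exists i.
pose A := [set u i - e i | i in [set: T]].
have ub j : ubound A (u j + e j).
  move=> _ [i _ <-]; have := H i j; rewrite ler_norml => /andP[_]; lra.
have hs : has_sup A by split; [exists (u i0 - e i0), i0 | exists (u i0 + e i0); exact: ub].
exists (sup A) => i; rewrite ler_norml; apply/andP; split.
  have : sup A <= u i + e i by apply: ge_sup (ub i); case: hs.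
  lra.
have : u i - e i <= sup A by apply: ub_le_sup; [case: hs | exists i].
lra.
Qed.

Lemma complex_limit (T : Type) (u : T -> R[i]) (e : T -> R) :
  (forall i j, normc (u i - u j) <= e i + e j) ->
  exists L, forall i, normc (u i - L) <= 2 * e i.
Proof.
move=> H.
have [i j|a aP] := @real_limit T (fun i => cRe (u i)) e.
  by rewrite -ReB; apply: le_trans (Re_le_normc _) (H i j).
have [i j|b bP] := @real_limit T (fun i => cIm (u i)) e.
  by rewrite -ImB; apply: le_trans (Im_le_normc _) (H i j).
exists (a +i* b)%C => i; apply: le_trans (normc_le_ReIm _) _.
rewrite ReB ImB /=; have := aP i; have := bP i; lra.
Qed.

End NestedLimits.

(** * Complex derivatives in one variable *)

Section ComplexDerivative.
Context {R : realType}.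
Implicit Types (f g : R[i] -> R[i]) (z w d : R[i]).

(** Free of quotients, so that [h = 0] is no exception, and with bounds in [R], so that estimates
    reduce to real arithmetic. *)
Definition cder f z d := forall e : R, 0 < e -> exists2 r : R, 0 < r &
  forall h, normc h < r -> normc (f (z + h) - f z - d * h) <= e * normc h.

Lemma cder_cst c z : cder (fun=> c) z 0.
Proof.
move=> e e0; exists 1 => // h _.
by rewrite mul0r subr0 subrr Normc.normc0 mulr_ge0 ?normc_ge0 // ltW.
Qed.

Lemma cder_id z : cder id z 1.
Proof.
move=> e e0; exists 1 => // h _.
by rewrite [X in normc X](_ : _ = 0) /=; [rewrite Normc.normc0 mulr_ge0 ?normc_ge0 // ltW|ring].
Qed.

Lemma cderD f g z d d' : cder f z d -> cder g z d' ->
  cder (fun w => f w + g w) z (d + d').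
Proof.
move=> F G e e0; have e20 : 0 < e / 2 by lra.
have [r r0 Fr] := F _ e20; have [s s0 Gs] := G _ e20.
exists (Num.min r s); first by rewrite lt_min r0.
move=> h; rewrite lt_min => /andP[/Fr A /Gs B].
rewrite [X in normc X](_ : _ = (f (z + h) - f z - d * h) + (g (z + h) - g z - d' * h)); last by ring.
apply: le_trans (normcD _ _) _; lra.
Qed.

Lemma cderZ c f z d : cder f z d -> cder (fun w => c * f w) z (c * d).
Proof.
move=> F e e0; have c0 : 0 < normc c + 1 by rewrite ltr_wpDl ?normc_ge0.
have [r r0 Fr] := F _ (divr_gt0 e0 c0).
exists r => // h /Fr A; rewrite -mulrA -!mulrBr Normc.normcM.
apply: le_trans (ler_wpM2l (normc_ge0 _) A) _.
rewrite mulrA ler_wpM2r ?normc_ge0 // mulrCA ler_piMr ?(ltW e0) //.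
by rewrite ler_pdivrMr // mul1r lerDl.
Qed.

Lemma cderN f z d : cder f z d -> cder (fun w => - f w) z (- d).
Proof.
move=> F e /F[r r0 Fr]; exists r => // h /Fr.
by rewrite -[X in _ -> X <= _]normcN !opprB !opprK mulNr; congr (normc _ <= _); ring.
Qed.

Lemma cderB f g z d d' : cder f z d -> cder g z d' ->
  cder (fun w => f w - g w) z (d - d').
Proof. by move=> F G; apply: cderD F (cderN G). Qed.

Lemma cder_lip f z d : cder f z d -> exists2 r : R, 0 < r &
  forall h, normc h < r -> normc (f (z + h) - f z) <= (normc d + 1) * normc h.
Proof.
move=> /(_ 1 ltr01)[r r0 H]; exists r => // h /H A.
rewrite -[f _ - f _](subrK (d * h)) (le_trans (normcD _ _)) //.
rewrite Normc.normcM; lra.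
Qed.

Lemma cder_cont f z d : cder f z d -> forall e : R, 0 < e -> exists2 r : R, 0 < r &
  forall h, normc h < r -> normc (f (z + h) - f z) <= e.
Proof.
move=> /cder_lip[r r0 H] e e0.
have c0 : 0 < normc d + 1 by rewrite ltr_wpDl ?normc_ge0.
exists (Num.min r (e / (normc d + 1))); first by rewrite lt_min r0 divr_gt0.
move=> h; rewrite lt_min => /andP[/H A B]; apply: le_trans A _.
by rewrite mulrC -ler_pdivlMr // ltW.
Qed.

Lemma cder_comp f g z d d' : cder g z d -> cder f (g z) d' ->
  cder (fun w => f (g w)) z (d' * d).
Proof.
move=> G F e e0.
have [r r0 L] := cder_lip G.
have c0 : 0 < normc d + 1 by rewrite ltr_wpDl ?normc_ge0.
have c1 : 0 < normc d' + 1 by rewrite ltr_wpDl ?normc_ge0.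
have [s s0 Fs] := F (e / 2 / (normc d + 1)) ltac:(by rewrite !divr_gt0).
have [t t0 Gt] := G (e / 2 / (normc d' + 1)) ltac:(by rewrite !divr_gt0).
exists (Num.min r (Num.min t (s / (normc d + 1)))).
  by rewrite !lt_min r0 t0 divr_gt0.
move=> h; rewrite !lt_min => /and3P[/L A /Gt B hs].
set k := g (z + h) - g z.
have ks : normc k < s.
  by apply: le_lt_trans A _; rewrite mulrC -ltr_pdivlMr.
have := Fs k ks; rewrite {1}/k addrCA subrr addr0 => E.
rewrite [X in normc X](_ : _ = (f (g (z + h)) - f (g z) - d' * k) + d' * (k - d * h)); last by ring.
apply: le_trans (normcD _ _) _; rewrite Normc.normcM.
have E1 : e / 2 / (normc d + 1) * normc k <= e / 2 * normc h.
  apply: le_trans (ler_wpM2l _ A) _; first by rewrite ltW // !divr_gt0.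
  by rewrite mulrA divfK // gt_eqF.
have E2 : normc d' * normc (k - d * h) <= e / 2 * normc h.
  apply: le_trans (ler_wpM2l (normc_ge0 _) B) _.
  rewrite mulrA ler_wpM2r ?normc_ge0 // mulrCA ler_piMr ?divr_ge0 ?(ltW e0) //.
  by rewrite ler_pdivrMr // mul1r lerDl.
by apply: le_trans (lerD E E2) _; apply: le_trans (lerD E1 (lexx _)) _; lra.
Qed.

Lemma cder_sqr z : cder (fun w => w * w) z (z + z).
Proof.
move=> e e0; exists e => // h he.
rewrite [X in normc X](_ : _ = h * h); last by ring.
by rewrite Normc.normcM ler_wpM2r ?normc_ge0 // ltW.
Qed.

Lemma cder_ext f g z d : (exists2 r : R, 0 < r & forall h, normc h < r -> f (z + h) = g (z + h)) ->
  cder f z d -> cder g z d.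
Proof.
move=> [r r0 E] F e /F[s s0 Fs]; exists (Num.min r s); first by rewrite lt_min r0.
move=> h; rewrite lt_min => /andP[hr /Fs]; rewrite E //.
by have := E 0; rewrite addr0 Normc.normc0 => ->.
Qed.

(* By polarization from squares. *)
Lemma cderM f g z d d' : cder f z d -> cder g z d' ->
  cder (fun w => f w * g w) z (d * g z + f z * d').
Proof.
move=> F G.
have S k dk : cder k z dk -> cder (fun w => k w * k w) z ((k z + k z) * dk).
  by move=> K; exact: cder_comp K (cder_sqr _).
have := cderZ (1 / 2) (cderB (cderB (S _ _ (cderD F G)) (S _ _ F)) (S _ _ G)).
set d1 := (X in cder _ _ X -> _).
have -> : d1 = d * g z + f z * d' by rewrite /d1; field.
by apply: cder_ext; exists 1 => // h _; field.
Qed.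

Lemma cder_inv z : z != 0 -> cder (fun w => w^-1) z (- (z^-1 * z^-1)).
Proof.
move=> z0 e e0; have nz : 0 < normc z by rewrite normc_gt0.
(* The first radius gives [|z + h| >= |z| / 2]; the remainder is then at most [2 |h|^2 / |z|^3],
   which the second radius absorbs. *)
exists (Num.min (normc z / 2) (e * normc z ^+ 3 / 2)).
  by rewrite lt_min !divr_gt0 ?mulr_gt0 ?exprn_gt0.
move=> h; rewrite lt_min => /andP[h1 h2].
have zh : normc z / 2 <= normc (z + h).
  by have := normc_sub_le z (- h); rewrite opprK normcN; lra.
have zh0 : z + h != 0 by rewrite -normc_gt0; lra.
rewrite [X in normc X](_ : _ = h * h * (z + h)^-1 * (z^-1 * z^-1)); last first.
  by field; rewrite zh0 z0.
rewrite !Normc.normcM !Normc.normcV -!mulrA mulrC ler_wpM2r ?normc_ge0 //.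
rewrite -!invfM ler_pdivrMr ?mulr_gt0 //; last by lra.
apply: le_trans (ltW h2) _; rewrite -mulrA ler_pM2l //.
rewrite (_ : _ / 2 = normc z / 2 * (normc z * normc z)); last by field.
by rewrite ler_wpM2r ?mulr_ge0 ?normc_ge0.
Qed.

Lemma cder_uniq f z d d' : cder f z d -> cder f z d' -> d = d'.
Proof.
move=> F G; apply/eqP; rewrite -subr_eq0; apply/eqP.
apply: (@normc_le_small _ _ 2) => e e0.
have [r r0 Fr] := F _ e0; have [s s0 Gs] := G _ e0.
pose t := Num.min r s / 2.
have t0 : 0 < t by rewrite /t divr_gt0 // lt_min r0.
have tm : t < Num.min r s by rewrite /t; move: t0; rewrite /t; lra.
have nt : normc (t%:C) = t by rewrite normc_real gtr0_norm.
move: tm; rewrite lt_min => /andP[tr ts].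
have A := Fr t%:C; have B := Gs t%:C; rewrite nt in A B.
have {}A := A tr; have {}B := B ts.
rewrite -(ler_pM2r t0) -{1}nt -Normc.normcM.
rewrite [X in normc X](_ : _ = (f (z + t%:C) - f z - d' * t%:C) - (f (z + t%:C) - f z - d * t%:C)); last by ring.
apply: le_trans (normcB _ _) _; lra.
Qed.

End ComplexDerivative.

(** The [+ 1] in the many radii [e / (k + 1)] spares a separate case for [k = 0]. *)
Lemma divr_absorb (R : realType) (e k : R) : 0 <= e -> 0 <= k -> e / (k + 1) * k <= e.
Proof.
move=> e0 k0; rewrite -mulrA ler_piMr // mulrC ler_pdivrMr ?mul1r ?lerDl //.
by rewrite ltr_wpDl.
Qed.

(** * Derivatives and antiderivatives of paths on [0, 1] *)

Section PathDerivative.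
Context {R : realType}.
Implicit Types (F G : R -> R[i]) (s t : R).

(** Relative to [0, 1]: one-sided at the end points, and blind to the values of [F] elsewhere. *)
Definition pder F t (d : R[i]) := forall e : R, 0 < e -> exists2 r : R, 0 < r &
  forall s, 0 <= s <= 1 -> `|s - t| < r ->
    normc (F s - F t - (s - t)%:C * d) <= e * `|s - t|.

Lemma pderB F G t d d' : pder F t d -> pder G t d' ->
  pder (fun s => F s - G s) t (d - d').
Proof.
move=> HF HG e e0; have e20 : 0 < e / 2 by lra.
have [r r0 Fr] := HF _ e20; have [s s0 Gs] := HG _ e20.
exists (Num.min r s); first by rewrite lt_min r0.
move=> u u01; rewrite lt_min => /andP[/(Fr _ u01) A /(Gs _ u01) B].
rewrite [X in normc X](_ : _ = (F u - F t - (u - t)%:C * d) -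
  (G u - G t - (u - t)%:C * d')); last by ring.
apply: le_trans (normcB _ _) _; lra.
Qed.

Lemma pder_comp (f : R[i] -> R[i]) a b t d :
  cder f (a + t%:C * b) d -> pder (fun s => f (a + s%:C * b)) t (d * b).
Proof.
move=> H e e0; have c0 : 0 < normc b + 1 by rewrite ltr_wpDl ?normc_ge0.
have [r r0 Fr] := H _ (divr_gt0 e0 c0).
exists (r / (normc b + 1)); first by rewrite divr_gt0.
move=> s _; rewrite ltr_pdivlMr // => sr.
have nE : normc ((s - t)%:C * b) = `|s - t| * normc b.
  by rewrite Normc.normcM normc_real.
have := Fr ((s - t)%:C * b); rewrite nE.
rewrite (_ : a + _ + _ = a + s%:C * b); last by rewrite rmorphB /=; ring.
rewrite [d * _]mulrCA => /(_ _)/le_trans; apply.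
  by apply: le_lt_trans sr; rewrite ler_wpM2l // lerDl.
rewrite [`|s - t| * _]mulrC mulrA ler_wpM2r //.
by rewrite divr_absorb ?normc_ge0 // ltW.
Qed.

(** For complex values there is no intermediate point. Instead, for each [e], the set of [t] up to
    which [F] grows with slope at most [M + e] is shown to reach 1 by looking at its supremum
    [T]. *)
Lemma mean_value F (d : R -> R[i]) (M : R) :
  (forall t, 0 <= t <= 1 -> pder F t (d t)) ->
  (forall t, 0 <= t <= 1 -> normc (d t) <= M) ->
  normc (F 1 - F 0) <= M.
Proof.
move=> dF dM; apply/ler_addgt0Pl => e e0.
have M0 : 0 <= M by apply: le_trans (dM 0 _); rewrite ?normc_ge0 // lexx ler01.
have loc t : 0 <= t <= 1 -> exists2 r : R, 0 < r & forall s, 0 <= s <= 1 ->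
    `|s - t| < r -> normc (F s - F t) <= (M + e) * `|s - t|.
  move=> t01; have [r r0 Hr] := dF t t01 e e0; exists r => // s s01 /(Hr s s01) A.
  rewrite -[F s - F t](subrK ((s - t)%:C * d t)) (le_trans (normcD _ _)) //.
  rewrite Normc.normcM normc_real mulrDl addrC lerD //.
  by rewrite mulrC ler_wpM2r // dM.
pose A := [set t : R | 0 <= t <= 1 /\
  forall u, 0 <= u <= t -> normc (F u - F 0) <= (M + e) * u].
have A0 : A 0.
  split=> [|u]; first by rewrite lexx ler01.
  by rewrite -eq_le => /eqP <-; rewrite subrr Normc.normc0 mulr0.
have hs : has_sup A by split; [exists 0 | exists 1 => t [/andP[]]].
set T := sup A.
have T01 : 0 <= T <= 1.
  rewrite /T ub_le_sup //=; last by case: hs.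
  by apply: ge_sup; [case: hs | move=> t [/andP[]]].
have below u : 0 <= u < T -> normc (F u - F 0) <= (M + e) * u.
  move=> /andP[u0 uT]; have Tu : 0 < T - u by rewrite subr_gt0.
  have [t [t01 At]] := sup_adherent Tu hs; rewrite subKr => ut.
  by apply: (At u); rewrite u0 ltW.
have [r r0 Hr] := loc T T01.
have atT : normc (F T - F 0) <= (M + e) * T.
  have [T0|T0] := eqVneq T 0; first by rewrite T0 subrr Normc.normc0 mulr0.
  have {}T0 : 0 < T by rewrite lt_neqAle eq_sym T0; case/andP: T01.
  pose u := Num.max 0 (T - r / 2).
  have u0 : 0 <= u by rewrite le_max lexx.
  have uT : u < T by rewrite gt_max T0 /=; lra.
  have ur : T - r / 2 <= u by rewrite le_max lexx orbT.
  have u01 : 0 <= u <= 1 by rewrite u0 /=; case/andP: T01; lra.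
  have Au := below u ltac:(by rewrite u0).
  have := Hr u u01; rewrite distrC gtr0_norm ?subr_gt0 // => /(_ _) B.
  have {}B := B ltac:(by lra).
  apply: le_trans (distc_triangle (F u) _ _) _; rewrite distcC.
  by apply: le_trans (lerD B Au) _; rewrite -mulrDr subrK.
(* Beyond [T] the local estimate at [T] takes over, so [T + r <= 1] would contradict the choice of
   [T]. *)
have step s : 0 <= s <= 1 -> s < T + r -> normc (F s - F 0) <= (M + e) * s.
  move=> s01 sr; have [Ts|sT] := leP T s; last first.
    by apply: below; case/andP: s01 => ->.
  have := Hr s s01; rewrite ger0_norm ?subr_ge0 // ltrBlDl => /(_ sr) B.
  apply: le_trans (distc_triangle (F T) _ _) _.
  by apply: le_trans (lerD B atT) _; rewrite -mulrDr subrK.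
have T1 : 1 < T + r.
  rewrite ltNge; apply/negP => Tr.
  suff : T + r / 2 <= T by lra.
  apply: ub_le_sup; first by case: hs.
  split=> [|u /andP[u0 uT]]; first by case/andP: T01 => ? ?; apply/andP; lra.
  by apply: step; [rewrite u0 /= | ]; lra.
by have := step 1 ltac:(by rewrite ler01 lexx) T1; rewrite mulr1 [M + e]addrC.
Qed.

Lemma antiderivative (f : R -> R) : continuous f ->
  exists F : R -> R, forall t, 0 <= t <= 1 -> is_derive t 1 F (f t).
Proof.
move=> cf; have [F HF] : exists F : R -> R, forall t, 0 <= t <= 1 ->
    derivable F t 1 /\ derive1 F t = f t.
  (* The integral starts at -1 and is considered up to 2, which puts [0, 1] in the interior and
     gives two-sided derivatives at 0 and 1. *)
  exists (fun x => (\int[lebesgue_measure]_(t in [set` `[-1, x]%R]) (f t))%R) => t /andP[t0 t1].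
  apply: (@continuous_FTC1_closed R f (-1) t 2).
  - lra.
  - apply: continuous_compact_integrable; first exact: segment_compact.
    by apply: continuous_subspaceT.
  - lra.
  - exact: cf.
exists F => t /HF[D E]; apply: DeriveDef => //.
by rewrite -derive1E.
Qed.

Lemma is_derive_eps (f : R -> R) t d : is_derive t 1 f d ->
  forall e : R, 0 < e -> exists2 r : R, 0 < r & forall s, `|s - t| < r ->
    `|f s - f t - (s - t) * d| <= e * `|s - t|.
Proof.
move=> [D <-] e e0.
move: D => /cvg_ex[l Dl]; have El : 'D_1 f t = l by apply: cvg_lim.
rewrite El; move/cvgrPdist_le: Dl => /(_ e e0).
rewrite /dnbhs /within /= => /nbhs_ballP[r /= r0 Hr].
exists r => // s sr; have [->|st] := eqVneq s t; first by rewrite !subrr mul0r subr0 normr0 mulr0.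
have st0 : s - t != 0 by rewrite subr_eq0.
have := Hr (s - t); rewrite /ball /= sub0r normrN => /(_ sr st0).
rewrite /= [_ *: 1]mulr1 subrK.
rewrite -(ler_pM2r (x := `|s - t|)) ?normr_gt0 // -normrM mulrBl.
rewrite [_ *: _]mulrC divfK // distrC; congr (`| _ | <= _); ring.
Qed.

Lemma path_antiderivative (f : R -> R[i]) :
  (forall t (e : R), 0 < e -> exists2 r : R, 0 < r &
     forall s, `|s - t| < r -> normc (f s - f t) <= e) ->
  exists F, forall t, 0 <= t <= 1 -> pder F t (f t).
Proof.
move=> cf.
have [A HA] : exists F : R -> R, forall t, 0 <= t <= 1 -> is_derive t 1 F (cRe (f t)).
  apply: antiderivative => t; apply/cvgrPdist_le => e e0.
  have [r r0 Hr] := cf t e e0; apply/nbhs_ballP; exists r => // s /=.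
  rewrite /ball /= distrC => /Hr; rewrite distrC -ReB; exact/le_trans/Re_le_normc.
have [B HB] : exists F : R -> R, forall t, 0 <= t <= 1 -> is_derive t 1 F (cIm (f t)).
  apply: antiderivative => t; apply/cvgrPdist_le => e e0.
  have [r r0 Hr] := cf t e e0; apply/nbhs_ballP; exists r => // s /=.
  rewrite /ball /= distrC => /Hr; rewrite distrC -ImB; exact/le_trans/Im_le_normc.
exists (fun t => (A t +i* B t)%C) => t t01 e e0; have e20 : 0 < e / 2 by lra.
have [r r0 Hr] := is_derive_eps (HA t t01) e20.
have [s s0 Hs] := is_derive_eps (HB t t01) e20.
exists (Num.min r s); first by rewrite lt_min r0.
move=> u _; rewrite lt_min => /andP[/Hr a /Hs b].
apply: le_trans (normc_le_ReIm _) _.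
rewrite !(ReB, ImB, ReM, ImM) /= !mul0r addr0 subr0.
by lra.
Qed.

End PathDerivative.

(** * Integrals over complex segments *)

Section SegmentIntegral.
Context {R : realType}.
Implicit Types (f g : R[i] -> R[i]) (a b u v z : R[i]) (F : R -> R[i]).

Definition ccont f z := forall e : R, 0 < e -> exists2 r : R, 0 < r &
  forall h, normc h < r -> normc (f (z + h) - f z) <= e.

(** Integrals are increments of such an [F], so uniqueness and estimates all come from [mean_value],
    and splitting or reversing a segment is a change of parameter in [F]. *)
Definition seg_primitive f a b F := forall t : R, 0 <= t <= 1 ->
  pder F t (f (a + t%:C * (b - a)) * (b - a)).

(* The integral of f over the segment from a to b. *)
Definition segint f a b : R[i] :=
  let F := xget (fun=> 0) (seg_primitive f a b) in F 1 - F 0.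

Lemma seg_primitive_ex f a b :
  (forall t : R, 0 <= t <= 1 -> ccont f (a + t%:C * (b - a))) ->
  exists F, seg_primitive f a b F.
Proof.
move=> cf.
(* [path_antiderivative] wants continuity on the whole line, so the parameter is clamped to [0, 1];
   the clamp is 1-Lipschitz. *)
have [c [c01 cE cL]] : exists c : R -> R, [/\ forall t, 0 <= c t <= 1,
    forall t, 0 <= t <= 1 -> c t = t & forall s t, `|c s - c t| <= `|s - t|].
  exists (fun t => if t <= 0 then 0 else if 1 <= t then 1 else t).
  split=> [t|t /andP[t0 t1]|s t].
  - by case: (leP t 0) => t0; case: (leP 1 t) => t1; apply/andP; split; lra.
  - case: (leP t 0) => t0'; first by apply/eqP; rewrite eq_le t0.
    by case: (leP 1 t) => t1' //; apply/eqP; rewrite eq_le t1'.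
  have sN := ler_norm (s - t); have tN := ler_norm (t - s); rewrite distrC in tN.
  rewrite ler_norml; apply/andP.
  by case: (leP s 0) => s0; case: (leP 1 s) => s1; case: (leP t 0) => t0; case: (leP 1 t) => t1; split; lra.
have [F HF] : exists F, forall t, 0 <= t <= 1 ->
    pder F t (f (a + (c t)%:C * (b - a)) * (b - a)).
  apply: path_antiderivative => t e e0.
  have nb : 0 <= normc (b - a) := normc_ge0 _.
  have nb1 : 0 < normc (b - a) + 1 by rewrite ltr_wpDl.
  have [r r0 Hr] := cf _ (c01 t) (e / (normc (b - a) + 1)) (divr_gt0 e0 nb1).
  exists (r / (normc (b - a) + 1)); first by rewrite divr_gt0.
  move=> s; rewrite ltr_pdivlMr // => sr.
  rewrite -mulrBl Normc.normcM.
  apply: (@le_trans _ _ (e / (normc (b - a) + 1) * normc (b - a))); last first.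
    by rewrite divr_absorb // ltW.
  rewrite ler_wpM2r //.
  rewrite (_ : a + (c s)%:C * (b - a) =
    a + (c t)%:C * (b - a) + (c s - c t)%:C * (b - a)); last first.
    by rewrite rmorphB /=; ring.
  apply: Hr; rewrite Normc.normcM normc_real; apply: le_lt_trans sr.
  have nb2 : normc (b - a) <= normc (b - a) + 1 by rewrite lerDl ler01.
  exact: ler_pM (normr_ge0 _) nb (cL s t) nb2.
by exists F => t t01; have := HF t t01; rewrite cE.
Qed.

Lemma seg_primitive_uniq (d : R -> R[i]) F G :
  (forall t, 0 <= t <= 1 -> pder F t (d t)) ->
  (forall t, 0 <= t <= 1 -> pder G t (d t)) -> F 1 - F 0 = G 1 - G 0.
Proof.
move=> HF HG; apply/eqP; rewrite -subr_eq0; apply/eqP.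
apply: Normc.eq0_normc; apply/eqP; rewrite eq_le normc_ge0 andbT.
rewrite (_ : F 1 - F 0 - (G 1 - G 0) = (F 1 - G 1) - (F 0 - G 0)); last by ring.
apply: (@mean_value _ (fun t => F t - G t) (fun t => d t - d t) 0) => t t01.
  exact: pderB (HF t t01) (HG t t01).
by rewrite subrr Normc.normc0.
Qed.

Lemma segintE f a b F : seg_primitive f a b F -> segint f a b = F 1 - F 0.
Proof.
move=> HF; rewrite /segint.
have H := xgetI (fun=> 0) HF; exact: seg_primitive_uniq H HF.
Qed.

(** The affine function has the explicit primitive [P], so only the deviation of [f] from it is
    integrated. Goursat's lemma takes the first-order expansion of [f]; the construction of
    primitives takes a constant, with [c1 = 0]. *)
Lemma segint_approx f a b c0 c1 z0 (M : R) :
  (forall t : R, 0 <= t <= 1 -> ccont f (a + t%:C * (b - a))) ->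
  (forall t : R, 0 <= t <= 1 -> let z := a + t%:C * (b - a) in
     is_true (normc (f z - (c0 + c1 * (z - z0))) <= M)) ->
  let P z := c0 * z + 1 / 2 * (c1 * ((z - z0) * (z - z0))) in
  is_true (normc (segint f a b - (P b - P a)) <= M * normc (b - a)).
Proof.
move=> cf HM P; have [F HF] := seg_primitive_ex cf.
rewrite (segintE HF).
have dP z : cder P z (c0 + c1 * (z - z0)).
  have S : cder (fun w => w - z0) z 1.
    have := cderB (cder_id z) (cder_cst z0 z); rewrite subr0; apply: cder_ext.
    by exists 1.
  have := cderD (cderZ c0 (cder_id z)) (cderZ (1 / 2) (cderZ c1 (cderM S S))).
  rewrite (_ : c0 * 1 + _ = c0 + c1 * (z - z0)); last by field.
  by apply: cder_ext; exists 1.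
rewrite (_ : F 1 - F 0 - (P b - P a) = (F 1 - P b) - (F 0 - P a)); last by ring.
pose G t := F t - P (a + t%:C * (b - a)).
have -> : F 1 - P b = G 1 by rewrite /G rmorph1 mul1r addrCA subrr addr0.
have -> : F 0 - P a = G 0 by rewrite /G rmorph0 mul0r addr0.
apply: (mean_value (d := fun t => let z := a + t%:C * (b - a) in
   f z * (b - a) - (c0 + c1 * (z - z0)) * (b - a))) => t t01 /=.
  by apply: pderB; [exact: HF|exact: pder_comp].
by rewrite -mulrBl Normc.normcM ler_wpM2r ?normc_ge0 //; exact: HM.
Qed.

Lemma pder_affine F (k c t : R) d : (forall s, 0 <= s <= 1 -> 0 <= c + k * s <= 1) ->
  pder F (c + k * t) d -> pder (fun s => F (c + k * s)) t (k%:C * d).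
Proof.
move=> H01 HF e e0; have k1 : 0 < `|k| + 1 by rewrite ltr_wpDl.
have [r r0 Hr] := HF _ (divr_gt0 e0 k1).
exists (r / (`|k| + 1)); first by rewrite divr_gt0.
move=> s s01; rewrite ltr_pdivlMr // => sr.
have E : c + k * s - (c + k * t) = k * (s - t) by ring.
have := Hr _ (H01 s s01); rewrite E normrM.
move=> /(_ _)/le_trans; rewrite mulrA -rmorphM [(s - t) * k]mulrC; apply.
  by apply: le_lt_trans sr; rewrite mulrC ler_wpM2l // lerDl.
by rewrite mulrA ler_wpM2r // divr_absorb // ltW.
Qed.

Lemma segint_split f a b :
  (forall t : R, 0 <= t <= 1 -> ccont f (a + t%:C * (b - a))) ->
  let m := (a + b) / 2 in segint f a b = segint f a m + segint f m b.
Proof.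
move=> cf m; have [F HF] := seg_primitive_ex cf.
have h2 : ((1 / 2 : R)%:C : R[i]) = 1 / 2.
  by rewrite !realcE.
have hk (t : R) : ((1 / 2 * t)%:C : R[i]) = 1 / 2 * t%:C.
  by rewrite !realcE.
have A : seg_primitive f a m (fun s => F (0 + 1 / 2 * s)).
  move=> t /andP[t0 t1].
  have := @pder_affine F (1 / 2) 0 t _ _ (HF (0 + 1 / 2 * t) _).
  rewrite (_ : (1 / 2)%:C * _ = f (a + t%:C * (m - a)) * (m - a)).
    apply; first by move=> s /andP[? ?]; apply/andP; lra.
    by apply/andP; lra.
  rewrite add0r hk h2 /m.
  rewrite (_ : a + 1 / 2 * t%:C * (b - a) = a + t%:C * ((a + b) / 2 - a)); last by field.
  by field.
have B : seg_primitive f m b (fun s => F (1 / 2 + 1 / 2 * s)).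
  move=> t /andP[t0 t1].
  have := @pder_affine F (1 / 2) (1 / 2) t _ _ (HF (1 / 2 + 1 / 2 * t) _).
  rewrite (_ : (1 / 2)%:C * _ = f (m + t%:C * (b - m)) * (b - m)).
    apply; first by move=> s /andP[? ?]; apply/andP; lra.
    by apply/andP; lra.
  rewrite realcD hk h2 /m.
  rewrite (_ : a + (1 / 2 + 1 / 2 * t%:C) * (b - a) = (a + b) / 2 + t%:C * (b - (a + b) / 2)); last by field.
  by field.
rewrite (segintE HF) (segintE A) (segintE B) !mulr1 !mulr0 !addr0 add0r.
rewrite (_ : 1 / 2 + 1 / 2 = 1 :> R); last by field.
by ring.
Qed.

Lemma segint_rev f a b :
  (forall t : R, 0 <= t <= 1 -> ccont f (a + t%:C * (b - a))) ->
  segint f b a = - segint f a b.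
Proof.
move=> cf; have [F HF] := seg_primitive_ex cf.
have A : seg_primitive f b a (fun s => F (1 + (-1) * s)).
  move=> t /andP[t0 t1].
  have := @pder_affine F (-1) 1 t _ _ (HF (1 + (-1) * t) _).
  rewrite (_ : (-1)%:C * _ = f (b + t%:C * (a - b)) * (a - b)).
    apply; first by move=> s /andP[? ?]; apply/andP; lra.
    by apply/andP; lra.
  rewrite !realcE.
  rewrite (_ : a + (1 + -1 * t%:C) * (b - a) = b + t%:C * (a - b)); last by ring.
  by ring.
rewrite (segintE HF) (segintE A) mulr0 addr0 mulr1 subrr; ring.
Qed.

Lemma cder_ccont f z d : cder f z d -> ccont f z.
Proof. exact: cder_cont. Qed.

End SegmentIntegral.

(** * Goursat's lemma for triangles *)

Section Goursat.
Context {R : realType}.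
Implicit Types (a b u v z : R[i]).

Lemma exp_half_small (e : R) : 0 < e -> exists n, (1 / 2) ^+ n < e.
Proof.
move=> e0; have : `|1 / 2 : R| < 1 by rewrite ger0_norm; lra.
move=> /cvg_expr /cvgrPdist_lt /(_ e e0)[n _ /(_ n (leqnn n))] /=.
by rewrite sub0r normrN normrX ger0_norm; [exists n | lra].
Qed.

(** Pigeonhole in contrapositive form: one of four pieces carries at least a quarter of the
    whole. *)
Lemma four_summands (a1 a2 a3 a4 t : R) : 4 * a1 < t -> 4 * a2 < t ->
  4 * a3 < t -> 4 * a4 < t -> t <= a1 + a2 + a3 + a4 -> False.
Proof. lra. Qed.

Lemma segment_dist (p q c h t : R) : `|p - c| <= h -> `|q - c| <= h ->
  0 <= t <= 1 -> `|p + t * (q - p) - c| <= h.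
Proof.
move=> pc qc /andP[t0 t1].
rewrite (_ : _ - c = (1 - t) * (p - c) + t * (q - c)); last by ring.
apply: le_trans (ler_normD _ _) _; rewrite !normrM (ger0_norm t0) ger0_norm ?subr_ge0 //.
have := ler_wpM2l t0 qc; have t1' : 0 <= 1 - t by lra.
by have := ler_wpM2l t1' pc; lra.
Qed.

Variables (f : R[i] -> R[i]) (a u v : R[i]).
Hypothesis df : forall x y : R, 0 <= x -> 0 <= y -> x + y <= 1 ->
  exists d, cder f (a + x%:C * u + y%:C * v) d.

Let P (x y : R) := a + x%:C * u + y%:C * v.
(** A triangle of the subdivision is given by a corner and one signed leg length [s] in the affine
    coordinates of the base triangle. The inverted middle piece has the opposite sign of [s], so all
    four pieces have the same form. The condition [good] says that the three vertices lie in the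
    base triangle. *)
Let T (q : R * R * R) := let: (x, y, s) := q in
  segint f (P x y) (P (x + s) y) + segint f (P (x + s) y) (P x (y + s))
  + segint f (P x (y + s)) (P x y).

Let good (q : R * R * R) := let: (x, y, s) := q in
  [/\ 0 <= x /\ 0 <= x + s, 0 <= y /\ 0 <= y + s, x + y <= 1 & x + y + s <= 1].

Let segP (x y x' y' t : R) :
  P x y + t%:C * (P x' y' - P x y) = P (x + t * (x' - x)) (y + t * (y' - y)).
Proof. by rewrite /P !realcE; ring. Qed.

Let segcont (x y x' y' : R) : 0 <= x -> 0 <= y -> x + y <= 1 ->
  0 <= x' -> 0 <= y' -> x' + y' <= 1 ->
  forall t : R, 0 <= t <= 1 -> ccont f (P x y + t%:C * (P x' y' - P x y)).
Proof.
move=> x0 y0 xy x'0 y'0 xy' t /andP[t0 t1]; rewrite segP.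
have [||| d dd] := @df (x + t * (x' - x)) (y + t * (y' - y)); last exact: cder_ccont dd.
- nra.
- nra.
- nra.
Qed.

Let subdivide (q : R * R * R) : good q -> exists q' : R * R * R,
  good q' /\ [/\ `|q'.2| = `|q.2| / 2, `|q'.1.1 - q.1.1| <= `|q.2| / 2,
    `|q'.1.2 - q.1.2| <= `|q.2| / 2 & normc (T q) <= 4 * normc (T q')].
Proof.
case: q => [[x y] s] /= [[x0 xs] [y0 ys] xy xys].
have sn : `|s / 2| = `|s| / 2 by rewrite normrM [`|2^-1|]ger0_norm // invr_ge0.
have sn' : `|- (s / 2)| = `|s| / 2 by rewrite normrN.
have sn0 : 0 <= `|s| / 2 by rewrite divr_ge0.
pose q1 := (x, y, s / 2); pose q2 := (x + s / 2, y, s / 2).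
pose q3 := (x, y + s / 2, s / 2); pose q4 := (x + s / 2, y + s / 2, - (s / 2)).
have mid (x1 y1 x2 y2 : R) : (P x1 y1 + P x2 y2) / 2 = P ((x1 + x2) / 2) ((y1 + y2) / 2).
  by rewrite /P !realcE; field.
pose D (x1 y1 : R) := [/\ 0 <= x1, 0 <= y1 & x1 + y1 <= 1].
have D1 : D x y by [].
have D2 : D (x + s) y by split=> //; lra.
have D3 : D x (y + s) by split=> //; lra.
have D4 : D (x + s / 2) y by split; lra.
have D5 : D x (y + s / 2) by split; lra.
have D6 : D (x + s / 2) (y + s / 2) by split; lra.
have sp (x1 y1 x2 y2 : R) : D x1 y1 -> D x2 y2 ->
  segint f (P x1 y1) (P x2 y2) = segint f (P x1 y1) (P ((x1 + x2) / 2) ((y1 + y2) / 2))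
    + segint f (P ((x1 + x2) / 2) ((y1 + y2) / 2)) (P x2 y2).
  by move=> [? ? ?] [? ? ?]; rewrite segint_split ?mid //; apply: segcont.
have rv (x1 y1 x2 y2 : R) : D x1 y1 -> D x2 y2 ->
  segint f (P x2 y2) (P x1 y1) = - segint f (P x1 y1) (P x2 y2).
  by move=> [? ? ?] [? ? ?]; rewrite segint_rev //; apply: segcont.
(* The outer edges are halved, and each of the three inner edges is run through twice in opposite
   directions. *)
have TE : T (x, y, s) = T q1 + T q2 + T q3 + T q4.
  rewrite /T /q1 /q2 /q3 /q4.
  rewrite (sp _ _ _ _ D1 D2) (sp _ _ _ _ D2 D3) (sp _ _ _ _ D3 D1).
  have e1 : (x + (x + s)) / 2 = x + s / 2 by field.
  have e2 : (y + y) / 2 = y by field.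
  have e3 : (x + s + x) / 2 = x + s / 2 by field.
  have e4 : (y + (y + s)) / 2 = y + s / 2 by field.
  have e5 : (x + x) / 2 = x by field.
  have e6 : (y + s + y) / 2 = y + s / 2 by field.
  have e7 : x + s / 2 + s / 2 = x + s by field.
  have e8 : y + s / 2 + s / 2 = y + s by field.
  have e9 : x + s / 2 - s / 2 = x by field.
  have e10 : y + s / 2 - s / 2 = y by field.
  rewrite e1 e2 e3 e4 e5 e6 e7 e8 e9 e10.
  rewrite (rv _ _ _ _ D4 D5) (rv _ _ _ _ D4 D6) (rv _ _ _ _ D5 D6).
  do 9 (match goal with |- context [segint ?g ?b ?c] => generalize (segint g b c) end; intro).
  ring.
have g1 : good q1 by do ?split; lra.
have g2 : good q2 by do ?split; lra.
have g3 : good q3 by do ?split; lra.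
have g4 : good q4 by do ?split; lra.
have n1 : `|x - x| <= `|s| / 2 by rewrite subrr normr0.
have n2 : `|y - y| <= `|s| / 2 by rewrite subrr normr0.
have n3 : `|x + s / 2 - x| <= `|s| / 2 by rewrite addrAC subrr add0r sn.
have n4 : `|y + s / 2 - y| <= `|s| / 2 by rewrite addrAC subrr add0r sn.
have : normc (T (x, y, s)) <= normc (T q1) + normc (T q2) + normc (T q3) + normc (T q4).
  rewrite {1}TE; apply: le_trans (normcD _ _) _; rewrite lerD2r.
  by apply: le_trans (normcD _ _) _; rewrite lerD2r normcD.
have [h1|h1] := leP (normc (T (x, y, s))) (4 * normc (T q1)); first by exists q1.
have [h2|h2] := leP (normc (T (x, y, s))) (4 * normc (T q2)); first by exists q2.
have [h3|h3] := leP (normc (T (x, y, s))) (4 * normc (T q3)); first by exists q3.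
have [h4|h4] := leP (normc (T (x, y, s))) (4 * normc (T q4)); first by exists q4.
by move=> h5; have := four_summands h1 h2 h3 h4 h5.
Qed.

Let side (x y x' y' s : R) (n : R) z0 c0 c1 :
  0 <= x -> 0 <= y -> x + y <= 1 -> 0 <= x' -> 0 <= y' -> x' + y' <= 1 ->
  normc (P x' y' - P x y) <= s ->
  (forall t, 0 <= t <= 1 -> let z := P (x + t * (x' - x)) (y + t * (y' - y)) in
     is_true (normc (f z - (c0 + c1 * (z - z0))) <= n)) ->
  let Q z := c0 * z + 1 / 2 * (c1 * ((z - z0) * (z - z0))) in
  is_true (normc (segint f (P x y) (P x' y') - (Q (P x' y') - Q (P x y))) <= n * s).
Proof.
move=> x0 y0 xy x'0 y'0 xy' ss H Q.
apply: le_trans (segint_approx (c0 := c0) (c1 := c1) (z0 := z0) (M := n) (segcont x0 y0 xy x'0 y'0 xy') _) _.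
  by move=> t t01 /=; rewrite segP; apply: H.
rewrite ler_wpM2l //; apply: le_trans (H 0 _); first exact: normc_ge0.
by rewrite lexx ler01.
Qed.

Lemma goursat_triangle :
  segint f a (a + u) + segint f (a + u) (a + v) + segint f (a + v) a = 0.
Proof.
have [next nextP] : exists next : R * R * R -> R * R * R, forall q, good q ->
    good (next q) /\ [/\ `|(next q).2| = `|q.2| / 2, `|(next q).1.1 - q.1.1| <= `|q.2| / 2,
    `|(next q).1.2 - q.1.2| <= `|q.2| / 2 & normc (T q) <= 4 * normc (T (next q))].
  have [q|next nextP] := @choice _ _ (fun q q' => good q -> good q' /\ [/\ `|q'.2| = `|q.2| / 2,
    `|q'.1.1 - q.1.1| <= `|q.2| / 2,
    `|q'.1.2 - q.1.2| <= `|q.2| / 2 & normc (T q) <= 4 * normc (T q')]); last by exists next.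
  have [/subdivide[q' ?]|?] := pselect (good q); first by exists q'.
  by exists q.
pose q n := iter n next (0, 0, 1).
have goodq n : good (q n).
  elim: n => [|n /nextP[]//]; by rewrite /good /=; do ?split; lra.
have h0 n : 0 <= (1 / 2 : R) ^+ n by rewrite exprn_ge0 //; lra.
have sq n : `|(q n).2| = (1 / 2) ^+ n.
  elim: n => [|n IH]; first by rewrite expr0 /= normr1.
  by have [_ [-> _ _ _]] := nextP _ (goodq n); rewrite -/(q n) IH exprS; field.
(* A corner moves by at most half the current leg, which is exactly this drop, so the moves
   telescope and the corners converge with rate [(1 / 2) ^+ n]. *)
have stepx n : `|(q n.+1).1.1 - (q n).1.1| <= (1 / 2) ^+ n - (1 / 2) ^+ n.+1.
  have [_ [_ A _ _]] := nextP _ (goodq n); apply: le_trans A _; rewrite sq exprS; lra.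
have stepy n : `|(q n.+1).1.2 - (q n).1.2| <= (1 / 2) ^+ n - (1 / 2) ^+ n.+1.
  have [_ [_ _ A _]] := nextP _ (goodq n); apply: le_trans A _; rewrite sq exprS; lra.
have cauchy (c : nat -> R) : (forall n, `|c n.+1 - c n| <= (1 / 2) ^+ n - (1 / 2) ^+ n.+1) ->
    exists L, forall n, `|c n - L| <= (1 / 2) ^+ n.
  move=> st; apply: real_limit.
  have far n k : `|c (n + k)%N - c n| <= (1 / 2) ^+ n - (1 / 2) ^+ (n + k).
    elim: k => [|k IH]; first by rewrite addn0 !subrr normr0.
    rewrite -(subrK (c (n + k)%N) (c (n + k.+1)%N)) -addrA.
    apply: le_trans (ler_normD _ _) _; rewrite addnS.
    by have := st (n + k)%N; lra.
  move=> i j; have [ij|ji] := leqP i j.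
    by rewrite distrC -(subnKC ij); have := far i (j - i)%N; have := h0 (i + (j - i))%N; lra.
  by rewrite -(subnKC (ltnW ji)); have := far j (i - j)%N; have := h0 (j + (i - j))%N; lra.
have [x xP] := cauchy _ stepx; have [y yP] := cauchy _ stepy.
(* Used to keep the limit point [(x, y)] inside the closed base triangle, where [f] is
   differentiable. *)
have lim0 (c : nat -> R) L : (forall n, `|c n - L| <= 2 * (1 / 2) ^+ n) -> (forall n, 0 <= c n) -> 0 <= L.
  move=> cL c0; rewrite leNgt; apply/negP => L0.
  have [n hn] := @exp_half_small (- L / 2) ltac:(lra).
  by have := cL n; rewrite ler_norml => /andP[_]; have := c0 n; lra.
have x0 : 0 <= x.
  apply: (lim0 (fun n => (q n).1.1)) => n; first by have := xP n; have := h0 n; lra.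
  by have := goodq n; case: (q n) => [[? ?] ?] [[]].
have y0 : 0 <= y.
  apply: (lim0 (fun n => (q n).1.2)) => n; first by have := yP n; have := h0 n; lra.
  by have := goodq n; case: (q n) => [[? ?] ?] [_ []].
have xy1 : x + y <= 1.
  suff : 0 <= 1 - (x + y) by lra.
  apply: (lim0 (fun n => 1 - ((q n).1.1 + (q n).1.2))) => n; last first.
    by have := goodq n; case: (q n) => [[? ?] ?] [_ _ /=]; lra.
  have := xP n; have := yP n; rewrite !ler_norml => /andP[? ?] /andP[? ?].
  by apply/andP; split; lra.
have T0E : T (q 0%N) = segint f a (a + u) + segint f (a + u) (a + v) + segint f (a + v) a.
  by rewrite /T /= /P !add0r realc0 realc1 !mul0r !mul1r !addr0.
rewrite -T0E; pose B := normc u + normc v.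
have B0 : 0 <= B by rewrite addr_ge0 ?normc_ge0.
(* At level [n], with [h = (1 / 2) ^+ n], each of three sides is at most [h * B] long, and on it [f]
   deviates from its expansion at the limit point by at most [e * (2 * h * B)]. The factor [h * h]
   cancels the growth [4 ^+ n]. *)
apply: (@normc_le_small _ _ (6 * B * B)) => e e0.
have [d dd] := df x0 y0 xy1; have [r r0 Hr] := dd e e0; rewrite -/(P x y) in Hr.
have B1 : 0 < 2 * B + 1 by lra.
have [n hn] := exp_half_small (divr_gt0 r0 B1).
have growth m : normc (T (q 0%N)) <= 4 ^+ m * normc (T (q m)).
  elim: m => [|m IH]; first by rewrite mul1r.
  have [_ [_ _ _ A]] := nextP _ (goodq m); apply: le_trans IH _.
  by rewrite exprSr -mulrA ler_wpM2l ?exprn_ge0.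
apply: le_trans (growth n) _.
set h := (1 / 2) ^+ n in hn; have hh0 : 0 <= h := h0 n.
have h4 : 4 ^+ n * (h * h) = 1.
  by rewrite /h -!exprMn (_ : 4 * _ = 1) ?expr1n //; field.
suff key : normc (T (q n)) <= 6 * B * B * e * (h * h).
  apply: le_trans (ler_wpM2l _ key) _; first by rewrite exprn_ge0.
  by rewrite mulrCA h4 mulr1.
have := goodq n; have := sq n; have := xP n; have := yP n.
case: (q n) => [[xn yn] s] /= yb xb sb [[xn0 xs0] [yn0 ys0] xyn xys].
have near (x' y' : R) : `|x' - x| <= 2 * h -> `|y' - y| <= 2 * h ->
    normc (f (P x' y') - (f (P x y) + d * (P x' y' - P x y))) <= e * (2 * h * B).
  move=> hx hy; have E : normc (P x' y' - P x y) <= 2 * h * B.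
    rewrite (_ : P x' y' - P x y = (x' - x)%:C * u + (y' - y)%:C * v); last first.
      by rewrite /P !realcE; ring.
    rewrite (le_trans (normcD _ _)) // !Normc.normcM !normc_real /B mulrDr lerD //.
      by rewrite ler_wpM2r ?normc_ge0.
    by rewrite ler_wpM2r ?normc_ge0.
  have hr : h * (2 * B + 1) < r by rewrite -ltr_pdivlMr.
  have Er : normc (P x' y' - P x y) < r.
    by apply: le_lt_trans E _; move: hr; rewrite mulrDr mulr1; lra.
  have := Hr _ Er; rewrite subrKC => H1; rewrite opprD addrA.
  by apply: le_trans H1 _; rewrite ler_wpM2l // ltW.
have Us : normc (s%:C * u) <= h * B.
  by rewrite Normc.normcM normc_real sb -/h ler_wpM2l // /B lerDl normc_ge0.
have Vs : normc (s%:C * v) <= h * B.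
  by rewrite Normc.normcM normc_real sb -/h ler_wpM2l // /B lerDr normc_ge0.
have UVs : normc (s%:C * (v - u)) <= h * B.
  by rewrite Normc.normcM normc_real sb -/h ler_wpM2l // /B [normc u + _]addrC normcB.
have xb' : `|xn - x| <= 2 * h by apply: le_trans xb _; rewrite ler_peMl // ler1n.
have yb' : `|yn - y| <= 2 * h by apply: le_trans yb _; rewrite ler_peMl // ler1n.
have h2 : h + h <= 2 * h by rewrite mulr2n mulrDl mul1r.
have xsb : `|xn + s - x| <= 2 * h.
  by rewrite addrAC; apply: le_trans (ler_normD _ _) (le_trans _ h2); rewrite lerD // sb.
have ysb : `|yn + s - y| <= 2 * h.
  by rewrite addrAC; apply: le_trans (ler_normD _ _) (le_trans _ h2); rewrite lerD // sb.
have xsy : xn + s + yn <= 1 by rewrite addrAC.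
have xys' : xn + (yn + s) <= 1 by rewrite addrA.
(* A primitive of the first-order expansion; its increments around the triangle cancel. *)
pose Q z := f (P x y) * z + 1 / 2 * (d * ((z - P x y) * (z - P x y))).
have I1 : normc (segint f (P xn yn) (P (xn + s) yn) - (Q (P (xn + s) yn) - Q (P xn yn))) <= e * (2 * h * B) * (h * B).
  apply: side => //.
    by rewrite (_ : P _ _ - _ = s%:C * u) //; rewrite /P !realcE; ring.
  by move=> t t01 /=; apply: near; apply: segment_dist.
have I2 : normc (segint f (P (xn + s) yn) (P xn (yn + s)) - (Q (P xn (yn + s)) - Q (P (xn + s) yn))) <= e * (2 * h * B) * (h * B).
  apply: side => //.
    by rewrite (_ : P _ _ - _ = s%:C * (v - u)) //; rewrite /P !realcE; ring.
  by move=> t t01 /=; apply: near; apply: segment_dist.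
have I3 : normc (segint f (P xn (yn + s)) (P xn yn) - (Q (P xn yn) - Q (P xn (yn + s)))) <= e * (2 * h * B) * (h * B).
  apply: side => //.
    by rewrite (_ : P _ _ - _ = - (s%:C * v)) ?normcN //; rewrite /P !realcE; ring.
  by move=> t t01 /=; apply: near; apply: segment_dist.
move: I1 I2 I3; set s1 := segint _ _ _; set s2 := segint _ _ _; set s3 := segint _ _ _.
move=> I1 I2 I3.
rewrite (_ : s1 + s2 + s3 = (s1 - (Q (P (xn + s) yn) - Q (P xn yn))) +
  (s2 - (Q (P xn (yn + s)) - Q (P (xn + s) yn))) +
  (s3 - (Q (P xn yn) - Q (P xn (yn + s))))); last by ring.
apply: le_trans (normcD _ _) _.
apply: le_trans (lerD (normcD _ _) (lexx _)) _.
apply: le_trans (lerD (lerD I1 I2) I3) _.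
by apply: le_of_eq; ring.
Qed.

End Goursat.

(** * Primitives on convex open sets *)

Section Primitive.
Context {R : realType}.
Implicit Types (O : set R[i]) (f g F : R[i] -> R[i]) (a b z w : R[i]).

Definition cconvex O := forall a b (t : R), O a -> O b -> 0 <= t <= 1 ->
  O (a + t%:C * (b - a)).
Definition copen O := forall z, O z -> exists2 r : R, 0 < r &
  forall h, normc h < r -> O (z + h).
Definition chol O f := forall z, O z -> exists d, cder f z d.

Lemma cconvex_triangle O a u v : cconvex O -> O a -> O (a + u) -> O (a + v) ->
  forall x y : R, 0 <= x -> 0 <= y -> x + y <= 1 -> O (a + x%:C * u + y%:C * v).
Proof.
move=> cO Oa Ou Ov x y x0 y0 xy.
have [s0|s0] := eqVneq (x + y) 0.
  have -> : x = 0 by lra. have -> : y = 0 by lra.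
  by rewrite realc0 !mul0r !addr0.
have {}s0 : 0 < x + y by rewrite lt_neqAle eq_sym s0 addr_ge0.
(* The point is reached from [a] along a ray that meets the edge from [a + u] to [a + v] in this
   point. *)
have O1 := cO _ _ (y / (x + y)) Ou Ov.
have := cO _ _ (x + y) Oa (O1 _); rewrite (_ : a + (x + y)%:C * _ = a + x%:C * u + y%:C * v).
  apply; first by rewrite divr_ge0 ?(ltW s0) //= ler_pdivrMr // mul1r lerDr.
  by rewrite (ltW s0).
rewrite !realcE; field.
by rewrite -realcD -normc_gt0 normc_real normr_gt0 gt_eqF.
Qed.

(** Integrate over the straight segment from a base point. Goursat's lemma for the triangle [z0],
    [z], [z + h] turns the increment into the integral over the short segment, on which [f] is
    nearly [f z]. *)
Lemma primitive_exists O f : cconvex O -> copen O -> chol O f ->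
  exists F, forall z, O z -> cder F z (f z).
Proof.
move=> cO oO hf; have [[z0 Oz0]|no] := pselect (O !=set0); last first.
  by exists (fun=> 0) => z Oz; exfalso; apply: no; exists z.
have cf a b : O a -> O b -> forall t : R, 0 <= t <= 1 -> ccont f (a + t%:C * (b - a)).
  by move=> Oa Ob t t01; have [d dd] := hf _ (cO _ _ _ Oa Ob t01); apply: cder_ccont dd.
exists (segint f z0) => z Oz e e0.
have [r r0 Hr] := oO z Oz.
have [d dd] := hf z Oz; have [s s0 Hs] := cder_ccont dd e0.
exists (Num.min r s); first by rewrite lt_min r0.
move=> h; rewrite lt_min => /andP[hr hs]; have Ow := Hr h hr.
have G : segint f z0 z + segint f z (z + h) + segint f (z + h) z0 = 0.
  have := @goursat_triangle R f z0 (z - z0) (z + h - z0).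
  rewrite !subrKC; apply=> x y x0 y0 xy; apply: hf.
  by apply: cconvex_triangle => //; rewrite subrKC.
have E : segint f z0 (z + h) - segint f z0 z = segint f z (z + h).
  move: G; rewrite (segint_rev (cf _ _ Oz0 Ow)) => /eqP; rewrite subr_eq0 => /eqP <-.
  by rewrite addrAC subrr add0r.
rewrite E.
have A (t : R) : 0 <= t <= 1 -> let u := z + t%:C * (z + h - z) in
    is_true (normc (f u - (f z + 0 * (u - z))) <= e).
  move=> /andP[t0 t1] /=; rewrite mul0r addr0 addrAC subrr add0r; apply: Hs.
  rewrite Normc.normcM normc_real ger0_norm //.
  by apply: le_lt_trans hs; rewrite ler_piMl ?normc_ge0.
have := segint_approx (cf _ _ Oz Ow) A.
have Eh : z + h - z = h by ring.
by rewrite /= !mul0r !mulr0 !addr0 -mulrBr Eh.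
Qed.

Lemma mean_value_segment f (df : R[i] -> R[i]) a b (M : R) :
  (forall t : R, 0 <= t <= 1 -> let z := a + t%:C * (b - a) in
     cder f z (df z) /\ is_true (normc (df z) <= M)) ->
  normc (f b - f a) <= M * normc (b - a).
Proof.
move=> H; pose F t := f (a + t%:C * (b - a)).
have -> : f b = F 1 by rewrite /F realc1 mul1r subrKC.
have -> : f a = F 0 by rewrite /F realc0 mul0r addr0.
apply: (mean_value (d := fun t => df (a + t%:C * (b - a)) * (b - a))) => t t01.
  by apply: pder_comp; have [] := H t t01.
by rewrite Normc.normcM ler_wpM2r ?normc_ge0 //; have [] := H t t01.
Qed.

End Primitive.

(** * The complex exponential from its real and imaginary parts *)

Section ComplexExponential.
Context {R : realType}.
Implicit Types (w h : R[i]).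

Definition cexp w : R[i] :=
  (expR (cRe w) * cos (cIm w) +i* (expR (cRe w) * sin (cIm w)))%C.

Lemma cexpD w h : cexp (w + h) = cexp w * cexp h.
Proof.
apply: complex_ext; rewrite ?ReM ?ImM /= ReD ImD expRD ?cosD ?sinD; ring.
Qed.

Lemma normc_cexp w : normc (cexp w) = expR (cRe w).
Proof.
rewrite normcE /= !exprMn -mulrDr cos2Dsin2 mulr1 sqrtr_sqr ger0_norm // expR_ge0.
Qed.

Lemma cexp_neq0 w : cexp w != 0.
Proof. by rewrite -normc_gt0 normc_cexp expR_gt0. Qed.

Lemma cexp_period w : cexp (w + (0 +i* (pi *+ 2))%C) = cexp w.
Proof.
rewrite cexpD; set p := (X in _ * cexp X).
have -> : cexp p = 1 by rewrite /cexp /p expR0 cos2pi sin2pi mulr0 mulr1.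
by rewrite mulr1.
Qed.

Lemma cder_cexp0 (e : R) : 0 < e -> exists2 r : R, 0 < r &
  forall h, normc h < r -> normc (cexp h - 1 - h) <= e * normc h.
Proof.
move=> e0.
(* With [|h| <= e1 <= 1] the errors of the two parts add up to at most [9 * e1 * |h|], hence the
   margin 16. *)
have [e1 [e10 e1e e11]] : exists e1 : R, [/\ 0 < e1, e1 <= e / 16 & e1 <= 1].
  exists (Num.min (e / 16) 1); rewrite ge_min lexx ge_min lexx orbT lt_min ltr01.
  by split=> //; rewrite andbT divr_gt0.
have [r1 r10 H1] := is_derive_eps (is_derive_expR 0) e10.
have [r2 r20 H2] := is_derive_eps (is_derive_sin 0) e10.
have [r3 r30 H3] := is_derive_eps (is_derive_cos 0) e10.
exists (Num.min e1 (Num.min r1 (Num.min r2 r3))).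
  by rewrite !lt_min e10 r10 r20.
move=> h; rewrite !lt_min => /and4P[he h1 h2 h3].
have nx := Re_le_normc h; have ny := Im_le_normc h.
set x := cRe h in nx *; set y := cIm h in ny *; set n := normc h in nx ny he h1 h2 h3 *.
have n0 : 0 <= n by exact: normc_ge0.
have := H1 x; have := H2 y; have := H3 y.
rewrite !subr0 expR0 cos0 sin0 oppr0 mulr0 mulr1 !subr0 mulr1.
move=> /(_ (le_lt_trans ny h3)) A3 /(_ (le_lt_trans ny h2)) A2 /(_ (le_lt_trans nx h1)) A1.
apply: le_trans (normc_le_ReIm _) _; rewrite !(ReB, ImB) /= -/x -/y subr0.
set E := expR x in A1 *; set c := cos y in A3 *; set s := sin y in A2 *.
rewrite addr0 in A2.
have B1 : `|E - 1 - x| <= e1 * n by apply: le_trans A1 _; rewrite ler_wpM2l // ltW.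
have B2 : `|s - y| <= e1 * n by apply: le_trans A2 _; rewrite ler_wpM2l // ltW.
have B3 : `|c - 1| <= e1 * n by apply: le_trans A3 _; rewrite ler_wpM2l // ltW.
have en : e1 * n <= n by rewrite ler_piMl.
have C1 : `|E - 1| <= 2 * n.
  by rewrite -[E - 1](subrK x); apply: le_trans (ler_normD _ _) _; lra.
have C2 : `|s| <= 2 * n.
  by rewrite -[s](subrK y); apply: le_trans (ler_normD _ _) _; lra.
have D1 : `|E * c - 1 - x| <= e1 * n + (e1 * n + 2 * n * (e1 * n)).
  rewrite (_ : _ - x = (E - 1 - x) + ((c - 1) + (E - 1) * (c - 1))); last by ring.
  apply: le_trans (ler_normD _ _) _; apply: lerD => //.
  apply: le_trans (ler_normD _ _) _; apply: lerD => //.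
  by rewrite normrM ler_pM.
have D2 : `|E * s - y| <= e1 * n + 2 * n * (2 * n).
  rewrite (_ : _ - y = (s - y) + (E - 1) * s); last by ring.
  apply: le_trans (ler_normD _ _) _; apply: lerD => //.
  by rewrite normrM ler_pM.
have F1 : n * (e1 * n) <= 1 * (e1 * n) by rewrite ler_wpM2r ?mulr_ge0 // ?(ltW e10) //; lra.
have F2 : n * n <= e1 * n by rewrite ler_wpM2r // ltW.
have F3 : e1 * n <= e / 16 * n by rewrite ler_wpM2r.
have F4 : 0 <= e1 * n by rewrite mulr_ge0 // ltW.
lra.
Qed.

Lemma cder_cexp w : cder cexp w (cexp w).
Proof.
move=> e e0; have E0 : 0 < normc (cexp w) by rewrite normc_gt0 cexp_neq0.
have [r r0 Hr] := cder_cexp0 (divr_gt0 e0 E0); exists r => // h /Hr H.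
rewrite cexpD (_ : _ - _ = cexp w * (cexp h - 1 - h)); last by ring.
rewrite Normc.normcM; apply: le_trans (ler_wpM2l (ltW E0) H) _.
by rewrite mulrA mulrCA divff ?mulr1 // gt_eqF.
Qed.

End ComplexExponential.

(** * Cauchy's estimate at the centre of a disc *)

Section CauchyEstimate.
Context {R : realType}.

(* On the half-plane Re w < ln r the function (g (e^w) - g 0) e^-w has period
   2 i pi and a primitive K; the constant K (w + 2 i pi) - K w is
   2 i pi g'(0), as one sees for Re w -> -oo, and it is bounded by the values
   of g on any circle around 0. *)
Lemma cauchy_estimate0 (g : R[i] -> R[i]) d (r M : R) : 0 < r ->
  (forall z, normc z < r -> exists d, cder g z d) ->
  (forall z, normc z < r -> normc (g z) <= M) ->
  cder g 0 d -> normc d <= 4 * M / r.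
Proof.
move=> r0 hg bg dg.
pose H := [set w : R[i] | cRe w < ln r].
have cH : cconvex H.
  move=> a b t; rewrite /H /= => Ha Hb /andP[t0 t1].
  rewrite ReD ReM ReB /= mul0r subr0.
  have [t1'|t1'] := eqVneq t 1; first by rewrite t1'; lra.
  have {t1 t1'} : 0 < 1 - t by rewrite subr_gt0 lt_neqAle t1' t1.
  have := ler_wpM2l t0 (ltW Hb).
  move=> A B; have : (1 - t) * cRe a < (1 - t) * ln r by rewrite ltr_pM2l.
  lra.
have oH : copen H.
  move=> z; rewrite /H /= => zH; exists (ln r - cRe z); first by rewrite subr_gt0.
  move=> h hr; rewrite /= ReD; have := Re_le_normc h; have := ler_norm (cRe h); lra.
have small w : H w -> normc (cexp w) < r.
  by rewrite /H /= normc_cexp => wr; rewrite -[ltRHS]lnK ?posrE // ltr_expR.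
pose k w := (g (cexp w) - g 0) * (cexp w)^-1.
have hk : chol H k.
  move=> w Hw; have [d' dd'] := hg _ (small w Hw).
  have A := cderB (cder_comp (cder_cexp w) dd') (cder_cst (g 0) w).
  have B := cder_comp (cder_cexp w) (cder_inv (cexp_neq0 w)).
  by eexists; exact: cderM A B.
have [K HK] := primitive_exists cH oH hk.
pose p : R[i] := (0 +i* (pi *+ 2))%C.
have np : normc p = pi *+ 2.
  by rewrite normcE /= expr0n add0r sqrtr_sqr ger0_norm // mulrn_wge0 // pi_ge0.
have pi0 : 0 < (pi : R) *+ 2 by rewrite mulrn_wgt0 // pi_gt0.
have Hp w : H w -> H (w + p) by rewrite /H /= ReD /= addr0.
have Hseg w t : H w -> H (w + t%:C * (w + p - w)).
  by rewrite /H /= ReD ReM ReB ReD /= !mul0r addr0 !subrr mulr0 subr0 addr0.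
have kp w : k (w + p) = k w by rewrite /k cexp_period.
have Kc w w' : H w -> H w' -> K (w + p) - K w = K (w' + p) - K w'.
  move=> Hw Hw'; apply/eqP; rewrite -subr_eq0; apply/eqP/Normc.eq0_normc/eqP.
  rewrite eq_le normc_ge0 andbT.
  have := @mean_value_segment _ (fun w => K (w + p) - K w) (fun w => k (w + p) - k w) w' w 0.
  rewrite mul0r; apply => t t01 /=; have Ht := cH _ _ _ Hw' Hw t01.
  split; last by rewrite kp subrr Normc.normc0.
  apply: cderB (HK _ Ht); move=> e e0; have [s s0 Hs] := HK _ (Hp _ Ht) e e0.
  by exists s => // h /Hs; rewrite [_ + p + h]addrAC.
(* On the line [Re w = ln (r / 2)] one has [|e^w| = r / 2], so [|k| <= 2 * M / (r / 2)]. This is the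
   constant [4 * M / r]; the length of the period then cancels from both sides. *)
pose c := K ((ln (r / 2))%:C + p) - K (ln (r / 2))%:C.
have H2 : H (ln (r / 2))%:C by rewrite /H /= ltr_ln ?posrE; lra.
have cM : normc c <= 4 * M / r * (pi *+ 2).
  rewrite -np -[p](addrK (ln (r / 2))%:C) [p + _]addrC.
  apply: (@mean_value_segment _ K k) => t t01 /=.
  split; first by apply: HK; apply: Hseg.
  have Hw := Hseg _ t H2; set w := _ + _ in Hw *.
  have wE : normc (cexp w) = r / 2.
    rewrite normc_cexp /w ReD ReM ReB ReD /= !mul0r addr0 subrr mulr0 subr0 addr0.
    by rewrite lnK // posrE; lra.
  rewrite /k Normc.normcM Normc.normcV wE.
  have : normc (g (cexp w) - g 0) <= M + M.
    apply: le_trans (normcB _ _) _; apply: lerD; apply: bg => //; last by rewrite Normc.normc0.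
    exact: small.
  move=> A; apply: (@le_trans _ _ ((M + M) * (r / 2)^-1)).
    by rewrite ler_wpM2r // invr_ge0; lra.
  apply: le_of_eq; field; lra.
have cd : c = d * p.
  apply/eqP; rewrite -subr_eq0; apply/eqP.
  apply: (@normc_le_small _ _ (pi *+ 2)) => e e0.
  have [s s0 Hs] := dg e e0.
  pose m := Num.min r s / 2.
  have m0 : 0 < m by rewrite /m divr_gt0 // lt_min r0.
  have : m < Num.min r s by move: m0; rewrite /m; lra.
  rewrite lt_min => /andP[mr ms].
  have Hx : H (ln m)%:C by rewrite /H /= ltr_ln ?posrE.
  rewrite /c (Kc _ _ H2 Hx).
  rewrite (_ : _ - _ - _ = (K ((ln m)%:C + p) - d * ((ln m)%:C + p)) - (K (ln m)%:C - d * (ln m)%:C)); last by ring.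
  have -> : pi *+ 2 * e = e * normc ((ln m)%:C + p - (ln m)%:C).
    by rewrite -np mulrC; congr (_ * normc _); ring.
  apply: (@mean_value_segment _ (fun w => K w - d * w) (fun w => k w - d)) => t t01 /=.
  have Hw := Hseg _ t Hx; set w := _ + _ in Hw *.
  split.
    by have := cderB (HK _ Hw) (cderZ d (cder_id w)); rewrite mulr1.
  have wE : normc (cexp w) = m.
    rewrite normc_cexp /w ReD ReM ReB ReD /= !mul0r addr0 subrr mulr0 subr0 addr0.
    by rewrite lnK // posrE.
  rewrite (_ : k w - d = (g (0 + cexp w) - g 0 - d * cexp w) * (cexp w)^-1); last first.
    by rewrite add0r /k; field; exact: cexp_neq0.
  rewrite Normc.normcM Normc.normcV wE ler_pdivrMr // -[X in e * X]wE.
  by apply: Hs; rewrite wE.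
by move: cM; rewrite cd Normc.normcM np ler_pM2r.
Qed.

End CauchyEstimate.

(** * Bounded holomorphic functions on a disc *)

Section OneVariable.
Context {R : realType}.
Implicit Types (f g k : R[i] -> R[i]) (a z w h d : R[i]) (r M : R).

Definition bhol f a r M := forall z, normc (z - a) < r ->
  (exists d, cder f z d) /\ normc (f z) <= M.

Definition dv f z : R[i] := xget 0 [set d | cder f z d].

Lemma dvP f z : (exists d, cder f z d) -> cder f z (dv f z).
Proof. by move=> H; have := @xgetPex _ 0 [set d | cder f z d] H. Qed.

Lemma dvE f z d : cder f z d -> dv f z = d.
Proof. by move=> dd; have := cder_uniq (dvP (ex_intro _ d dd)) dd. Qed.

Lemma cder_shift f a z d : cder f (a + z) d -> cder (fun w => f (a + w)) z d.
Proof. by move=> H e /H[r r0 Hr]; exists r => // h /Hr; rewrite addrA. Qed.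

Lemma cder_quad f z d r C : 0 < r ->
  (forall h, normc h < r -> normc (f (z + h) - f z - d * h) <= C * normc h ^+ 2) ->
  cder f z d.
Proof.
move=> r0 H e e0; have C1 : 0 < `|C| + 1 by rewrite ltr_wpDl.
exists (Num.min r (e / (`|C| + 1))); first by rewrite lt_min r0 divr_gt0.
move=> h; rewrite lt_min => /andP[/H A]; rewrite ltr_pdivlMr // => B.
apply: le_trans A _; rewrite expr2 mulrA ler_wpM2r ?normc_ge0 //.
apply: le_trans (ltW B); rewrite mulrC ler_wpM2l ?normc_ge0 //.
by rewrite (le_trans (ler_norm _)) // lerDl.
Qed.

Lemma bhol_ge0 f a r M : 0 < r -> bhol f a r M -> 0 <= M.
Proof.
move=> r0 H; have [|_ A] := H a; first by rewrite subrr Normc.normc0.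
exact: le_trans (normc_ge0 _) A.
Qed.

Lemma bhol_sub f a r M b s : bhol f a r M -> normc (b - a) + s <= r -> bhol f b s M.
Proof.
move=> H ab z zb; apply: H; apply: le_lt_trans (distc_triangle b _ _) _; lra.
Qed.

Lemma bhol_shift f a r M : bhol f a r M -> bhol (fun z => f (a + z)) 0 r M.
Proof.
move=> H z; rewrite subr0 => zr; have [|[d dd] fz] := H (a + z); first by rewrite addrC addKr.
by split=> //; exists d; apply: cder_shift.
Qed.

Lemma bholB f g a r M N : bhol f a r M -> bhol g a r N ->
  bhol (fun z => f z - g z) a r (M + N).
Proof.
move=> F G z zr; have [[d dd] fM] := F z zr; have [[d' dd'] gN] := G z zr.
split; first by exists (d - d'); apply: cderB.
by apply: le_trans (normcB _ _) _; apply: lerD.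
Qed.

Lemma cauchy_estimate f a r M d : 0 < r -> bhol f a r M -> cder f a d ->
  normc d <= 4 * M / r.
Proof.
move=> r0 /bhol_shift H dd.
apply: (@cauchy_estimate0 _ (fun z => f (a + z))) => // [z zr|z zr|].
- by have [|] := H z; first by rewrite subr0.
- by have [|] := H z; first by rewrite subr0.
- by apply: cder_shift; rewrite addr0.
Qed.

Lemma ball_segment a r z w (t : R) : normc (z - a) < r -> normc (w - a) < r ->
  0 <= t <= 1 -> normc (z + t%:C * (w - z) - a) < r.
Proof.
move=> za wa /andP[t0 t1].
rewrite (_ : _ - a = (1 - t)%:C * (z - a) + t%:C * (w - a)); last by rewrite !realcE; ring.
apply: le_lt_trans (normcD _ _) _; rewrite !Normc.normcM !normc_real (ger0_norm t0) ger0_norm ?subr_ge0 //.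
have [->|t1'] := eqVneq t 1; first by lra.
have {}t1 : 0 < 1 - t by rewrite subr_gt0 lt_neqAle t1'.
have := ler_wpM2l t0 (ltW wa).
have : (1 - t) * normc (z - a) < (1 - t) * r by rewrite ltr_pM2l.
lra.
Qed.

Lemma bhol_deriv f a r M z : 0 < r -> bhol f a r M -> normc (z - a) < r / 2 ->
  cder f z (dv f z) /\ normc (dv f z) <= 8 * M / r.
Proof.
move=> r0 H zr; have [|dz _] := H z; first by lra.
split; first exact: dvP.
have Hz : bhol f z (r / 2) M by apply: bhol_sub H _; lra.
have r2 : 0 < r / 2 by lra.
have := cauchy_estimate r2 Hz (dvP dz); rewrite (_ : 4 * M / (r / 2) = 8 * M / r) //.
by field; lra.
Qed.

Lemma bhol_lip f a r M z w : 0 < r -> bhol f a r M ->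
  normc (z - a) < r / 2 -> normc (w - a) < r / 2 ->
  normc (f z - f w) <= 8 * M / r * normc (z - w).
Proof.
move=> r0 H zr wr; apply: (mean_value_segment (df := dv f)) => t t01 /=.
by apply: bhol_deriv H _ => //; apply: ball_segment.
Qed.

(** Cauchy's estimate is applied to the difference of two translates of [f], which is small by
    [bhol_lip]; no second derivative appears. The constant is [4 * (8 * M / r) / (r / 4)]. *)
Lemma bhol_dlip f a r M z w : 0 < r -> bhol f a r M ->
  normc (z - a) < r / 4 -> normc (w - a) < r / 4 ->
  normc (dv f z - dv f w) <= 128 * M / r ^+ 2 * normc (z - w).
Proof.
move=> r0 H zr wr; have r4 : 0 < r / 4 by lra.
have Hz : bhol (fun u => f (z + u) - f (w + u)) 0 (r / 4) (8 * M / r * normc (z - w)).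
  move=> u; rewrite subr0 => ur.
  have zu : normc (z + u - a) < r / 2.
    by rewrite addrAC; apply: le_lt_trans (normcD _ _) _; lra.
  have wu : normc (w + u - a) < r / 2.
    by rewrite addrAC; apply: le_lt_trans (normcD _ _) _; lra.
  have [d1 _] := bhol_deriv r0 H zu; have [d2 _] := bhol_deriv r0 H wu.
  split; first by eexists; apply: cderB; apply: cder_shift; [exact: d1|exact: d2].
  have := bhol_lip r0 H zu wu; rewrite (_ : z + u - (w + u) = z - w) //; ring.
have [d1 _] := bhol_deriv (z := z) r0 H ltac:(lra).
have [d2 _] := bhol_deriv (z := w) r0 H ltac:(lra).
have := cauchy_estimate (d := dv f z - dv f w) r4 Hz.
rewrite (_ : 4 * _ / _ = 128 * M / r ^+ 2 * normc (z - w)); last by field; lra.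
by apply; apply: cderB; apply: cder_shift; rewrite addr0.
Qed.

Lemma bhol_taylor2 f a r M z h : 0 < r -> bhol f a r M ->
  normc (z - a) < r / 4 -> normc (z + h - a) < r / 4 ->
  normc (f (z + h) - f z - dv f z * h) <= 128 * M / r ^+ 2 * normc h ^+ 2.
Proof.
move=> r0 H zr hr; have M0 := bhol_ge0 r0 H.
rewrite (_ : _ - _ = (f (z + h) - dv f z * (z + h)) - (f z - dv f z * z)); last by ring.
rewrite expr2 mulrA.
have -> : 128 * M / r ^+ 2 * normc h * normc h = 128 * M / r ^+ 2 * normc h * normc (z + h - z).
  by congr (_ * normc _); ring.
apply: (mean_value_segment (df := fun w => dv f w - dv f z) (f := fun w => f w - dv f z * w)) => t t01 /=.
have zt := ball_segment zr hr t01; set w := z + t%:C * (z + h - z) in zt *.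
have [dw _] := bhol_deriv (z := w) r0 H ltac:(lra).
split; first by have := cderB dw (cderZ (dv f z) (cder_id w)); rewrite mulr1.
apply: le_trans (bhol_dlip r0 H zt zr) _; rewrite ler_wpM2l //.
  by rewrite mulr_ge0 ?invr_ge0 ?exprn_ge0 ?mulr_ge0 // ltW.
rewrite /w (_ : _ - z = t%:C * h); last by ring.
case/andP: t01 => t0 t1.
by rewrite Normc.normcM normc_real ger0_norm // ler_piMl ?normc_ge0.
Qed.

(** The difference quotients of [dv f] at [a] with steps [h] and [k] differ by the derivative at 0
    of a function [g], a difference of quotients of [f]. Both quotients approximate [dv f (a + z)],
    so [g] is of size [|h| + |k|], and Cauchy's estimate hands this bound to its derivative.
    [complex_limit] then produces [L], with a remainder bound. *)
Lemma bhol_deriv2 f a r M : 0 < r -> bhol f a r M ->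
  exists L C, forall h, normc h < r / 16 ->
    normc (dv f (a + h) - dv f a - L * h) <= C * normc h ^+ 2.
Proof.
move=> r0 H; pose T := {h : R[i] | 0 < normc h < r / 16}.
pose q (h : T) := (dv f (a + sval h) - dv f a) / sval h.
pose C := 4 * (128 * M / r ^+ 2) / (r / 16).
have r16 : 0 < r / 16 by lra.
have nz (h : T) : sval h != 0 by have /andP[] := svalP h; rewrite normc_gt0.
have [i j|L LP] := @complex_limit R T q (fun t : T => C * normc (sval t)).
  have /andP[i0 ir] := svalP i; have /andP[j0 jr] := svalP j.
  have := nz i; have := nz j; rewrite /q; set h := sval i in i0 ir *; set k := sval j in j0 jr *.
  move=> k0 h0.
  pose g z := (f (a + h + z) - f (a + z)) / h - (f (a + k + z) - f (a + z)) / k.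
  have Hg : bhol g 0 (r / 16) (128 * M / r ^+ 2 * (normc h + normc k)).
    move=> z; rewrite subr0 => zr.
    have az : normc (a + z - a) < r / 16 by rewrite addrAC subrr add0r.
    have ahz : normc (a + h + z - a) < r / 8.
      by rewrite (_ : _ - a = h + z); [apply: le_lt_trans (normcD _ _) _; lra | ring].
    have akz : normc (a + k + z - a) < r / 8.
      by rewrite (_ : _ - a = k + z); [apply: le_lt_trans (normcD _ _) _; lra | ring].
    have [d1 _] := bhol_deriv (z := a + z) r0 H ltac:(lra).
    have [d2 _] := bhol_deriv (z := a + h + z) r0 H ltac:(lra).
    have [d3 _] := bhol_deriv (z := a + k + z) r0 H ltac:(lra).
    split.
      eexists; apply: cderB.
        apply: (@cder_ext _ (fun z => h^-1 * (f (a + h + z) - f (a + z)))).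
          by exists 1 => // u _; rewrite mulrC.
        by apply: cderZ; apply: cderB; apply: cder_shift; [exact: d2|exact: d1].
      apply: (@cder_ext _ (fun z => k^-1 * (f (a + k + z) - f (a + z)))).
        by exists 1 => // u _; rewrite mulrC.
      by apply: cderZ; apply: cderB; apply: cder_shift; [exact: d3|exact: d1].
    have q1 (u : R[i]) : u != 0 -> normc (a + u + z - a) < r / 8 ->
        normc ((f (a + u + z) - f (a + z)) / u - dv f (a + z)) <= 128 * M / r ^+ 2 * normc u.
      move=> u0 ur; have nu : 0 < normc u by rewrite normc_gt0.
      rewrite -(ler_pM2r nu) -Normc.normcM mulrBl divfK // -[leRHS]mulrA -expr2.
      have := @bhol_taylor2 f a r M (a + z) u r0 H ltac:(lra).
      rewrite [a + z + u]addrAC; apply; lra.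
    rewrite /g (_ : _ - _ = ((f (a + h + z) - f (a + z)) / h - dv f (a + z)) -
       ((f (a + k + z) - f (a + z)) / k - dv f (a + z))); last by ring.
    by apply: le_trans (normcB _ _) _; rewrite mulrDr lerD // q1.
  have := cauchy_estimate (d := (dv f (a + h) - dv f a) / h - (dv f (a + k) - dv f a) / k) r16 Hg.
  rewrite (_ : 4 * _ / _ = C * normc h + C * normc k); last by rewrite /C; ring.
  apply.
  have [d1 _] := bhol_deriv (z := a) r0 H ltac:(rewrite subrr Normc.normc0; lra).
  have [d2 _] := bhol_deriv (z := a + h) r0 H ltac:(rewrite addrAC subrr add0r; lra).
  have [d3 _] := bhol_deriv (z := a + k) r0 H ltac:(rewrite addrAC subrr add0r; lra).
  apply: cderB.
    rewrite mulrC; apply: (@cder_ext _ (fun z => h^-1 * (f (a + h + z) - f (a + z)))).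
      by exists 1 => // u _; rewrite mulrC.
    by apply: cderZ; apply: cderB; apply: cder_shift; rewrite addr0.
  rewrite mulrC; apply: (@cder_ext _ (fun z => k^-1 * (f (a + k + z) - f (a + z)))).
    by exists 1 => // u _; rewrite mulrC.
  by apply: cderZ; apply: cderB; apply: cder_shift; rewrite addr0.
exists L, (2 * C) => h hr; have [->|h0] := eqVneq h 0.
  by rewrite addr0 subrr mulr0 subr0 Normc.normc0 expr2 !mulr0.
have nh : 0 < normc h by rewrite normc_gt0.
have hP : 0 < normc h < r / 16 by rewrite nh.
have := LP (exist _ h hP); rewrite /q /= -(ler_pM2r nh) -Normc.normcM mulrBl divfK //.
by move=> /le_trans; apply; rewrite expr2; apply: le_of_eq; ring.
Qed.

(** Removable singularity of [f z / z], whose derivative at 0 is half the [L] of [bhol_deriv2]. The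
    bound comes from the Lipschitz constant for [|z| < r / 2] and from [1 / |z| <= 2 / r] elsewhere.
    The radius is not reduced, so the division can be iterated. *)
Lemma bhol_div f r M : 0 < r -> bhol f 0 r M -> f 0 = 0 ->
  exists2 k, bhol k 0 r (M * (8 / r)) & forall z, f z = z * k z.
Proof.
move=> r0 H f0; have M0 := bhol_ge0 r0 H.
pose k z := if z == 0 then dv f 0 else f z * z^-1.
have kE z : z != 0 -> k z = f z * z^-1 by rewrite /k => /negbTE ->.
exists k => [z|z]; last first.
  have [->|z0] := eqVneq z 0; first by rewrite f0 mul0r.
  by rewrite kE // mulrCA divff ?mulr1.
rewrite subr0 => zr; have [z0|z0] := eqVneq z 0; last first.
  have nz : 0 < normc z by rewrite normc_gt0.
  have [|[d dd] fM] := H z; first by rewrite subr0.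
  split.
    eexists; apply: cder_ext (cderM dd (cder_inv z0)).
    exists (normc z) => // h hz; rewrite kE //.
    by rewrite -normc_gt0; have := normc_sub_le z (- h); rewrite opprK normcN; lra.
  rewrite kE // Normc.normcM Normc.normcV ler_pdivrMr //.
  have [zr2|zr2] := ltP (normc z) (r / 2).
    have := @bhol_lip f 0 r M z 0 r0 H; rewrite !subr0 f0 subr0 => /(_ zr2).
    rewrite Normc.normc0 => /(_ ltac:(lra))/le_trans; apply.
    by apply: le_of_eq; field; lra.
  apply: le_trans fM _; rewrite -mulrA ler_peMr // mulrAC ler_pdivlMr // mul1r; lra.
rewrite z0; have c0 : normc (0 - 0 : R[i]) < r / 2 by rewrite subrr Normc.normc0; lra.
have [d0 d0M] := bhol_deriv r0 H c0.
split; last by rewrite /k eqxx (_ : M * (8 / r) = 8 * M / r) //; field; lra.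
have [L [C LP]] := bhol_deriv2 r0 H.
have r16 : 0 < r / 16 by lra.
exists (L / 2); apply: (@cder_quad _ _ _ (r / 16) `|C|) => // h hr.
rewrite add0r; have [->|h0] := eqVneq h 0.
  by rewrite subrr mulr0 subr0 Normc.normc0 expr2 !mulr0.
have nh : 0 < normc h by rewrite normc_gt0.
rewrite [k 0]/k eqxx kE // -(ler_pM2r nh) -Normc.normcM.
rewrite (_ : (f h * h^-1 - dv f 0 - L / 2 * h) * h = (f h - dv f 0 * h - L / 2 * (h * h)) - (f 0 - dv f 0 * 0 - L / 2 * (0 * 0))); last first.
  by rewrite f0; field; exact: h0.
have -> : `|C| * normc h ^+ 2 * normc h = `|C| * normc h ^+ 2 * normc (h - 0).
  by rewrite subr0.
apply: (@mean_value_segment R (fun w => f w - dv f 0 * w - L / 2 * (w * w))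
  (fun w => dv f w - dv f 0 - L / 2 * (w + w))) => t /andP[t0 t1] /=.
rewrite add0r subr0.
have th : normc (t%:C * h) <= normc h.
  by rewrite Normc.normcM normc_real ger0_norm // ler_piMl ?normc_ge0.
set w := _ * _ in th *; have [dw _] := bhol_deriv (z := w) r0 H ltac:(rewrite subr0; lra).
split.
  have := cderB (cderB dw (cderZ (dv f 0) (cder_id w))) (cderZ (L / 2) (cder_sqr w)).
  by rewrite mulr1.
rewrite (_ : L / 2 * (w + w) = L * w); last by field.
have := LP w; rewrite add0r => /(_ ltac:(lra))/le_trans; apply.
apply: (@le_trans _ _ (`|C| * normc w ^+ 2)); first by rewrite ler_wpM2r ?exprn_ge0 ?normc_ge0 ?ler_norm.
by rewrite ler_wpM2l // ler_pXn2r ?nnegrE ?normc_ge0.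
Qed.

End OneVariable.

(** * Leading coefficients, the identity theorem and Harnack's inequality *)

Section LeadingCoefficient.
Context {R : realType}.
Implicit Types (f g k : R[i] -> R[i]) (a c z w h : R[i]) (r M : R).

(** For holomorphic [f], the Taylor coefficient of order [m], once all lower ones vanish. This
    one-term expansion replaces power series. *)
Definition lead f m c := forall e : R, 0 < e -> exists2 r : R, 0 < r &
  forall z, normc z < r -> normc (f z - z ^+ m * c) <= e * normc z ^+ m.

Lemma lead_uniq f m c c' : lead f m c -> lead f m c' -> c = c'.
Proof.
move=> L L'; apply/eqP; rewrite -subr_eq0; apply/eqP.
apply: (@normc_le_small _ _ 2) => e e0.
have [r r0 Hr] := L _ e0; have [s s0 Hs] := L' _ e0.
pose t := Num.min r s / 2.
have t0 : 0 < t by rewrite /t divr_gt0 // lt_min r0.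
have : t < Num.min r s by rewrite /t; move: t0; rewrite /t; lra.
rewrite lt_min => /andP[tr ts].
have nt : normc (t%:C) = t by rewrite normc_real gtr0_norm.
have tm : 0 < t ^+ m by rewrite exprn_gt0.
have := Hr t%:C; have := Hs t%:C; rewrite nt => /(_ ts) B /(_ tr) A.
rewrite -(ler_pM2l tm) -{1}nt -normcX -Normc.normcM.
rewrite (_ : t%:C ^+ m * (c - c') = (f t%:C - t%:C ^+ m * c') - (f t%:C - t%:C ^+ m * c)); last by ring.
apply: le_trans (normcB _ _) _; apply: le_trans (lerD B A) _.
by apply: le_of_eq; ring.
Qed.

Lemma lead_bhol k f r M m : 0 < r -> bhol k 0 r M ->
  (forall z, normc z < r -> f z = z ^+ m * k z) -> lead f m (k 0).
Proof.
move=> r0 H E e e0; have [|[d dd] _] := H 0; first by rewrite subrr Normc.normc0.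
have [s s0 Hs] := cder_cont dd e0.
exists (Num.min r s); first by rewrite lt_min r0.
move=> z; rewrite lt_min => /andP[zr zs]; rewrite E // -mulrBr Normc.normcM normcX mulrC.
by rewrite ler_wpM2r ?exprn_ge0 ?normc_ge0 //; have := Hs z zs; rewrite add0r.
Qed.

Lemma factor_power f r M m : 0 < r -> bhol f 0 r M ->
  (forall j, (j < m)%N -> lead f j 0) ->
  exists2 k, bhol k 0 r (M * (8 / r) ^+ m) & forall z, f z = z ^+ m * k z.
Proof.
move=> r0 H; elim: m => [_|m IH L].
  by exists f => [|z]; rewrite ?expr0 ?mulr1 // mul1r.
have [|k Hk E] := IH; first by move=> j jm; apply: L; apply: ltnW.
have k0 : k 0 = 0.
  by apply: (lead_uniq (f := f) (m := m)); [apply: (lead_bhol r0 Hk) => z _; exact: E | exact: L].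
have [k' Hk' E'] := bhol_div r0 Hk k0.
exists k' => [|z].
  by rewrite (_ : M * _ = M * (8 / r) ^+ m * (8 / r)) // exprSr; ring.
by rewrite E E' exprSr mulrA.
Qed.

(** Dividing by [z ^+ m] for every [m] bounds [|f z|] by [M * (8 * |z| / r) ^+ m], and
    [|z| < r / 16] makes the base at most 1/2. *)
Lemma lead_flat f r M z : 0 < r -> bhol f 0 r M -> (forall j, lead f j 0) ->
  normc z < r / 16 -> f z = 0.
Proof.
move=> r0 H L zr; have M0 := bhol_ge0 r0 H.
apply: (@normc_le_small _ _ M) => e e0; have [m me] := exp_half_small e0.
have [k Hk ->] := factor_power r0 H (fun j _ => L j) (m := m).
rewrite Normc.normcM normcX.
have [|_ kM] := Hk z; first by rewrite subr0; lra.
apply: le_trans (ler_wpM2l _ kM) _; first by rewrite exprn_ge0 ?normc_ge0.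
rewrite mulrCA -exprMn ler_wpM2l //; apply: le_trans (ltW me).
apply: lerXn2r; rewrite ?nnegrE ?mulr_ge0 ?normc_ge0 ?invr_ge0 ?(ltW r0) //.
by rewrite mulrA ler_pdivrMr //; lra.
Qed.

Lemma lead_near0 f r m : 0 < r -> (forall h, normc h < r -> f h = 0) -> lead f m 0.
Proof.
move=> r0 H e e0; exists r => // z /H ->.
by rewrite mulr0 subr0 Normc.normc0 mulr_ge0 ?(ltW e0) ?exprn_ge0 ?normc_ge0.
Qed.

Lemma chol_bhol (O : set R[i]) f z : copen O -> chol O f -> O z ->
  exists r M, 0 < r /\ bhol (fun h => f (z + h)) 0 r M.
Proof.
move=> oO hf Oz; have [r r0 Hr] := oO z Oz; have [d dd] := hf z Oz.
have [s s0 Hs] := cder_cont dd ltr01.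
exists (Num.min r s), (normc (f z) + 1); rewrite lt_min r0; split=> // h.
rewrite subr0 lt_min => /andP[hr hs]; have [d' dd'] := hf _ (Hr h hr).
split; first by exists d'; apply: cder_shift.
rewrite -[f (z + h)](subrK (f z)) addrC; apply: le_trans (normcD _ _) _.
by rewrite lerD2l Hs.
Qed.

(** The set of [t] near which [f] vanishes is followed from 0 along the segment; its supremum can be
    passed because vanishing near a point gives flatness there, hence vanishing on a disc whose
    radius does not depend on that point. *)
Lemma identity_segment (O : set R[i]) f : cconvex O -> copen O -> chol O f ->
  O 0 -> O 1 -> (forall j, lead f j 0) -> f 1 = 0.
Proof.
move=> cO oO hf O0 O1 L.
pose A := [set t : R | 0 <= t <= 1 /\
  exists2 e : R, 0 < e & forall h, normc h < e -> f (t%:C + h) = 0].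
have Ot (t : R) : 0 <= t <= 1 -> O t%:C.
  by move=> t01; have := cO _ _ t O0 O1 t01; rewrite add0r subr0 mulr1.
have A0 : A 0.
  split; first by rewrite lexx ler01.
  have [r [M [r0 H]]] := chol_bhol oO hf O0; exists (r / 16); first by lra.
  move=> h hr; rewrite realc0; apply: (@lead_flat (fun h => f (0 + h)) r M h r0 H _ hr).
  move=> j e e0; have [s s0 Hs] := L j e e0; by exists s => // z /Hs; rewrite add0r.
have hs : has_sup A.
  split; first by exists 0; exact: A0.
  by exists 1 => t [/andP[_ ?] _].
set T := sup A.
have T01 : 0 <= T <= 1.
  rewrite /T ub_le_sup //=; last by case: hs.
  by apply: ge_sup; [case: hs | move=> t [/andP[_ ?] _]].
have [r [M [r0 H]]] := chol_bhol oO hf (Ot T T01).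
have r64 : 0 < r / 64 by lra.
have [t [t01 [e e0 He]]] := sup_adherent r64 hs; rewrite -/T => Tt.
have tT : t <= T by apply: ub_le_sup; [case: hs | split=> //; exists e].
have Tt' : normc (t - T)%:C <= r / 64 by rewrite normc_real distrC ger0_norm ?subr_ge0; lra.
(* The disc of this radius around [t] stays in the disc of radius [r] around [T]. Flatness at [t]
   yields zeros up to distance [3 / 64 * r]: at most [r / 32] is spent on reaching [s < T + r / 64],
   and [r / 64] is left for a neighbourhood of [s]. *)
have r34 : 0 < 3 / 4 * r by lra.
have Ht : bhol (fun h => f (t%:C + h)) 0 (3 / 4 * r) M.
  have := bhol_shift (bhol_sub (b := (t - T)%:C) (s := 3 / 4 * r) H _).
  rewrite subr0 (_ : (fun z => f (T%:C + ((t - T)%:C + z))) = (fun h => f (t%:C + h))).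
    by apply; lra.
  by apply/funext => z; rewrite addrA realcB subrKC.
have Z h : normc h < 3 / 64 * r -> f (t%:C + h) = 0.
  move=> hr; apply: (@lead_flat (fun h => f (t%:C + h)) _ _ _ r34 Ht); last by lra.
  by move=> j; apply: lead_near0 e0 He.
have Zs (s : R) : 0 <= s <= 1 -> T <= s < T + r / 64 -> A s.
  move=> s01 /andP[Ts sT]; split=> //; exists (r / 64) => // h hr.
  rewrite (_ : s%:C + h = t%:C + ((s - t)%:C + h)); last by rewrite realcB; ring.
  apply: Z; apply: le_lt_trans (normcD _ _) _.
  by rewrite normc_real ger0_norm ?subr_ge0; lra.
have T1 : 1 < T + r / 64.
  rewrite ltNge; apply/negP => TB.
  suff : T + r / 128 <= T by lra.
  apply: ub_le_sup; first by case: hs.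
  by case/andP: T01 => T0 T1; apply: Zs; apply/andP; split; lra.
have T1' : T <= 1 by case/andP: T01.
have [_ [d d0 Hd]] := Zs 1 ltac:(by rewrite ler01 lexx) ltac:(by rewrite T1' T1).
by have := Hd 0; rewrite addr0 realc1 Normc.normc0; apply.
Qed.

(** The Cayley transform [k] of [f] at [f a] maps into the unit disc and vanishes at [a]; its
    Lipschitz constant [8 / r] gives [|k b| <= 1 / 2] at distance [r / 16]. Undoing the transform
    gives both bounds. *)
Lemma harnack f a b r : 0 < r ->
  (forall z, normc (z - a) < r -> (exists d, cder f z d) /\ 0 < cRe (f z)) ->
  normc (b - a) <= r / 16 ->
  cRe (f a) / 3 <= cRe (f b) /\ normc (f b - f a) <= 2 * cRe (f a).
Proof.
move=> r0 H ba; pose ca := conjc (f a).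
have caE : cRe ca = cRe (f a) /\ cIm ca = - cIm (f a) by rewrite /ca; case: (f a).
have [|_ ra] := H a; first by rewrite subrr Normc.normc0.
pose k z := (f z - f a) * (f z + ca)^-1.
have sqE z : normc (f z + ca) ^+ 2 = normc (f z - f a) ^+ 2 + 4 * cRe (f z) * cRe (f a).
  rewrite !sqr_normcE !(ReD, ImD, ReN, ImN) caE.1 caE.2; ring.
have den z : normc (z - a) < r -> f z + ca != 0.
  move=> /H[_ fz]; rewrite -normc_gt0.
  by have := Re_le_normc (f z + ca); rewrite ReD caE.1; have := ler_norm (cRe (f z) + cRe (f a)); lra.
have leq z : normc (z - a) < r -> normc (f z - f a) <= normc (f z + ca).
  move=> zr; have [_ fz] := H z zr.
  rewrite -(ler_pXn2r (n := 2)) ?nnegrE ?normc_ge0 // sqE lerDl.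
  by rewrite !mulr_ge0 ?ltW.
have Hk : bhol k a r 1.
  move=> z zr; have [[d dd] fz] := H z zr; split.
    eexists; apply: cderM (cderB dd (cder_cst (f a) z)) _.
    exact: cder_comp (cderD dd (cder_cst ca z)) (cder_inv (den z zr)).
  rewrite /k Normc.normcM Normc.normcV ler_pdivrMr ?mul1r ?leq //.
  by rewrite normc_gt0 den.
have br : normc (b - a) < r by lra.
have : normc (k b) <= 1 / 2.
  have := @bhol_lip R k a r 1 b a r0 Hk; rewrite subrr Normc.normc0 /k subrr mul0r subr0.
  move=> /(_ ltac:(lra) ltac:(lra))/le_trans; apply.
  by rewrite mulr1 mulrAC ler_pdivrMr //; lra.
rewrite /k Normc.normcM Normc.normcV ler_pdivrMr ?normc_gt0 ?den // => kb.
have [_ fb] := H b br; have := sqE b.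
have := normc_ge0 (f b - f a); have := normc_ge0 (f b + ca).
have := Re_le_normc (f b - f a); rewrite ReB ler_norml => /andP[re1 re2].
have tri : normc (f b + ca) <= normc (f b - f a) + 2 * cRe (f a).
  rewrite (_ : f b + ca = (f b - f a) + (2 * cRe (f a))%:C); last first.
    by apply: complex_ext; rewrite !(ReD, ImD, ReN, ImN) ?caE.1 ?caE.2 /=; ring.
  by apply: le_trans (normcD _ _) _; rewrite normc_real ger0_norm // mulr_ge0 // ltW.
move: kb tri re1 re2 ra fb.
move: (normc (f b + ca)) (normc (f b - f a)) (cRe (f b)) (cRe (f a)).
move=> S D x y kb tri re1 re2 ra fb S0 D0 E.
split; last by lra.
rewrite leNgt; apply/negP => xy; nra.
Qed.

End LeadingCoefficient.

(** * Real-valued norms on complex normed modules *)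

Section VectorNorm.
Context {R : realType}.

(** Norms of modules over [R[i]] take values in [R[i]]; this brings them back to [R], and
    [normr_nrm] shows that nothing is lost. On row vectors it is the maximum norm. *)
Definition nrm {V : normedModType R[i]} (x : V) : R := cRe `|x|.

Section Generic.
Context {V : normedModType R[i]}.
Implicit Types x y : V.

Lemma normr_nrm x : `|x| = (nrm x)%:C.
Proof.
have /ger0_Im H : 0 <= `|x| := normr_ge0 x.
by apply: complex_ext => //=; rewrite H.
Qed.

Lemma nrm_ge0 x : 0 <= nrm x.
Proof. by have := normr_ge0 x; rewrite normr_nrm lecR. Qed.

Lemma nrmD x y : nrm (x + y) <= nrm x + nrm y.
Proof. by have := ler_normD x y; rewrite !normr_nrm -realcD lecR. Qed.

Lemma nrmN x : nrm (- x) = nrm x.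
Proof. by rewrite /nrm normrN. Qed.

Lemma nrmB x y : nrm (x - y) <= nrm x + nrm y.
Proof. by rewrite -[nrm y]nrmN nrmD. Qed.

Lemma nrm_distC x y : nrm (x - y) = nrm (y - x).
Proof. by rewrite -nrmN opprB. Qed.

Lemma nrm0 : nrm (0 : V) = 0.
Proof. by rewrite /nrm normr0. Qed.

Lemma nrm_eq0 x : nrm x = 0 -> x = 0.
Proof. by move=> x0; apply/eqP; rewrite -normr_eq0 normr_nrm x0. Qed.

Lemma nrm_gt0 x : x != 0 -> 0 < nrm x.
Proof.
move=> x0; rewrite lt_neqAle nrm_ge0 andbT eq_sym.
by apply: contra x0 => /eqP/nrm_eq0 ->.
Qed.

Lemma nrmZ c x : nrm (c *: x) = normc c * nrm x.
Proof.
by apply: (@complexI R); rewrite realcM -!normr_nrm normrZ normr_normc normr_nrm.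
Qed.

Lemma nrm_dist_triangle y x z : nrm (x - z) <= nrm (x - y) + nrm (y - z).
Proof. by rewrite (le_trans _ (nrmD _ _)) // addrA subrK. Qed.

Lemma nrm_segment a r x y (t : R) : nrm (x - a) < r -> nrm (y - a) < r ->
  0 <= t <= 1 -> nrm (x + t%:C *: (y - x) - a) < r.
Proof.
move=> xa ya /andP[t0 t1].
have -> : x + t%:C *: (y - x) - a = (1 - t)%:C *: (x - a) + t%:C *: (y - a).
  rewrite realcB realc1 scalerBl scale1r -[RHS]addrA [- _ + _]addrC -scalerBr.
  by rewrite opprB addrA subrK addrAC.
apply: le_lt_trans (nrmD _ _) _; rewrite !nrmZ !normc_real (ger0_norm t0) ger0_norm ?subr_ge0 //.
have [->|t1'] := eqVneq t 1; first by lra.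
have {}t1 : 0 < 1 - t by rewrite subr_gt0 lt_neqAle t1'.
have := ler_wpM2l t0 (ltW ya).
have : (1 - t) * nrm (x - a) < (1 - t) * r by rewrite ltr_pM2l.
lra.
Qed.

End Generic.

Lemma nrm_normc (z : R[i]) : nrm z = normc z.
Proof. by []. Qed.

Lemma coord_nrm n (x : 'rV[R[i]]_n) j : normc (x ord0 j) <= nrm x.
Proof.
rewrite -lecR -normr_normc -normr_nrm.
rewrite [leRHS]/Num.norm /= mx_normE -[leLHS]nngE num_le.
exact: (le_bigmax _ (fun ij => `|x ij.1 ij.2|%:nng) (ord0, j)).
Qed.

Lemma nrm_le n (x : 'rV[R[i]]_n) (c : R) : 0 <= c ->
  (forall j, normc (x ord0 j) <= c) -> nrm x <= c.
Proof.
move=> c0 H; have [->|x0] := eqVneq x 0; first by rewrite nrm0.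
rewrite -lecR -normr_nrm; have [|[i j] /= E] := @mx_norm_neq0 _ _ _ x.
  by rewrite -[mx_norm x]/(`|x|) normr_eq0.
by rewrite [leLHS]/Num.norm /= E (ord1 i) normr_normc lecR.
Qed.

End VectorNorm.

(** * Scalar functions of several variables through complex lines *)

Section SeveralVariables.
Context {R : realType} {n : nat}.
Notation V := 'rV[R[i]]_n.
Implicit Types (phi : V -> R[i]) (a b c h v w x : V).

(** Gateaux holomorphy together with a bound. Unlike Frechet differentiability, this is easy to
    verify for a pointwise limit. *)
Definition gbounded phi a r M := forall z, nrm (z - a) < r ->
  (forall v, exists d, cder (fun t : R[i] => phi (z + t *: v)) 0 d) /\ normc (phi z) <= M.

Definition gd phi b v := dv (fun t : R[i] => phi (b + t *: v)) 0.

Lemma gbounded_ge0 phi a r M : 0 < r -> gbounded phi a r M -> 0 <= M.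
Proof.
move=> r0 H; have [|_ A] := H a; first by rewrite subrr nrm0.
exact: le_trans (normc_ge0 _) A.
Qed.

Lemma gd_cder phi a r M b v t : gbounded phi a r M -> nrm (b + t *: v - a) < r ->
  cder (fun s : R[i] => phi (b + s *: v)) t (gd phi (b + t *: v) v).
Proof.
move=> H /H[/(_ v)/dvP D _] e /D[s s0 Hs]; exists s => // k /Hs.
by rewrite add0r scale0r addr0 scalerDl addrA.
Qed.

Lemma gd_cder0 phi a r M b v : gbounded phi a r M -> nrm (b - a) < r ->
  cder (fun s : R[i] => phi (b + s *: v)) 0 (gd phi b v).
Proof. by move=> H /H[/(_ v)/dvP]. Qed.

Lemma gbounded_slice phi a r M b v s : gbounded phi a r M ->
  nrm (b - a) < r -> nrm (b - a) + s * nrm v <= r ->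
  bhol (fun t : R[i] => phi (b + t *: v)) 0 s M.
Proof.
move=> H br bs t; rewrite subr0 => ts.
have tr : nrm (b + t *: v - a) < r.
  rewrite addrAC; apply: le_lt_trans (nrmD _ _) _; rewrite nrmZ.
  have [v0|v0] := eqVneq (nrm v) 0; first by rewrite v0 mulr0 addr0.
  have {}v0 : 0 < nrm v by rewrite lt_neqAle eq_sym v0 nrm_ge0.
  by apply: lt_le_trans bs; rewrite ltrD2l ltr_pM2r.
split; first by exists (gd phi (b + t *: v) v); apply: gd_cder H _.
by have [] := H _ tr.
Qed.

Lemma gdZ phi a r M b v k : gbounded phi a r M -> nrm (b - a) < r ->
  gd phi b (k *: v) = k * gd phi b v.
Proof.
move=> H br; apply: dvE.
have C : cder (fun s : R[i] => s * k) 0 k.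
  have := cderZ k (cder_id (0 : R[i])); rewrite mulr1; apply: cder_ext.
  by exists 1 => // h _; rewrite mulrC.
have := cder_comp C (f := fun s => phi (b + s *: v)) (d' := gd phi b v).
rewrite mul0r => /(_ (gd_cder0 v H br)); rewrite mulrC; apply: cder_ext.
by exists 1 => // h _; rewrite scalerA.
Qed.

Lemma gd0 phi a r M b : gbounded phi a r M -> nrm (b - a) < r -> gd phi b 0 = 0.
Proof. by move=> H br; rewrite -(scale0r 0) (gdZ _ _ H br) mul0r. Qed.

Lemma gd_bound phi a r M b v : 0 < r -> gbounded phi a r M -> nrm (b - a) < r / 2 ->
  normc (gd phi b v) <= 8 * M / r * nrm v.
Proof.
move=> r0 H br; have br' : nrm (b - a) < r by lra.
have [->|v0] := eqVneq v 0; first by rewrite (gd0 H br') Normc.normc0 nrm0 mulr0.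
have {}v0 := nrm_gt0 v0.
have s0 : 0 < r / 2 / nrm v by rewrite !divr_gt0.
have Hs : bhol (fun t : R[i] => phi (b + t *: v)) 0 (r / 2 / nrm v) M.
  by apply: gbounded_slice H _ _ => //; rewrite divfK ?gt_eqF //; lra.
apply: le_trans (cauchy_estimate s0 Hs (gd_cder0 v H br')) _.
by apply: le_of_eq; field; rewrite !gt_eqF.
Qed.

Lemma gbounded_lip phi a r M b c : 0 < r -> gbounded phi a r M ->
  nrm (b - a) < r / 2 -> nrm (c - a) < r / 2 ->
  normc (phi b - phi c) <= 8 * M / r * nrm (b - c).
Proof.
move=> r0 H br cr.
have := @mean_value_segment R (fun t : R[i] => phi (c + t *: (b - c)))
  (fun t => gd phi (c + t *: (b - c)) (b - c)) 0 1 (8 * M / r * nrm (b - c)).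
rewrite scale0r scale1r addr0 subrKC subr0 Normc.normc1 mulr1; apply => t t01 /=.
rewrite add0r mulr1; have ct := nrm_segment cr br t01; split.
  by apply: gd_cder H _; lra.
exact: gd_bound H ct.
Qed.

Lemma gbounded_taylor phi a r M b h : 0 < r -> gbounded phi a r M ->
  nrm (b - a) < r / 2 -> nrm h < r / 8 ->
  normc (phi (b + h) - phi b - gd phi b h) <= 512 * M / r ^+ 2 * nrm h ^+ 2.
Proof.
move=> r0 H br hr; have br' : nrm (b - a) < r by lra.
have [->|h0] := eqVneq h 0.
  by rewrite addr0 subrr (gd0 H br') subr0 Normc.normc0 nrm0 expr0n mulr0.
have {}h0 := nrm_gt0 h0.
(* In the slice along [h] the increment is the unit step and the disc has radius [r / 2 / |h|];
   inserted in [bhol_taylor2], this turns 128 into 512. *)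
have s0 : 0 < r / 2 / nrm h by rewrite !divr_gt0.
have Hs : bhol (fun t : R[i] => phi (b + t *: h)) 0 (r / 2 / nrm h) M.
  by apply: gbounded_slice H _ _ => //; rewrite divfK ?gt_eqF //; lra.
have s1 : 1 < r / 2 / nrm h / 4.
  by rewrite ltr_pdivlMr // mul1r ltr_pdivlMr //; lra.
have c1 : normc (0 - 0 : R[i]) < r / 2 / nrm h / 4.
  by rewrite subr0 Normc.normc0; lra.
have c2 : normc (0 + 1 - 0 : R[i]) < r / 2 / nrm h / 4.
  by rewrite subr0 add0r Normc.normc1.
have := bhol_taylor2 s0 Hs c1 c2.
rewrite add0r scale1r scale0r addr0 mulr1 Normc.normc1 => /le_trans; apply.
by apply: le_of_eq; rewrite expr1n; field; rewrite !gt_eqF.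
Qed.

Lemma gd_lip phi a r M b c v : 0 < r -> gbounded phi a r M ->
  nrm (b - a) < r / 4 -> nrm (c - a) < r / 4 ->
  normc (gd phi b v - gd phi c v) <= 128 * M / r ^+ 2 * nrm (b - c) * nrm v.
Proof.
move=> r0 H br cr; have br' : nrm (b - a) < r by lra. have cr' : nrm (c - a) < r by lra.
have [->|v0] := eqVneq v 0.
  by rewrite (gd0 H br') (gd0 H cr') subrr Normc.normc0 nrm0 mulr0.
have {}v0 := nrm_gt0 v0.
have s0 : 0 < r / 4 / nrm v by rewrite !divr_gt0.
have Hs : bhol (fun t : R[i] => phi (b + t *: v) - phi (c + t *: v)) 0
    (r / 4 / nrm v) (8 * M / r * nrm (b - c)).
  move=> t; rewrite subr0 ltr_pdivlMr // -nrmZ => tr.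
  have b2 : nrm (b + t *: v - a) < r / 2.
    by rewrite addrAC; apply: le_lt_trans (nrmD _ _) _; lra.
  have c2 : nrm (c + t *: v - a) < r / 2.
    by rewrite addrAC; apply: le_lt_trans (nrmD _ _) _; lra.
  split; first by eexists; apply: cderB; apply: gd_cder H _; lra.
  have := gbounded_lip r0 H b2 c2.
  by rewrite opprD addrACA subrr addr0.
have := cauchy_estimate s0 Hs (cderB (gd_cder0 v H br') (gd_cder0 v H cr')).
by move=> /le_trans; apply; apply: le_of_eq; field; rewrite !gt_eqF.
Qed.

(* Comparing the increments of phi along t(v + w) and along tv followed by tw. *)
Lemma gdD phi a r M b v w : 0 < r -> gbounded phi a r M -> nrm (b - a) < r / 8 ->
  gd phi b (v + w) = gd phi b v + gd phi b w.
Proof.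
move=> r0 H br; have M0 := gbounded_ge0 r0 H.
apply/eqP; rewrite -subr_eq0; apply/eqP.
pose N := nrm v + nrm w + 1.
have v0 := nrm_ge0 v; have w0 := nrm_ge0 w; have N0 : 0 < N by rewrite /N; lra.
pose K := 512 * M / r ^+ 2; have K0 : 0 <= K.
  apply: divr_ge0; first exact: mulr_ge0 (ler0n _ 512) M0.
  by apply: exprn_ge0; apply: ltW.
apply: (@normc_le_small _ _ (4 * K * N ^+ 2)) => e e0.
pose t := Num.min e (r / 16 / N).
have t0 : 0 < t by rewrite lt_min e0 !divr_gt0.
have te : t <= e by rewrite ge_min lexx.
have tN : t * N <= r / 16 by rewrite -ler_pdivlMr // ge_min lexx orbT.
have nt : normc t%:C = t by rewrite normc_real gtr0_norm.
have sm (u : V) : nrm u <= N -> nrm (t%:C *: u) <= t * N by move=> uN; rewrite nrmZ nt ler_pM2l.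
have vN : nrm v <= N by rewrite /N; lra.
have wN : nrm w <= N by rewrite /N; lra.
have vwN : nrm (v + w) <= N by have := nrmD v w; rewrite /N; lra.
have br' : nrm (b - a) < r by lra.
have bt : nrm (b + t%:C *: v - a) < r / 4.
  by rewrite addrAC; apply: le_lt_trans (nrmD _ _) _; have := sm v vN; lra.
have tay (c u : V) : nrm (c - a) < r / 4 -> nrm u <= N ->
    normc (phi (c + t%:C *: u) - phi c - t%:C * gd phi c u) <= K * (t * N) ^+ 2.
  move=> cr uN; have cr' : nrm (c - a) < r by lra.
  rewrite -(gdZ _ _ H cr'); apply: le_trans (gbounded_taylor (h := t%:C *: u) r0 H _ _) _.
  - lra.
  - have := sm u uN; lra.
  by rewrite ler_wpM2l // ler_pXn2r ?nnegrE ?nrm_ge0 ?sm // mulr_ge0 // ltW.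
have A := tay b (v + w) ltac:(lra) vwN; have B := tay b v ltac:(lra) vN.
have C := tay _ w bt wN; clear tay.
have D : normc (gd phi (b + t%:C *: v) w - gd phi b w) <= K * (t * N) * N.
  have br4 : nrm (b - a) < r / 4 by lra.
  have := gd_lip w r0 H bt br4; rewrite addrAC subrr add0r => /le_trans; apply.
  apply: ler_pM; rewrite ?nrm_ge0 ?mulr_ge0 ?invr_ge0 ?exprn_ge0 ?nrm_ge0 ?(ltW r0) //.
  apply: ler_pM; rewrite ?nrm_ge0 ?mulr_ge0 ?invr_ge0 ?exprn_ge0 ?nrm_ge0 ?(ltW r0) ?sm //.
  by rewrite /K ler_wpM2r ?invr_ge0 ?exprn_ge0 ?(ltW r0) // ler_wpM2r //; lra.
rewrite -(ler_pM2l t0) -{1}nt -Normc.normcM.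
rewrite scalerDr addrA in A.
rewrite [X in normc X](_ : _ =
  (phi (b + t%:C *: v) - phi b - t%:C * gd phi b v) +
  (phi (b + t%:C *: v + t%:C *: w) - phi (b + t%:C *: v) - t%:C * gd phi (b + t%:C *: v) w)
  - (phi (b + t%:C *: v + t%:C *: w) - phi b - t%:C * gd phi b (v + w))
  + t%:C * (gd phi (b + t%:C *: v) w - gd phi b w)); last by ring.
apply: le_trans (normcD _ _) _; rewrite Normc.normcM nt.
have D' := ler_wpM2l (ltW t0) D.
have E : normc ((phi (b + t%:C *: v) - phi b - t%:C * gd phi b v) +
  (phi (b + t%:C *: v + t%:C *: w) - phi (b + t%:C *: v) - t%:C * gd phi (b + t%:C *: v) w)
  - (phi (b + t%:C *: v + t%:C *: w) - phi b - t%:C * gd phi b (v + w))) <= 3 * (K * (t * N) ^+ 2).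
  apply: le_trans (normcB _ _) _; apply: le_trans (lerD (normcD _ _) (lexx _)) _; lra.
apply: le_trans (lerD E D') _.
have KN : 0 <= 4 * K * N ^+ 2.
  by apply: mulr_ge0; [apply: mulr_ge0 K0 | apply: exprn_ge0; apply: ltW].
have F := ler_wpM2l (ltW t0) (ler_wpM2l KN te).
by apply: le_trans F; apply: le_of_eq; ring.
Qed.

Lemma gd_sum phi a r M b x : 0 < r -> gbounded phi a r M -> nrm (b - a) < r / 8 ->
  gd phi b x = \sum_(i < n) x ord0 i * gd phi b (delta_mx ord0 i).
Proof.
move=> r0 H br; have br' : nrm (b - a) < r by lra.
rewrite {1}(row_sum_delta x).
elim/big_ind2 : _ => [|x1 x2 y1 y2 <- <-|i _]; first exact: gd0 H br'.
  exact: gdD H br.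
exact: gdZ H br'.
Qed.

End SeveralVariables.

(** * Jacobians of vector-valued maps *)

Section VectorMaps.
Context {R : realType} {n m : nat}.
Notation V := 'rV[R[i]]_n.
Notation W := 'rV[R[i]]_m.
Implicit Types (f g : V -> W) (a b c h v x : V).

(** The sign of [M] is recorded because for [m = 0] the components impose nothing on it. *)
Definition gvec f a r M := 0 <= M /\
  forall j, gbounded (fun z => f z ord0 j) a r M.

(** Row convention: the differential is [x |-> x *m jac f b], so matrices of a composite multiply in
    the order of application. *)
Definition jac f b : 'M[R[i]]_(n, m) :=
  \matrix_(i, j) gd (fun z => f z ord0 j) b (delta_mx ord0 i).

Lemma mul_jac f a r M b x j : 0 < r -> gvec f a r M -> nrm (b - a) < r / 8 ->
  (x *m jac f b) ord0 j = gd (fun z => f z ord0 j) b x.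
Proof.
move=> r0 [_ H] br; rewrite mxE (gd_sum x r0 (H j) br).
by apply: eq_bigr => i _; rewrite mxE.
Qed.

Lemma gvec_taylor f a r M b h : 0 < r -> gvec f a r M ->
  nrm (b - a) < r / 8 -> nrm h < r / 8 ->
  nrm (f (b + h) - f b - h *m jac f b) <= 512 * M / r ^+ 2 * nrm h ^+ 2.
Proof.
move=> r0 G br hr; have [M0 H] := G; apply: nrm_le => [|j].
  apply: mulr_ge0; last by apply: exprn_ge0; apply: nrm_ge0.
  apply: divr_ge0; first exact: mulr_ge0 (ler0n _ 512) M0.
  by apply: exprn_ge0; apply: ltW.
have -> : (f (b + h) - f b - h *m jac f b) ord0 j =
   f (b + h) ord0 j - f b ord0 j - gd (fun z => f z ord0 j) b h.
  by rewrite -(mul_jac h j r0 G br) !mxE.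
by apply: gbounded_taylor (H j) _ hr => //; lra.
Qed.

Lemma jac_lip f a r M b c x : 0 < r -> gvec f a r M ->
  nrm (b - a) < r / 8 -> nrm (c - a) < r / 8 ->
  nrm (x *m jac f b - x *m jac f c) <= 128 * M / r ^+ 2 * nrm (b - c) * nrm x.
Proof.
move=> r0 G br cr; have [M0 H] := G; apply: nrm_le => [|j].
  by rewrite !mulr_ge0 ?nrm_ge0 ?invr_ge0 ?exprn_ge0 // ltW.
have -> : (x *m jac f b - x *m jac f c) ord0 j =
   gd (fun z => f z ord0 j) b x - gd (fun z => f z ord0 j) c x.
  by rewrite -(mul_jac x j r0 G br) -(mul_jac x j r0 G cr) !mxE.
by apply: gd_lip (H j) _ _ => //; lra.
Qed.

Lemma jac_bound f a r M b x : 0 < r -> gvec f a r M -> nrm (b - a) < r / 8 ->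
  nrm (x *m jac f b) <= 8 * M / r * nrm x.
Proof.
move=> r0 G br; have [M0 H] := G; apply: nrm_le => [|j].
  by rewrite !mulr_ge0 ?nrm_ge0 ?invr_ge0 // ltW.
by rewrite (mul_jac x j r0 G br); apply: gd_bound (H j) _ => //; lra.
Qed.

End VectorMaps.

(** * Passage between topological notions and estimates with [nrm] *)

Section Interface.
Context {R : realType}.

Lemma gt0_complex (e : R[i]) : 0 < e -> e = (cRe e)%:C /\ 0 < cRe e.
Proof.
move=> e0; have E : e = (cRe e)%:C by apply: complex_ext => //=; apply: ger0_Im; apply: ltW.
by split=> //; move: e0; rewrite {1}E ltcR.
Qed.

Lemma nbhs_nrmP {V : normedModType R[i]} (x : V) (P : set V) : nbhs x P <->
  exists2 r : R, 0 < r & forall y, nrm (y - x) < r -> P y.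
Proof.
split=> [/nbhs_ballP[e /= /gt0_complex[E e0] H]|[r r0 H]].
  exists (cRe e) => // y yx; apply: H; rewrite -ball_normE /= E normr_nrm ltcR.
  by rewrite nrm_distC.
apply/nbhs_ballP; exists (r%:C); first by rewrite /= ltcR.
move=> y; rewrite -ball_normE /= normr_nrm ltcR nrm_distC; exact: H.
Qed.

Lemma open_nrmP {V : normedModType R[i]} (D : set V) : open D <->
  forall x, D x -> exists2 r : R, 0 < r & forall y, nrm (y - x) < r -> D y.
Proof.
rewrite openE; split=> [H x /H /nbhs_nrmP //|H x /H ?].
exact/nbhs_nrmP.
Qed.

Lemma continuous_nrmP {V W : normedModType R[i]} (f : V -> W) (x : V) :
  {for x, continuous f} <-> forall e : R, 0 < e -> exists2 r : R, 0 < r &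
    forall y, nrm (y - x) < r -> nrm (f y - f x) < e.
Proof.
split=> [H e e0|H].
  have e1 : 0 < e%:C by rewrite ltcR.
  have /cvgrPdist_lt/(_ _ e1)/nbhs_nrmP[r r0 Hr] := H.
  by exists r => // y /Hr; rewrite /= normr_nrm ltcR nrm_distC.
apply/cvgrPdist_lt => e /gt0_complex[E e0]; have [r r0 Hr] := H _ e0.
apply/nbhs_nrmP; exists r => // y /Hr; rewrite nrm_distC E normr_nrm ltcR.
by [].
Qed.

Context {n m : nat}.
Notation V := 'rV[R[i]]_n.
Notation W := 'rV[R[i]]_m.

Lemma derivable_cder (f : V -> W) z v j : derivable f z v ->
  exists d, cder (fun t : R[i] => f (z + t *: v) ord0 j) 0 d.
Proof.
move=> /cvg_ex[l Hl]; exists (l ord0 j) => e e0.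
have e1 : 0 < e%:C by rewrite ltcR.
move: Hl => /cvgrPdist_le/(_ _ e1); rewrite /dnbhs /within /= => /nbhs_nrmP[r r0 Hr].
exists r => // h hr; rewrite add0r scale0r addr0.
have [->|h0] := eqVneq h 0.
  by rewrite scale0r addr0 subrr mulr0 subr0 Normc.normc0 mulr0.
have := Hr h; rewrite subr0 => /(_ hr h0); rewrite normr_nrm lecR => H.
have nh : 0 < normc h by rewrite normc_gt0.
have := le_trans (coord_nrm _ j) H; rewrite -(ler_pM2r nh) -Normc.normcM.
rewrite !mxE -normcN; congr (normc _ <= _).
by rewrite [h *: v + z]addrC; field.
Qed.

(** Entry point for [holomorphic_on]: differentiability near [a] gives the slice derivatives, and
    continuity at [a] the local bound. [matrix_differentiable] leads back. *)
Lemma differentiable_gvec (U : set V) (f : V -> W) a : open U ->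
  (forall z, U z -> differentiable f z) -> U a ->
  exists r M, [/\ 0 < r, forall z, nrm (z - a) < r -> U z & gvec f a r M].
Proof.
move=> /open_nrmP oU df Ua; have [r r0 Hr] := oU a Ua.
have /continuous_nrmP/(_ 1 ltr01)[s s0 Hs] := differentiable_continuous (df a Ua).
exists (Num.min r s), (nrm (f a) + 1); rewrite lt_min r0; split=> // [z|].
  by rewrite lt_min => /andP[/Hr].
split=> [|j z]; first by rewrite addr_ge0 ?nrm_ge0.
rewrite lt_min => /andP[zr zs]; split=> [v|].
  by apply: derivable_cder; apply: diff_derivable; apply: df; apply: Hr.
apply: le_trans (coord_nrm _ j) _; rewrite -[f z](subrK (f a)) addrC.
by apply: le_trans (nrmD _ _) _; rewrite lerD2l; apply: ltW; apply: Hs.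
Qed.

Lemma mulmx_nrm_le (A : 'M[R[i]]_(n, m)) : exists2 K : R, 0 < K &
  forall x : V, nrm (x *m A) <= K * nrm x.
Proof.
pose K := \sum_i \sum_j normc (A i j) + 1.
have s0 : 0 <= \sum_i \sum_j normc (A i j).
  by apply: sumr_ge0 => i _; apply: sumr_ge0 => j _; apply: normc_ge0.
exists K => [|x]; first by rewrite /K ltr_wpDl.
have nc (I : finType) (F : I -> R[i]) : normc (\sum_i F i) <= \sum_i normc (F i).
  elim/big_ind2 : _ => [|x1 x2 y1 y2 A1 A2|//]; first by rewrite Normc.normc0.
  by apply: le_trans (normcD _ _) (lerD A1 A2).
apply: nrm_le => [|j]; first by rewrite mulr_ge0 ?nrm_ge0 // /K addr_ge0.
rewrite mxE; apply: le_trans (nc _ _) _.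
apply: (@le_trans _ _ (\sum_i (\sum_j normc (A i j)) * nrm x)).
  apply: ler_sum => i _; rewrite Normc.normcM mulrC.
  apply: ler_pM; rewrite ?normc_ge0 ?coord_nrm //.
  rewrite (bigD1 j) //= lerDl; apply: sumr_ge0 => k _; exact: normc_ge0.
by rewrite -mulr_suml ler_wpM2r ?nrm_ge0 // /K lerDl.
Qed.

Lemma matrix_differentiable (f : V -> W) b (A : 'M[R[i]]_(n, m)) :
  (forall e : R, 0 < e -> exists2 r : R, 0 < r & forall h, nrm h < r ->
     nrm (f (b + h) - f b - h *m A) <= e * nrm h) -> differentiable f b.
Proof.
move=> H; have cA : continuous (mulmxr A : {linear V -> W}).
  move=> x; apply/continuous_nrmP => e e0; have [K K0 KP] := mulmx_nrm_le A.
  exists (e / K); first by rewrite divr_gt0.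
  move=> y; rewrite ltr_pdivlMr // mulrC => yx; rewrite /= -mulmxBl.
  exact: le_lt_trans (KP _) yx.
have E : f \o shift b = cst (f b) + (mulmxr A : {linear V -> W}) +o_ (0 : V) id.
  apply/eqaddoP => e /gt0_complex[Ee e0]; have [r r0 Hr] := H _ e0.
  apply/nbhs_nrmP; exists r => // y; rewrite subr0 => /Hr.
  rewrite Ee !normr_nrm -realcM lecR; congr (nrm _ <= _).
  by rewrite !fctE /= opprD addrA [y + b]addrC.
have D := diff_unique cA E.
apply/diff_locallyP; rewrite D; split => //.
Qed.

End Interface.

(** * Compactness and separation in complex row space *)

Section FiniteDimensional.
Context {R : realType}.

Lemma closure_nrmP {V : normedModType R[i]} (A : set V) x : closure A x <->
  forall r : R, 0 < r -> exists2 y, A y & nrm (y - x) < r.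
Proof.
split=> [H r r0|H B /nbhs_nrmP[r r0 Hr]].
  have [|y [Ay Hy]] := H [set y | nrm (y - x) < r]; last by exists y.
  by apply/nbhs_nrmP; exists r.
by have [y Ay yr] := H r r0; exists y; split=> //; apply: Hr.
Qed.

Lemma closed_nrmP {V : normedModType R[i]} (A : set V) :
  (forall x, (forall r : R, 0 < r -> exists2 y, A y & nrm (y - x) < r) -> A x) -> closed A.
Proof. by move=> H x /closure_nrmP; exact: H. Qed.

Lemma lipschitz_real_continuous {V : normedModType R[i]} (f : V -> R) K :
  (forall x y, `|f x - f y| <= K * nrm (x - y)) -> continuous f.
Proof.
move=> H x; apply/cvgrPdist_le => e e0; apply/nbhs_nrmP.
have K0 : 0 < `|K| + 1 by rewrite ltr_wpDl.
exists (e / (`|K| + 1)); first by rewrite divr_gt0.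
move=> y; rewrite ltr_pdivlMr // => yx; rewrite distrC; apply: le_trans (H _ _) _.
apply: le_trans (ltW yx); rewrite mulrC ler_wpM2l ?nrm_ge0 //.
by apply: le_trans (ler_norm _) _; rewrite lerDl.
Qed.

Lemma box_compact (M : R) : compact [set z : R[i] | `|cRe z| <= M /\ `|cIm z| <= M].
Proof.
pose f (p : R * R) : R[i] := (p.1 +i* p.2)%C.
have cf : continuous f.
  move=> p A /nbhs_nrmP[r r0 Hr]; apply/nbhs_ballP; exists (r / 2); first by rewrite /= divr_gt0.
  move=> q [/= q1 q2]; apply: Hr; rewrite nrm_normc.
  apply: le_lt_trans (normc_le_ReIm _) _; rewrite /f ReB ImB /=.
  move: q1 q2; rewrite /ball /= ![`|_ - q.1|]distrC ![`|_ - q.2|]distrC; lra.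
have C : compact (f @` (`[- M, M]%classic `*` `[- M, M]%classic)).
  apply: continuous_compact; first exact: continuous_subspaceT.
  by apply: compact_setX; apply: segment_compact.
rewrite (_ : [set z | _] = f @` (`[- M, M]%classic `*` `[- M, M]%classic)) //.
apply/seteqP; split=> [z [zr zi]|_ [[a b] [/= + +] <-]].
  exists (cRe z, cIm z); last by case: z zr zi.
  by rewrite /= !in_itv /= -!ler_norml.
by rewrite !in_itv /= -!ler_norml.
Qed.

Context {n : nat}.
Notation V := 'rV[R[i]]_n.
Implicit Types (x y w u : V) (A D : set V).

Lemma nrm_bounded_compact A (M : R) : closed A -> (forall x, A x -> nrm x <= M) -> compact A.
Proof.
move=> cA bA; have C := @rV_compact R[i] n _ (fun=> @box_compact M).
apply: (subclosed_compact cA C) => x Ax j.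
split; first exact: le_trans (Re_le_normc _) (le_trans (coord_nrm _ _) (bA _ Ax)).
exact: le_trans (Im_le_normc _) (le_trans (coord_nrm _ _) (bA _ Ax)).
Qed.

Lemma seq_cluster A (v : nat -> V) : compact A -> (forall k, A (v k)) ->
  exists2 u, A u & forall (e : R) N, 0 < e -> exists2 k, (N <= k)%N & nrm (v k - u) < e.
Proof.
move=> cA Av; have [|u [Au cu]] := cA (v @ \oo) _; first by exists 0%N => // k _; exact: Av.
exists u => // e N e0.
have [||y [[k Nk <-] ye]] := cu (v @` [set k | (N <= k)%N]) [set y | nrm (y - u) < e].
- by exists N => // k Nk; exists k.
- by apply/nbhs_nrmP; exists e.
by exists k.
Qed.

Definition lin u x : R[i] := \sum_j x ord0 j * u ord0 j.

Lemma linD u x y : lin u (x + y) = lin u x + lin u y.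
Proof. by rewrite /lin -big_split; apply: eq_bigr => j _; rewrite mxE mulrDl. Qed.

Lemma linZ u k x : lin u (k *: x) = k * lin u x.
Proof. by rewrite /lin mulr_sumr; apply: eq_bigr => j _; rewrite mxE mulrA. Qed.

Lemma linB u x y : lin u (x - y) = lin u x - lin u y.
Proof. by rewrite linD -scaleN1r linZ mulN1r. Qed.

Lemma linE u x : lin u x = (x *m u^T) ord0 ord0.
Proof. by rewrite mxE; apply: eq_bigr => j _; rewrite mxE. Qed.

Lemma lin_bound u : exists2 K : R, 0 < K & forall x, normc (lin u x) <= K * nrm x.
Proof.
have [K K0 H] := mulmx_nrm_le u^T; exists K => // x; rewrite linE.
exact: le_trans (coord_nrm _ _) (H x).
Qed.

(** The Euclidean structure of the underlying real space. Nearest points and the strict convexity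
    argument need it, since the maximum norm [nrm] is not strictly convex. *)
Definition sqnorm x : R := \sum_j normc (x ord0 j) ^+ 2.
Definition rdot x y : R := \sum_j (cRe (x ord0 j) * cRe (y ord0 j) + cIm (x ord0 j) * cIm (y ord0 j)).

Lemma sqnorm_ge0 x : 0 <= sqnorm x.
Proof. by apply: sumr_ge0 => j _; apply: exprn_ge0; apply: normc_ge0. Qed.

Lemma sqnorm_nrm x : nrm x ^+ 2 <= sqnorm x.
Proof.
have s0 := sqnorm_ge0 x.
have : nrm x <= Num.sqrt (sqnorm x).
  apply: nrm_le => [|j]; first exact: sqrtr_ge0.
  rewrite -(ler_pXn2r (n := 2)) ?nnegrE ?sqrtr_ge0 ?normc_ge0 // sqr_sqrtr //.
  rewrite /sqnorm (bigD1 j) //= lerDl; apply: sumr_ge0 => k _.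
  by apply: exprn_ge0; apply: normc_ge0.
rewrite -(ler_pXn2r (n := 2)) ?nnegrE ?sqrtr_ge0 ?nrm_ge0 // sqr_sqrtr //.
Qed.

Lemma sqnormD x y (t : R) :
  sqnorm (x + t%:C *: y) = sqnorm x + 2 * t * rdot x y + t ^+ 2 * sqnorm y.
Proof.
rewrite /sqnorm /rdot !mulr_sumr -!big_split; apply: eq_bigr => j _ /=.
by rewrite !mxE !sqr_normcE ReD ImD ReM ImM /=; ring.
Qed.

Lemma sqnorm_continuous w : continuous (fun x => sqnorm (x - w)).
Proof.
apply: (@continuous_big _ _ _ _ _ _ _ _ (fun i x => normc ((x - w) ord0 i) ^+ 2)) => [|i _ x].
  exact: add_continuous.
have C : {for x, continuous (fun y : V => normc ((y - w) ord0 i))}.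
  apply: (@lipschitz_real_continuous _ _ 1) => a b; rewrite mul1r ler_norml; apply/andP.
  have := normc_sub_le ((a - w) ord0 i) ((b - w) ord0 i).
  have := normc_sub_le ((b - w) ord0 i) ((a - w) ord0 i).
  have := coord_nrm (a - b) i; rewrite distcC.
  rewrite (_ : (a - b) ord0 i = (a - w) ord0 i - (b - w) ord0 i); last by rewrite !mxE; ring.
  by move=> *; split; lra.
exact: (cvgM C C).
Qed.

(** The functional is the real inner product with [a = y0 - w], where [y0] is a point of [D] nearest
    to [w]; conjugating coordinates writes it as the real part of a complex linear form. *)
Lemma convex_separation D w : D !=set0 -> closed D ->
  (forall x y (t : R), D x -> D y -> 0 <= t <= 1 -> D (x + t%:C *: (y - x))) -> ~ D w ->
  exists u, forall y, D y -> cRe (lin u y) < cRe (lin u w).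
Proof.
move=> [y1 D1] cD vD nDw.
pose M := sqnorm (y1 - w); pose B := M + 1 + nrm w.
pose A := D `&` [set y | sqnorm (y - w) <= M].
have bA y : A y -> nrm y <= B.
  move=> [_ /= yM]; rewrite -[y](subrK w); apply: le_trans (nrmD _ _) _; rewrite lerD2r.
  have := le_trans (sqnorm_nrm (y - w)) yM; have := nrm_ge0 (y - w).
  by move: (nrm _) => s; rewrite expr2 => s0 sM; nra.
have cA : compact A.
  apply: nrm_bounded_compact bA; apply: closedI cD _.
  rewrite (_ : [set y | _] = (fun y => sqnorm (y - w)) @^-1` [set r | r <= M]) //.
  by apply: preimage_closed; [move=> x _; exact: sqnorm_continuous | exact: closed_le].
have [||y0 /set_mem[D0 _] min0] := compact_EVT_min (f := fun y => sqnorm (y - w)) _ cA.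
- by exists y1; split=> //=.
- by apply: continuous_subspaceT; exact: sqnorm_continuous.
have min y : D y -> sqnorm (y0 - w) <= sqnorm (y - w).
  move=> Dy; have [yM|/ltW My] := leP (sqnorm (y - w)) M; first by apply: min0; apply/mem_set.
  by apply: le_trans My; apply: min0; apply/mem_set; split => /=.
pose a := y0 - w.
have dot y : D y -> 0 <= rdot a (y - y0).
  move=> Dy; rewrite leNgt; apply/negP => dneg.
  set q := rdot a _ in dneg; pose s := sqnorm (y - y0).
  have s0 : 0 <= s := sqnorm_ge0 _.
  (* If [q < 0], this step from [y0] towards [y] would change the squared distance by
     [2 * t * q + t ^+ 2 * s < 0]. *)
  pose t := Num.min 1 (- q / (s + 1)).
  have s1 : 0 < s + 1 by lra.
  have t0 : 0 < t by rewrite lt_min ltr01 divr_gt0 //; lra.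
  have t1 : t <= 1 by rewrite ge_min lexx.
  have ts : t * (s + 1) <= - q by rewrite -ler_pdivlMr // ge_min lexx orbT.
  have := min _ (vD _ _ t D0 Dy _); rewrite (ltW t0) t1 => /(_ isT).
  rewrite addrAC -/a sqnormD -/q -/s.
  have := ler_wpM2l (ltW t0) ts; have : t * q < 0 by rewrite pmulr_rlt0.
  by rewrite expr2 -/a; nra.
have a0 : 0 < sqnorm a.
  have aw : a != 0 by rewrite subr_eq0; apply: contra_notN nDw => /eqP <-.
  by apply: lt_le_trans (sqnorm_nrm a); rewrite exprn_gt0 // nrm_gt0.
pose u : V := \row_j - conjc (a ord0 j).
have linu x : cRe (lin u x) = - rdot a x.
  rewrite /lin /rdot (big_morph (fun z : R[i] => cRe z) ReD (erefl _)) -sumrN; apply: eq_bigr => j _.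
  by rewrite ReM mxE ReN ImN; case: (a ord0 j) => ? ? /=; ring.
exists u => y Dy; have := dot y Dy.
have -> : rdot a (y - y0) = - cRe (lin u (y - y0)) by rewrite linu opprK.
have : cRe (lin u (w - y0)) = sqnorm a.
  rewrite linu /rdot /sqnorm -sumrN; apply: eq_bigr => j _; rewrite sqr_normcE !mxE.
  by rewrite !(ReB, ImB, ReN, ImN, ReD, ImD); ring.
rewrite !linB !ReB; lra.
Qed.

End FiniteDimensional.

(** * Cores of convex domains and Harnack chains *)

Section ConvexDomain.
Context {R : realType} {n : nat}.
Notation V := 'rV[R[i]]_n.
Implicit Types (x y w u p z : V) (D : set V).

Definition rconvex D := forall x y (t : R), D x -> D y -> 0 <= t <= 1 ->
  D (x + t%:C *: (y - x)).

Lemma convex_rconvex D : convex_in_Cn D -> rconvex D.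
Proof.
move=> cD x y t Dx Dy /andP[t0 t1].
have t01 : (0 <= 1 - t%:C :> R[i]) && (1 - t%:C <= 1 :> R[i]).
  by rewrite -realc1 -realcB !lecR; apply/andP; split; lra.
pose l : {i01 R[i]} := Itv01 (elimT andP t01).1 (elimT andP t01).2.
suff -> : x + t%:C *: (y - x) = l%:inum *: x + (1 - l%:inum) *: y.
  exact: (set_mem (cD x y l (mem_set Dx) (mem_set Dy))).
have -> : l%:inum = 1 - t%:C by [].
by apply/rowP => j; rewrite !mxE; ring.
Qed.

Definition supporting D u (c : R) := forall y, D y -> cRe (lin u y) < c.

(* A bound on the position of w relative to p, uniform over all supporting
   half-spaces of D. *)
Definition core D p (N : nat) : set V := [set w | forall u c, supporting D u c ->
  3 ^- N * (c - cRe (lin u p)) <= c - cRe (lin u w) /\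
  normc (lin u w - lin u p) <= 3 ^+ N * (c - cRe (lin u p))].

(** If [w] is outside [D], then [w'], slightly beyond [w] as seen from [p], is outside the closure:
    a point of [D] close to [w'], joined with the ball around [p], would cover [w]. For the
    half-space separating [w'] the ratio of distances of [w] and [p] to its boundary is
    [e / (1 + e)], below the [e = 3 ^- N] that the core guarantees. *)
Lemma core_sub D p N : open D -> rconvex D -> D p -> core D p N `<=` D.
Proof.
move=> /open_nrmP oD cD Dp w Kw; apply: contrapT => nDw.
have [e eE e0] : exists2 e : R, e = 3 ^- N & 0 < e.
  by exists (3 ^- N) => //; rewrite invr_gt0 exprn_gt0.
have [r r0 Hr] := oD p Dp.
pose w' := w + e%:C *: (w - p).
have e1 : 1 + e%:C != 0 :> R[i].
  by rewrite -[1]realc1 -realcD -normc_gt0 normc_real gtr0_norm; lra.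
have ne : e%:C != 0 :> R[i] by rewrite -normc_gt0 normc_real gtr0_norm.
have nw' : ~ closure D w'.
  move=> /closure_nrmP/(_ (e * r))[|y Dy yw]; first by rewrite mulr_gt0.
  apply: nDw; pose q := p + e^-1%:C *: (w' - y).
  have Dq : D q.
    apply: Hr; rewrite /q addrAC subrr add0r nrmZ normc_real gtr0_norm ?invr_gt0 //.
    by rewrite mulrC ltr_pdivrMr // nrm_distC mulrC.
  have := cD y q (e / (1 + e)) Dy Dq _.
  have -> : y + (e / (1 + e))%:C *: (q - y) = w.
    apply/rowP => j; rewrite /q /w' !mxE !realcE; field.
    by rewrite ?e1 ?ne.
  by apply; rewrite divr_ge0 /= ?ler_pdivrMr ?mul1r; lra.
have cl : rconvex (closure D).
  move=> x y t /closure_nrmP Dx /closure_nrmP Dy t01; apply/closure_nrmP => s s0.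
  have [x' Dx' xs] := Dx s s0; have [y' Dy' ys] := Dy s s0.
  exists (x' + t%:C *: (y' - x')); first exact: cD.
  have := @nrm_segment _ _ 0 s (x' - x) (y' - y) t; rewrite !subr0 => /(_ xs ys t01).
  by congr (nrm _ < _); apply/rowP => j; rewrite !mxE; ring.
have [||u Hu] := @convex_separation R n (closure D) w' _ _ cl nw'.
- by exists p; apply: subset_closure.
- exact: closed_closure.
pose c := cRe (lin u w').
have su : supporting D u c by move=> y Dy; apply: Hu; apply: subset_closure.
have [K1 _] := Kw u c su; have := su p Dp.
rewrite -eE in K1; move: K1.
have -> : c = (1 + e) * cRe (lin u w) - e * cRe (lin u p).
  by rewrite /c /w' linD linZ linB ReD ReM ReB /= mul0r subr0; ring.
move: (cRe (lin u w)) (cRe (lin u p)) => a b K1 ab.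
have : 0 < (1 + e) * (a - b) by lra.
rewrite pmulr_rgt0 => [d0|]; last by lra.
have := mulr_gt0 (mulr_gt0 e0 e0) d0; lra.
Qed.

Lemma core_closed D p N : closed (core D p N).
Proof.
apply: closed_nrmP => w H u c su; have [K K0 HK] := lin_bound u.
have near (e : R) : 0 < e -> exists2 y, core D p N y & normc (lin u y - lin u w) <= e.
  move=> e0; have [y Ky yw] := H (e / K) (divr_gt0 e0 K0); exists y => //.
  by rewrite -linB; apply: le_trans (HK _) _; rewrite mulrC -ler_pdivlMr // ltW.
split; apply/ler_addgt0Pl => e e0; have [y /(_ u c su)[K1 K2] ye] := near e e0.
  apply: le_trans K1 _; have := Re_le_normc (lin u y - lin u w).
  by rewrite ReB ler_norml => /andP[]; lra.
apply: le_trans (distc_triangle (lin u y) _ _) _; rewrite distcC; lra.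
Qed.

Definition no_line D := forall p u, D p -> (forall t : R[i], D (p + t *: u)) -> u = 0.

(** Points of the core going to infinity have directions clustering at some unit vector [u]. Every
    supporting form takes bounded increments on the core, so it vanishes on [u], and the complex
    line through [p] along [u] stays in [D]. *)
Lemma core_bounded D p N : open D -> rconvex D -> D p -> no_line D ->
  exists M : R, forall w, core D p N w -> nrm w <= M.
Proof.
move=> oD cD Dp nl; apply: contrapT => nb.
have [|w Hw] := @choice _ _ (fun k w => core D p N w /\ k%:R + 1 < nrm (w - p)).
  move=> k; apply: contrapT => H; apply: nb; exists (k%:R + 1 + nrm p) => w Kw.
  rewrite leNgt; apply/negP => wk; apply: H; exists w; split=> //.
  by have := nrmD (w - p) p; rewrite subrK; lra.
pose s k : R := nrm (w k - p).
have s0 k : 0 < s k by have [_] := Hw k; rewrite -/(s k); have : 0 <= k%:R :> R by []; lra.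
pose v k := (s k)^-1%:C *: (w k - p).
have v1 k : nrm (v k) = 1.
  by rewrite nrmZ normc_real gtr0_norm ?invr_gt0 // mulVf // gt_eqF.
pose A := [set x : V | nrm x = 1].
have cA : compact A.
  apply: (@nrm_bounded_compact _ _ _ 1); last by move=> x /= ->.
  apply: closed_nrmP => x H; apply/eqP; rewrite eq_le; apply/andP; split; apply/ler_addgt0Pl => e e0.
    by have [y /= y1 ye] := H e e0; have := nrmB y (y - x); rewrite subKr y1; lra.
  by have [y /= y1 ye] := H e e0; have := nrmD (y - x) x; rewrite subrK y1; lra.
have [u /= u1 cu] := seq_cluster cA v1.
suff u0 : u = 0.
  have : nrm (0 : V) = 1 by rewrite -u1 u0.
  by rewrite nrm0; lra.
have lu u' c : supporting D u' c -> lin u' u = 0.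
  move=> su; have [K K0 HK] := lin_bound u'.
  apply: (@normc_le_small _ _ (K + 1)) => e e0.
  pose B := 3 ^+ N * (c - cRe (lin u' p)).
  have B0 : 0 < B by rewrite mulr_gt0 ?exprn_gt0 // subr_gt0; apply: su.
  have [k kB ke] := cu e (Num.bound (B / e)) e0.
  rewrite -[u](subrK (v k)) linD mulrDl mul1r; apply: le_trans (normcD _ _) _; apply: lerD.
    by apply: le_trans (HK _) _; rewrite ler_wpM2l ?(ltW K0) // nrm_distC ltW.
  have [Kk sk] := Hw k; have [_ K2] := Kk u' c su.
  rewrite /v linZ linB Normc.normcM normc_real gtr0_norm ?invr_gt0 // mulrC ler_pdivrMr //.
  apply: le_trans K2 _; rewrite -/B mulrC -ler_pdivrMr //.
  have : B / e < (Num.bound (B / e))%:R by apply: archi_boundP; apply: divr_ge0; apply: ltW.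
  have : (Num.bound (B / e))%:R <= k%:R :> R by rewrite ler_nat.
  by move: sk; rewrite -/(s k); lra.
(* Points that no supporting form distinguishes from [p] already lie in the core with exponent 0. *)
apply: (nl p u Dp) => t; apply: (@core_sub D p 0) => // u' c su.
rewrite linD linZ (lu u' c su) mulr0 addr0 expr0 invr1 !mul1r; split=> //.
by rewrite subrr Normc.normc0 subr_ge0 ltW //; apply: su.
Qed.

Lemma core_compact D p N : open D -> rconvex D -> D p -> no_line D ->
  compact (core D p N).
Proof.
move=> oD cD Dp nl; have [M HM] := core_bounded N oD cD Dp nl.
exact: nrm_bounded_compact (@core_closed _ _ _) HM.
Qed.

(** No continuity is required here; for self-maps of [D] fixing [p] the local bounds come from
    Harnack's inequality. *)
Definition gholo D (f : V -> V) := forall z, D z -> forall v j,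
  exists d, cder (fun t : R[i] => f (z + t *: v) ord0 j) 0 d.

Lemma gholo_lin D f u z v : gholo D f -> D z ->
  exists d, cder (fun t : R[i] => lin u (f (z + t *: v))) 0 d.
Proof.
move=> Hf Dz; rewrite /lin.
have H (s : seq 'I_n) : exists d, cder (fun t : R[i] => \sum_(j <- s) f (z + t *: v) ord0 j * u ord0 j) 0 d.
  elim: s => [|j s [d IH]].
    exists 0; apply: cder_ext (cder_cst 0 _); exists 1 => // h _; by rewrite big_nil.
  have [d' dd'] := Hf z Dz v j; exists (u ord0 j * d' + d).
  apply: cder_ext (cderD (cderZ (u ord0 j) dd') IH).
  by exists 1 => // h _; rewrite big_cons [u _ _ * _]mulrC.
exact: H.
Qed.

Lemma cder_slice_shift (phi : V -> R[i]) z v s d :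
  cder (fun t : R[i] => phi (z + s *: v + t *: v)) 0 d ->
  cder (fun t : R[i] => phi (z + t *: v)) s d.
Proof.
move=> D e /D[r r0 Hr]; exists r => // h /Hr.
by rewrite add0r scale0r addr0 scalerDl addrA.
Qed.

(** Harnack's inequality for [c - lin u (f _)] on the complex line through [x] and [x']: its real
    part is positive because [f] maps into [D]. *)
Lemma harnack_step D f u c x x' (r : R) : gholo D f -> set_fun D D f ->
  supporting D u c -> 0 < r -> (forall y, nrm (y - x) < r -> D y) ->
  nrm (x' - x) <= r / 16 ->
  (c - cRe (lin u (f x))) / 3 <= c - cRe (lin u (f x')) /\
  normc (lin u (f x') - lin u (f x)) <= 2 * (c - cRe (lin u (f x))).
Proof.
move=> Hf fD su r0 Dr xx'; have Dx : D x by apply: Dr; rewrite subrr nrm0.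
have p0 : 0 < c - cRe (lin u (f x)) by rewrite subr_gt0; apply: su; apply: fD.
have [E|x0] := eqVneq (x' - x) 0.
  move/eqP: E; rewrite subr_eq0 => /eqP ->.
  by rewrite subrr Normc.normc0; split; [rewrite ler_pdivrMr //|]; lra.
have {}x0 := nrm_gt0 x0.
have := @harnack R (fun t : R[i] => c%:C - lin u (f (x + t *: (x' - x)))) 0 1 (r / nrm (x' - x)).
rewrite scale0r addr0 scale1r subrKC subr0 Normc.normc1 !ReB /=.
rewrite (_ : c%:C - lin u (f x') - (c%:C - lin u (f x)) = - (lin u (f x') - lin u (f x))); last by ring.
rewrite normcN; apply; first by rewrite divr_gt0.
  move=> t; rewrite subr0 ltr_pdivlMr // -nrmZ => tr.
  have Dt : D (x + t *: (x' - x)) by apply: Dr; rewrite addrAC subrr add0r.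
  split; last by rewrite ReB /= subr_gt0; apply: su; apply: fD.
  have [d dd] := gholo_lin u (x' - x) Hf Dt; exists (0 - d).
  apply: cderB; first exact: cder_cst.
  exact: (cder_slice_shift (phi := fun z => lin u (f z))) dd.
by rewrite -mulrA mulrCA ler_pdivlMl // mulr1.
Qed.

Lemma shift_le (a b c m : R) : - m <= a - b -> c - a <= (c - b) + m.
Proof. lra. Qed.

Lemma harnack_sum (d1 d2 a X q : R) : d1 <= 2 * a -> a <= X + d2 ->
  d2 <= (q - 1) * X -> d1 + d2 <= (3 * q - 1) * X.
Proof. lra. Qed.

(** A chain of [N] steps of length at most [r / 16] from [p] to [z]. Each step costs a factor 3 in
    the lower bound, and the upper bound passes from [3 ^+ k - 1] to [3 ^+ k.+1 - 1] by
    [harnack_sum]; this is where the powers of 3 in [core] originate. *)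
Lemma harnack_core D f p z (r : R) (N : nat) : gholo D f -> set_fun D D f ->
  rconvex D -> f p = p -> 0 < r ->
  (forall y, nrm (y - p) < r -> D y) -> (forall y, nrm (y - z) < r -> D y) ->
  nrm (z - p) * 16 <= r * N%:R -> core D p N (f z).
Proof.
move=> Hf fD cD fp r0 Dp Dz zN u c su.
have [N0|N0] := posnP N.
  have -> : z = p.
    apply/eqP; rewrite -subr_eq0; apply/eqP/nrm_eq0/eqP; rewrite eq_le nrm_ge0 andbT.
    by move: zN; rewrite N0 mulr0; lra.
  have : cRe (lin u p) < c by apply: su; apply: Dp; rewrite subrr nrm0.
  by rewrite fp N0 subrr Normc.normc0 !expr0 invr1 !mul1r; lra.
pose x k : V := p + (k%:R / N%:R : R)%:C *: (z - p).
have N1 : 0 < N%:R :> R by rewrite ltr0n.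
have x0 : x 0%N = p by rewrite /x mul0r realc0 scale0r addr0.
have xN : x N = z by rewrite /x divff ?gt_eqF // realc1 scale1r subrKC.
have k01 k : (k <= N)%N -> 0 <= (k%:R / N%:R : R) <= 1.
  by move=> kN; rewrite divr_ge0 ?ler0n //= ler_pdivrMr // mul1r ler_nat.
(* By convexity, balls of the same radius around [p] and [z] sweep out balls around all points of
   the chain. *)
have Dx k : (k <= N)%N -> forall y, nrm (y - x k) < r -> D y.
  move=> kN y yr.
  have -> : y = (p + (y - x k)) + (k%:R / N%:R : R)%:C *: ((z + (y - x k)) - (p + (y - x k))).
    by apply/rowP => j; rewrite /x !mxE; ring.
  by apply: cD; [apply: Dp|apply: Dz|exact: k01]; rewrite addrAC subrr add0r.
pose X := c - cRe (lin u p).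
have X0 : 0 < X by rewrite subr_gt0; apply: su; apply: Dp; rewrite subrr nrm0.
have key k : (k <= N)%N -> 3 ^- k * X <= c - cRe (lin u (f (x k))) /\
    normc (lin u (f (x k)) - lin u p) <= (3 ^+ k - 1) * X.
  elim: k => [_|k IH kN]; first by rewrite x0 fp subrr Normc.normc0 !expr0 invr1 mul1r subrr mul0r.
  have [I1 I2] := IH (ltnW kN).
  have st : nrm (x k.+1 - x k) <= r / 16.
    have -> : x k.+1 - x k = (N%:R^-1)%:C *: (z - p).
      apply/rowP => j; rewrite /x !mxE -[k.+1]addn1 natrD mulrDl realcD mul1r; ring.
    by rewrite nrmZ normc_real gtr0_norm ?invr_gt0 // mulrC ler_pdivrMr // mulrAC ler_pdivlMr.
  have [S1 S2] := harnack_step Hf fD su r0 (Dx k (ltnW kN)) st.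
  split; first by apply: le_trans S1; rewrite exprS invfM -mulrA mulrC ler_pM2r.
  apply: le_trans (distc_triangle (lin u (f (x k))) _ _) _; rewrite exprS.
  apply: harnack_sum S2 _ I2; apply: shift_le.
  have := Re_le_normc (lin u (f (x k)) - lin u p); rewrite ReB ler_norml.
  by case/andP.
have [K1 K2] := key N (leqnn N); rewrite xN in K1 K2; split=> //.
by apply: le_trans K2 _; rewrite ler_wpM2r ?(ltW X0) //; lra.
Qed.

(** The radius and the exponent depend on [p] and [z] but not on [f]; this uniformity is the source
    of compactness. *)
Lemma harnack_core_local D p z : open D -> rconvex D -> D p -> D z ->
  exists r N, [/\ 0 < r, forall y, nrm (y - z) < r -> D y &
    forall f, gholo D f -> set_fun D D f -> f p = p ->
      forall y, nrm (y - z) < r -> core D p N (f y)].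
Proof.
move=> /open_nrmP oD cD Dp Dz; have [r r0 Hr] := oD p Dp; have [s s0 Hs] := oD z Dz.
pose t := Num.min r s / 2.
have m0 : 0 < Num.min r s by rewrite lt_min r0.
have t0 : 0 < t by rewrite /t; lra.
have mr : Num.min r s <= r by rewrite ge_min lexx.
have ms : Num.min r s <= s by rewrite ge_min lexx orbT.
pose N := Num.bound ((nrm (z - p) + t) * 16 / t).
exists t, N; split=> // [y yt|f Hf fD fp y yt]; first by apply: Hs; rewrite /t in yt; lra.
apply: (harnack_core (r := t)) => // [x xt|x xt|].
- by apply: Hr; rewrite /t in xt; lra.
- apply: Hs; apply: le_lt_trans (nrm_dist_triangle y _ _) _; rewrite /t in yt xt; lra.
have tN : (nrm (z - p) + t) * 16 / t <= N%:R.
  apply: ltW; apply: archi_boundP.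
  by rewrite divr_ge0 ?mulr_ge0 ?addr_ge0 ?nrm_ge0 // ltW.
rewrite ler_pdivrMr // in tN; rewrite [t * _]mulrC; apply: le_trans tN.
by rewrite ler_wpM2r //; have := nrm_dist_triangle z y p; lra.
Qed.

End ConvexDomain.

(** * Hyperbolic domains contain no complex line *)

Section NoComplexLine.
Context {R : realType} {n : nat}.
Notation V := 'rV[R[i]]_n.
Implicit Types (p u z w : V) (D : set V).

Lemma poincare_dist_ge0 (a b : R[i]) : 0 <= poincare_dist a b.
Proof.
rewrite /poincare_dist; set d := normc _; have d0 : 0 <= d := normc_ge0 _.
apply: mulr_ge0; first by rewrite invr_ge0.
(* For [d >= 1] the argument of [ln] is at most 0, division by zero included, and [ln] is 0 there by
   convention. *)
have [d1|d1] := ltP d 1; last by rewrite ln0 // pmulr_rle0 ?invr_le0; lra.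
by apply: ln_ge0; rewrite ler_pdivlMr; lra.
Qed.

Lemma poincare_dist0_le (s : R) : 0 <= s <= 1 / 2 -> poincare_dist 0 s%:C <= 2 * s.
Proof.
move=> /andP[s0 s1]; rewrite /poincare_dist.
rewrite sub0r (_ : 1 - _ = 1); last by rewrite (_ : conjc 0 = 0) ?mul0r ?subr0 //; apply: complex_ext; rewrite /= ?oppr0.
rewrite invr1 mulr1 normcN normc_real ger0_norm // mulrC ler_pdivrMr //.
rewrite (_ : (1 + s) / (1 - s) = 1 + 2 * s / (1 - s)); last by field; lra.
apply: le_trans (le_ln1Dx _) _.
  by apply: lt_le_trans (_ : 0 <= _); [lra|rewrite divr_ge0; lra].
rewrite ler_pdivrMr; nra.
Qed.

Lemma chain_length_ge0 (c : seq ((R[i] -> V) * (R[i] * R[i]))) : 0 <= chain_length c.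
Proof. by apply: sumr_ge0 => q _; apply: poincare_dist_ge0. Qed.

Lemma affine_differentiable p u (k : R[i]) (z : R[i]) :
  differentiable (fun t : R[i] => p + (k * t) *: u) z.
Proof.
apply: differentiableD; first exact: differentiable_cst.
apply: differentiableZl; apply: differentiableM => //.
Qed.

(* Discs of large radius in a complex line have small Poincare distance
   between given points. *)
Lemma hyperbolic_no_line D : kobayashi_hyperbolic D -> no_line D.
Proof.
move=> hD p u Dp Hu.
have E : p = p + u.
  apply: hD => //; first by have := Hu 1; rewrite scale1r.
  apply/eqP; rewrite eq_le; apply/andP; split; last first.
    by apply: le_ereal_inf_tmp => _ [c _ <-]; rewrite lee_fin chain_length_ge0.
  apply/lee_addgt0Pr => e e0; rewrite add0e.
  (* One disc, [t |-> p + (t / s) u], carries 0 to [p] and [s] to [p + u]. Its length is at most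
     [2 * s]: the bound 1/2 validates this estimate and [e / 2] makes it at most [e]. *)
  pose s := Num.min (1 / 2) (e / 2).
  have s0 : 0 < s by rewrite lt_min; apply/andP; split; lra.
  have s1 : s <= 1 / 2 by rewrite ge_min lexx.
  have se : s <= e / 2 by rewrite ge_min lexx orbT.
  pose c := [:: ((fun t : R[i] => p + ((s^-1)%:C * t) *: u), ((0 : R[i]), s%:C))].
  apply: (@le_trans _ _ (chain_length c)%:E).
    apply: ereal_inf_lbound; exists c; last by reflexivity.
    split.
    - by move=> z _; apply: affine_differentiable.
    - by move=> z _; apply: Hu.
    - rewrite /unit_disc /= Normc.normc0 normc_real ger0_norm ?(ltW s0) //.
      by split; [exact: ltr01 | lra].
    - by rewrite mulr0 scale0r addr0.
    by rewrite /= -realcM mulVf ?gt_eqF // realc1 scale1r.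
  rewrite lee_fin /chain_length big_seq1 /=.
  by apply: le_trans (poincare_dist0_le _) _; [rewrite (ltW s0)|]; lra.
by have := congr1 (fun x => x - p) E; rewrite subrr addrAC subrr add0r.
Qed.

End NoComplexLine.

(** * Compactness of the holomorphic self-maps fixing a given set *)

Section SelfMaps.
Context {R : realType} {n : nat}.
Notation V := 'rV[R[i]]_n.
Notation pointwise := (prod_topology (fun _ : V => V)).
Implicit Types (p z v w y : V) (f g : V -> V).

(** Differentiability from an inequality that involves only three values of [phi] at a time, and
    which therefore passes to pointwise limits. [gbounded_quotient] supplies it with constants
    uniform in the map. *)
Lemma quotient_cder (phi : R[i] -> R[i]) (d K : R) : 0 < d ->
  (forall s t : R[i], 0 < normc s < d -> 0 < normc t < d ->
    normc ((phi s - phi 0) / s - (phi t - phi 0) / t) <= K * normc s + K * normc t) ->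
  exists l, cder phi 0 l.
Proof.
move=> d0 H.
have [i j|l Hl] := @complex_limit R {t : R[i] | 0 < normc t < d}
  (fun t => (phi (sval t) - phi 0) / sval t) (fun t => K * normc (sval t)).
  exact: H (svalP i) (svalP j).
exists l; apply: (@cder_quad _ _ _ _ d (2 * K) d0) => h hd.
rewrite add0r; have [->|h0] := eqVneq h 0.
  by rewrite subrr mulr0 subr0 Normc.normc0 expr0n mulr0.
have nh : 0 < normc h by rewrite normc_gt0.
have hP : 0 < normc h < d by rewrite nh.
have := Hl (exist _ h hP); rewrite /= -(ler_pM2r nh) -Normc.normcM mulrBl divfK //.
by rewrite -!mulrA -expr2.
Qed.

Lemma gbounded_quotient (phi : V -> R[i]) z (r M : R) v (s t : R[i]) : 0 < r ->
  gbounded phi z r M -> s != 0 -> t != 0 ->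
  normc s * nrm v < r / 8 -> normc t * nrm v < r / 8 ->
  normc ((phi (z + s *: v) - phi z) / s - (phi (z + t *: v) - phi z) / t)
    <= 512 * M / r ^+ 2 * nrm v ^+ 2 * normc s + 512 * M / r ^+ 2 * nrm v ^+ 2 * normc t.
Proof.
move=> r0 H s0 t0 sr tr; have zz : nrm (z - z) < r / 2 by rewrite subrr nrm0; lra.
have zz' : nrm (z - z) < r by rewrite subrr nrm0.
have Q (k : R[i]) : k != 0 -> normc k * nrm v < r / 8 ->
    normc ((phi (z + k *: v) - phi z) / k - gd phi z v) <= 512 * M / r ^+ 2 * nrm v ^+ 2 * normc k.
  move=> k0 kr; have nk : 0 < normc k by rewrite normc_gt0.
  rewrite -(ler_pM2r nk) -Normc.normcM mulrBl divfK // [gd _ _ _ * k]mulrC.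
  rewrite -(gdZ v k H zz'); apply: le_trans (gbounded_taylor r0 H zz _) _; first by rewrite nrmZ.
  by rewrite nrmZ; apply: le_of_eq; ring.
rewrite (_ : _ - _ = ((phi (z + s *: v) - phi z) / s - gd phi z v) -
  ((phi (z + t *: v) - phi z) / t - gd phi z v)); last by ring.
by apply: le_trans (normcB _ _) _; apply: lerD; apply: Q.
Qed.

Lemma closure_pointwise (L : set pointwise) f (e : R) (s : seq V) : closure L f -> 0 < e ->
  exists2 g, L g & forall z, z \in s -> nrm (g z - f z) < e.
Proof.
move=> Lf e0; have [|g [Lg Hg]] := Lf [set g | forall z, z \in s -> nrm (g z - f z) < e].
  elim: s => [|a s IH]; first by apply: filterS filterT.
  have A : nbhs (f : pointwise) [set g : pointwise | nrm (g a - f a) < e].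
    apply: (@proj_continuous _ (fun _ : V => V) a f [set y | nrm (y - f a) < e]).
    by apply/nbhs_nrmP; exists e.
  apply: filterS (filterI A IH) => g [ga gs] z; rewrite in_cons => /orP[/eqP ->|] //.
  exact: gs.
by exists g.
Qed.

(** The functions are total, so being the identity off [D] makes each determined by its values on
    [D], and keeps the set compact in the full product over [V]. *)
Definition selfmaps (D M : set V) : set (V -> V) := [set f |
  [/\ forall z, ~ D z -> f z = z, gholo D f, set_fun D D f & forall z, M z -> f z = z]].

Variables (D M : set V) (p : V).
Hypotheses (oD : open D) (cD : rconvex D) (nl : no_line D) (Mp : M p) (MD : M `<=` D).

Lemma selfmaps_local : exists (r : V -> R) (N : V -> nat) (B : V -> R), forall z, D z ->
  [/\ 0 < r z, 0 <= B z, forall y, nrm (y - z) < r z -> D y,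
      forall w, core D p (N z) w -> nrm w <= B z &
      forall f, selfmaps D M f -> forall y, nrm (y - z) < r z -> core D p (N z) (f y)].
Proof.
have Dp := MD Mp.
have [|c Hc] := @choice V (R * nat * R) (fun z c => D z ->
  [/\ 0 < c.1.1, 0 <= c.2, forall y, nrm (y - z) < c.1.1 -> D y,
      forall w, core D p c.1.2 w -> nrm w <= c.2 &
      forall f, selfmaps D M f -> forall y, nrm (y - z) < c.1.1 -> core D p c.1.2 (f y)]).
  move=> z; have [Dz|nDz] := pselect (D z); last by exists (0, 0%N, 0).
  have [r [N [r0 rD H]]] := harnack_core_local oD cD Dp Dz.
  have [B HB] := core_bounded N oD cD Dp nl.
  exists (r, N, `|B|) => _; split=> //= [w /HB wB|f [_ gf fD fM] y yr].
    by apply: le_trans wB (ler_norm _).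
  by apply: H => //; apply: fM.
by exists (fun z => (c z).1.1), (fun z => (c z).1.2), (fun z => (c z).2).
Qed.

Lemma selfmaps_gvec f z (r B : R) (N : nat) : 0 <= B ->
  (forall y, nrm (y - z) < r -> D y) -> (forall w, core D p N w -> nrm w <= B) ->
  (forall f, selfmaps D M f -> forall y, nrm (y - z) < r -> core D p N (f y)) ->
  selfmaps D M f -> gvec f z r B.
Proof.
move=> B0 rD NB SN Sf; have [_ gf _ _] := Sf; split=> // j y yr.
split=> [v|]; first by apply: gf; apply: rD.
by apply: le_trans (coord_nrm _ _) _; apply: NB; apply: SN.
Qed.

Lemma selfmaps_closed : closed (selfmaps D M : set pointwise).
Proof.
have [r [N [B H]]] := selfmaps_local; move=> f Sf.
have near z (e : R) : 0 < e -> exists2 g, selfmaps D M g & nrm (g z - f z) < e.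
  by move=> e0; have [g Sg Hg] := closure_pointwise [:: z] Sf e0; exists g => //; apply: Hg; rewrite inE.
have fix_ z : (forall g, selfmaps D M g -> g z = z) -> f z = z.
  move=> Hz; apply/eqP; rewrite -subr_eq0; apply/eqP/nrm_eq0/eqP.
  rewrite eq_le nrm_ge0 andbT; apply/ler_addgt0Pl => e e0; rewrite addr0.
  by have [g /Hz gz] := near z e e0; rewrite gz nrm_distC => /ltW.
split.
- by move=> z nDz; apply: fix_ => g [Hg _ _ _]; apply: Hg.
- move=> z Dz v j; have [r0 B0 rD NB SN] := H z Dz.
  have v1 : 0 < nrm v + 1 by rewrite ltr_wpDl ?nrm_ge0.
  pose K := 512 * B z / r z ^+ 2 * nrm v ^+ 2.
  apply: (@quotient_cder _ (r z / 8 / (nrm v + 1)) K); first by rewrite !divr_gt0.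
  have small (k : R[i]) : normc k < r z / 8 / (nrm v + 1) -> normc k * nrm v < r z / 8.
    rewrite ltr_pdivlMr //; apply: le_lt_trans.
    by rewrite ler_wpM2l ?normc_ge0 // lerDl.
  move=> s t /andP[s0 sr] /andP[t0 tr]; rewrite !scale0r !addr0.
  have s1 : s != 0 by rewrite -normc_gt0. have t1 : t != 0 by rewrite -normc_gt0.
  apply/ler_addgt0Pl => e e0.
  pose C := 2 * (normc s^-1 + normc t^-1) + 1.
  have C0 : 0 < C.
    have := normc_ge0 s^-1; have := normc_ge0 t^-1; rewrite /C; lra.
  (* A [g] in the set that is close to [f] at these three points has nearly the same quotients; [C]
     collects the factors [1 / |s|] and [1 / |t|] of the errors. *)
  have [g Sg ge] := closure_pointwise [:: z; z + s *: v; z + t *: v] Sf (divr_gt0 e0 C0).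
  have gz := ge z; have gs := ge (z + s *: v); have gt := ge (z + t *: v).
  rewrite !inE !eqxx ?orbT in gz gs gt.
  have {}gz := le_lt_trans (coord_nrm _ j) (gz isT).
  have {}gs := le_lt_trans (coord_nrm _ j) (gs isT).
  have {}gt := le_lt_trans (coord_nrm _ j) (gt isT).
  rewrite !mxE in gz gs gt.
  have [_ /(_ j) Gj] := selfmaps_gvec B0 rD NB SN Sg.
  have := gbounded_quotient r0 Gj s1 t1 (small s sr) (small t tr); rewrite -/K.
  move=> HQ; set q := (X in normc X <= _) in HQ.
  set Q := (X in normc X <= _).
  suff QE : normc (Q - q) <= e.
    have := normcD q (Q - q); rewrite subrKC => /le_trans; apply.
    by rewrite addrC; apply: lerD QE HQ.
  rewrite (_ : Q - q = ((g z ord0 j - f z ord0 j) - (g (z + s *: v) ord0 j - f (z + s *: v) ord0 j)) * s^-1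
    - ((g z ord0 j - f z ord0 j) - (g (z + t *: v) ord0 j - f (z + t *: v) ord0 j)) * t^-1); last first.
    by rewrite /Q /q; ring.
  have E2 (k a b : R[i]) : normc a < e / C -> normc b < e / C ->
      normc ((a - b) * k^-1) <= e / C * (2 * normc k^-1).
    move=> ha hb; rewrite Normc.normcM mulrA; apply: ler_wpM2r; first exact: normc_ge0.
    by apply: le_trans (normcB _ _) _; lra.
  apply: le_trans (normcB _ _) _.
  apply: le_trans (lerD (E2 _ _ _ gz gs) (E2 _ _ _ gz gt)) _.
  rewrite -mulrDr -mulrDr mulrAC ler_pdivrMr // ler_wpM2l ?(ltW e0) // /C; lra.
- move=> z Dz; have [r0 B0 rD NB SN] := H z Dz.
  (* The limit cannot reach the boundary of [D]: the values at [z] stay in one core, which is closed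
     and contained in [D]. *)
  apply: (core_sub oD cD (MD Mp) (N := N z)); apply: core_closed.
  apply/closure_nrmP => e e0; have [g Sg gz] := near z e e0.
  by exists (g z) => //; apply: SN => //; rewrite subrr nrm0.
by move=> z Mz; apply: fix_ => g [_ _ _ Hg]; apply: Hg.
Qed.

Lemma selfmaps_compact : compact (selfmaps D M : set pointwise).
Proof.
have [r [N [B H]]] := selfmaps_local.
pose A (z : V) : set V := [set w | (D z -> core D p (N z) w) /\ (~ D z -> w = z)].
have cA : compact [set f : pointwise | forall z, A z (f z)].
  apply: tychonoff => z; have [Dz|nDz] := pselect (D z).
    rewrite (_ : A z = core D p (N z)); first exact: core_compact oD cD (MD Mp) nl.
    by apply/seteqP; split=> [w [/(_ Dz)]|w Kw] //; split.
  rewrite (_ : A z = [set z]); first exact: compact_set1.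
  by apply/seteqP; split=> [w [_ /(_ nDz)]|w ->] //; split.
apply: subclosed_compact selfmaps_closed cA _ => f Sf z; split=> [Dz|nDz].
  have [r0 _ _ _ SN] := H z Dz; apply: SN => //; by rewrite subrr nrm0.
by case: Sf => Hf _ _ _; apply: Hf.
Qed.

Lemma id_selfmap : selfmaps D M id.
Proof.
split=> // z Dz v j; exists (v ord0 j) => e e0; exists 1 => // h _.
rewrite /= !mxE add0r mul0r addr0 [X in normc X](_ : _ = 0); last by ring.
by rewrite Normc.normc0 mulr_ge0 ?normc_ge0 // ltW.
Qed.

Lemma selfmaps_midpoint f g : selfmaps D M f -> selfmaps D M g ->
  selfmaps D M (fun z => (1 / 2 : R[i]) *: (f z + g z)).
Proof.
move=> [f1 f2 f3 f4] [g1 g2 g3 g4].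
have half z : (1 / 2 : R[i]) *: (z + z) = z.
  by apply/rowP => j; rewrite !mxE; field.
split=> [z nDz|z Dz v j|z Dz|z Mz]; last by rewrite f4 // g4 // half.
- by rewrite f1 // g1 // half.
- have [d1 D1] := f2 z Dz v j; have [d2 D2] := g2 z Dz v j.
  exists (1 / 2 * (d1 + d2)); apply: cder_ext (cderZ (1 / 2) (cderD D1 D2)).
  by exists 1 => // h _; rewrite !mxE.
have := cD (f3 z Dz) (g3 z Dz) (t := 1 / 2); rewrite (_ : _ + _ = (1 / 2 : R[i]) *: (f z + g z)).
  by apply; apply/andP; lra.
by apply/rowP => j; rewrite !mxE !realcE; field.
Qed.

End SelfMaps.

(** * Frechet derivatives as matrices *)

Section Frechet.
Context {R : realType}.

Lemma cauchy_const_ge0 (k : nat) (M r : R) : 0 <= M -> 0 < r -> 0 <= k%:R * M / r ^+ 2.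
Proof.
move=> M0 r0; apply: divr_ge0; first exact: mulr_ge0 (ler0n _ k) M0.
by apply: exprn_ge0; apply: ltW.
Qed.

Section Calculus.
Context {n m : nat}.
Notation V := 'rV[R[i]]_n.
Notation W := 'rV[R[i]]_m.
Implicit Types (f g : V -> W) (b z h v : V) (A B : 'M[R[i]]_(n, m)).

Definition fr f b A := forall e : R, 0 < e -> exists2 r : R, 0 < r &
  forall h, nrm h < r -> nrm (f (b + h) - f b - h *m A) <= e * nrm h.

Lemma fr_differentiable f b A : fr f b A -> differentiable f b.
Proof. exact: matrix_differentiable. Qed.

Lemma gvec_fr f a r M b : 0 < r -> gvec f a r M -> nrm (b - a) < r / 8 ->
  fr f b (jac f b).
Proof.
move=> r0 G br e e0; have [M0 _] := G.
pose K := 512 * M / r ^+ 2.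
have K0 : 0 <= K by exact: cauchy_const_ge0.
have K1 : 0 < K + 1 by lra.
exists (Num.min (r / 8) (e / (K + 1))); first by rewrite lt_min !divr_gt0.
move=> h; rewrite lt_min => /andP[hr hK].
apply: le_trans (gvec_taylor r0 G br hr) _; rewrite -/K expr2 mulrA.
rewrite ler_wpM2r ?nrm_ge0 //.
move: hK; rewrite ltr_pdivlMr // => hK; apply: le_trans (ltW hK).
by rewrite mulrC ler_wpM2l ?nrm_ge0 // lerDl.
Qed.

Lemma holomorphic_fr (U : set V) f z : open U -> holomorphic_on U f -> U z ->
  fr f z (jac f z).
Proof.
move=> oU hf Uz; have [r [M [r0 _ G]]] := differentiable_gvec oU hf Uz.
by apply: (gvec_fr r0 G); rewrite subrr nrm0 divr_gt0.
Qed.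

Lemma fr_continuous f b A (e : R) : fr f b A -> 0 < e -> exists2 r : R, 0 < r &
  forall y, nrm (y - b) < r -> nrm (f y - f b) < e.
Proof.
move=> /fr_differentiable/differentiable_continuous/continuous_nrmP H e0.
exact: H.
Qed.

Lemma fr_lip f b A : fr f b A -> exists2 K : R, 0 < K & exists2 r : R, 0 < r &
  forall h, nrm h < r -> nrm (f (b + h) - f b) <= K * nrm h.
Proof.
move=> /(_ 1 ltr01)[r r0 Hr]; have [K K0 HK] := mulmx_nrm_le A.
exists (1 + K); first by lra.
exists r => // h /Hr H; rewrite -[f _ - f b](subrK (h *m A)).
apply: le_trans (nrmD _ _) _; rewrite mulrDl; exact: lerD H (HK h).
Qed.

Lemma fr_cst (c : W) b : fr (fun=> c) b 0.
Proof.
move=> e e0; exists 1 => // h _.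
by rewrite mulmx0 subrr subr0 nrm0 mulr_ge0 ?nrm_ge0 // ltW.
Qed.

Lemma fr_mulmx A b : fr (fun z => z *m A) b A.
Proof.
move=> e e0; exists 1 => // h _.
by rewrite mulmxDl addrAC addrK subrr nrm0 mulr_ge0 ?nrm_ge0 // ltW.
Qed.

Lemma frD f g b A B : fr f b A -> fr g b B -> fr (fun z => f z + g z) b (A + B).
Proof.
move=> F G e e0; have e2 : 0 < e / 2 by lra.
have [r r0 Fr] := F _ e2; have [s s0 Gs] := G _ e2.
exists (Num.min r s); first by rewrite lt_min r0.
move=> h; rewrite lt_min => /andP[/Fr X /Gs Y].
rewrite (_ : _ - _ = (f (b + h) - f b - h *m A) + (g (b + h) - g b - h *m B)); last first.
  by rewrite mulmxDr; apply/rowP => j; rewrite !mxE; ring.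
apply: le_trans (nrmD _ _) _; lra.
Qed.

Lemma frN f b A : fr f b A -> fr (fun z => - f z) b (- A).
Proof.
move=> F e /F[r r0 Fr]; exists r => // h /Fr; rewrite -nrmN mulmxN.
by congr (nrm _ <= _); rewrite !opprB !opprK addrC; apply/rowP => j; rewrite !mxE; ring.
Qed.

Lemma frB f g b A B : fr f b A -> fr g b B -> fr (fun z => f z - g z) b (A - B).
Proof. by move=> F G; apply: frD F (frN G). Qed.

Lemma fr_slice f b A v j : fr f b A ->
  cder (fun t : R[i] => f (b + t *: v) ord0 j) 0 ((v *m A) ord0 j).
Proof.
move=> F e e0; have v1 : 0 < nrm v + 1 by rewrite ltr_wpDl ?nrm_ge0.
have [r r0 Hr] := F _ (divr_gt0 e0 v1); exists (r / (nrm v + 1)); first by rewrite divr_gt0.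
move=> h; rewrite ltr_pdivlMr // => hr.
have hv : nrm (h *: v) < r.
  by apply: le_lt_trans hr; rewrite nrmZ ler_wpM2l ?normc_ge0 // lerDl.
have := le_trans (coord_nrm _ j) (Hr _ hv); rewrite -scalemxAl !mxE.
rewrite add0r scale0r addr0 [_ * h]mulrC => /le_trans; apply.
rewrite nrmZ mulrCA mulrC ler_wpM2r ?normc_ge0 //.
by apply: divr_absorb; rewrite ?nrm_ge0 ?(ltW e0).
Qed.

Lemma fr_uniq f b A B : fr f b A -> fr f b B -> A = B.
Proof.
move=> FA FB; apply/row_matrixP => i; apply/rowP => j; rewrite !rowE.
exact: cder_uniq (fr_slice (delta_mx ord0 i) j FA) (fr_slice _ j FB).
Qed.

Lemma fr_ext f g b A (r : R) : 0 < r -> (forall z, nrm (z - b) < r -> f z = g z) ->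
  fr f b A -> fr g b A.
Proof.
move=> r0 E F e /F[s s0 Fs]; exists (Num.min r s); first by rewrite lt_min r0.
move=> h; rewrite lt_min => /andP[hr /Fs]; rewrite !E //; first by rewrite subrr nrm0.
by rewrite addrAC subrr add0r.
Qed.

(** Strict differentiability, with both points moving: the Taylor estimate at [c] is corrected by
    the Lipschitz bound for the Jacobian. The inverse function theorem and the action of [G] on
    leading coefficients both depend on it. *)
Lemma fr_strict f a r M (e : R) : 0 < r -> gvec f a r M -> 0 < e ->
  exists2 s : R, 0 < s & forall b c, nrm (b - a) < s -> nrm (c - a) < s ->
    nrm (f b - f c - (b - c) *m jac f a) <= e * nrm (b - c).
Proof.
move=> r0 G e0; have [M0 _] := G.
pose K := 512 * M / r ^+ 2; pose L := 128 * M / r ^+ 2.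
have K0 : 0 <= K by exact: cauchy_const_ge0.
have L0 : 0 <= L by exact: cauchy_const_ge0.
pose C := 2 * K + L + 1; have C0 : 0 < C by rewrite /C; lra.
exists (Num.min (r / 16) (e / C)); first by rewrite lt_min !divr_gt0.
move=> b c; rewrite !lt_min => /andP[b1 b2] /andP[c1 c2].
have bc : nrm (b - c) <= nrm (b - a) + nrm (c - a).
  by rewrite [nrm (c - a)]nrm_distC; exact: nrm_dist_triangle.
have c8 : nrm (c - a) < r / 8 by lra.
have bc8 : nrm (b - c) < r / 8 by lra.
have a8 : nrm (a - a) < r / 8 by rewrite subrr nrm0; lra.
have T := gvec_taylor r0 G c8 bc8; rewrite subrKC -/K in T.
have J := jac_lip (b - c) r0 G c8 a8; rewrite -/L in J.
rewrite (_ : _ - _ = (f b - f c - (b - c) *m jac f c) +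
  ((b - c) *m jac f c - (b - c) *m jac f a)); last by rewrite addrA subrK.
apply: le_trans (nrmD _ _) _; apply: le_trans (lerD T J) _.
rewrite expr2 mulrA -mulrDl ler_wpM2r ?nrm_ge0 //.
have qE : e = e / C * C by rewrite divfK // gt_eqF.
have q0 : 0 <= e / C by rewrite divr_ge0 // ltW.
have Kbc := ler_wpM2l K0 bc; have Kb := ler_wpM2l K0 (ltW b2).
have Kc := ler_wpM2l K0 (ltW c2); move: Kbc Kb Kc.
have := ler_wpM2l L0 (ltW c2); move: b2 c2 qE q0; move: (e / C) => q b2 c2 -> q0.
by rewrite /C; clearbody K L; clear -q0; lra.
Qed.

End Calculus.

Lemma fr_comp {n m k} (f : 'rV[R[i]]_n -> 'rV[R[i]]_m) (g : 'rV[R[i]]_m -> 'rV[R[i]]_k) b A B :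
  fr f b A -> fr g (f b) B -> fr (fun z => g (f z)) b (A *m B).
Proof.
move=> F G e e0.
have [K K0 [r r0 L]] := fr_lip F; have [C C0 HB] := mulmx_nrm_le B.
have [s s0 Gs] := G (e / 2 / K) ltac:(by rewrite !divr_gt0).
have [t t0 Ft] := F (e / 2 / C) ltac:(by rewrite !divr_gt0).
exists (Num.min r (Num.min t (s / K))); first by rewrite !lt_min r0 t0 divr_gt0.
move=> h; rewrite !lt_min => /and3P[/L X /Ft Y]; rewrite ltr_pdivlMr // mulrC => hs.
have := Gs (f (b + h) - f b) (le_lt_trans X hs); rewrite subrKC => Z.
rewrite (_ : _ - _ = (g (f (b + h)) - g (f b) - (f (b + h) - f b) *m B) +
  (f (b + h) - f b - h *m A) *m B); last first.
  by rewrite [(_ - h *m A) *m B]mulmxBl addrA subrK mulmxA.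
apply: le_trans (nrmD _ _) _.
have Z' : e / 2 / K * nrm (f (b + h) - f b) <= e / 2 * nrm h.
  have := ler_wpM2l (ltW (divr_gt0 (divr_gt0 e0 (ltr0Sn R 1)) K0)) X.
  by rewrite mulrA divfK // gt_eqF.
have Y' : C * nrm (f (b + h) - f b - h *m A) <= e / 2 * nrm h.
  by have := ler_wpM2l (ltW C0) Y; rewrite mulrA [C * (_ / C)]mulrC divfK // gt_eqF.
have := HB (f (b + h) - f b - h *m A); lra.
Qed.

Lemma fr_jac {n m} (f : 'rV[R[i]]_n -> 'rV[R[i]]_m) b A (U : set _) : open U ->
  holomorphic_on U f -> U b -> fr f b A -> jac f b = A.
Proof. by move=> oU hf Ub; exact: fr_uniq (holomorphic_fr oU hf Ub). Qed.

End Frechet.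

(** * Automorphisms fixing [M] and their action on self-maps *)

Section Action.
Context {R : realType} {n : nat}.
Notation V := 'rV[R[i]]_n.
Implicit Types (z v w y x : V) (f g h : V -> V).

Lemma holomorphic_gholo (D : set V) f : open D -> holomorphic_on D f -> gholo D f.
Proof.
move=> oD hf z Dz v j; exists ((v *m jac f z) ord0 j).
by apply: fr_slice; apply: holomorphic_fr hf Dz.
Qed.

Lemma holomorphic_comp (D E : set V) f g : holomorphic_on D f -> set_fun D E f ->
  holomorphic_on E g -> holomorphic_on D (fun z => g (f z)).
Proof.
by move=> hf fD hg z Dz; apply: differentiable_comp; [apply: hf | apply: hg; apply: fD].
Qed.

Definition fixers (D M : set V) : set (V -> V) :=
  [set g | automorphism D g /\ forall z, M z -> g z = z].

(** Automorphisms are arbitrary off [D], so a plain composite would leave [selfmaps]. *)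
Definition act (D : set V) g f : V -> V := fun z => if `[< D z >] then g (f z) else z.

Lemma actE (D : set V) g f z : D z -> act D g f z = g (f z).
Proof. by rewrite /act; case: asboolP. Qed.

Lemma act_out (D : set V) g f z : ~ D z -> act D g f z = z.
Proof. by rewrite /act; case: asboolP. Qed.

Lemma act_act (D : set V) g h f : act D g (act D h f) = act D (fun z => g (h z)) f.
Proof. by apply/funext => z; rewrite /act; case: asboolP. Qed.

Variables (D M : set V) (p : V).
Hypotheses (oD : open D) (cD : rconvex D) (nl : no_line D) (Mp : M p) (MD : M `<=` D).
Notation S := (selfmaps D M).
Notation G := (fixers D M).

Lemma selfmaps_gvec_local z : D z -> exists r B : R, [/\ 0 < r, 0 <= B,
  forall y, nrm (y - z) < r -> D y & forall f, S f -> gvec f z r B].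
Proof.
move=> Dz; have [r [N [B H]]] := selfmaps_local oD cD nl Mp MD.
have [r0 B0 rD NB SN] := H z Dz; exists (r z), (B z); split=> // f Sf.
exact: selfmaps_gvec B0 rD NB SN Sf.
Qed.

Lemma selfmap_holomorphic f : S f -> holomorphic_on D f.
Proof.
move=> Sf z Dz; have [r [B [r0 _ _ /(_ f Sf) Gf]]] := selfmaps_gvec_local Dz.
apply: fr_differentiable; apply: (gvec_fr r0 Gf); rewrite subrr nrm0 divr_gt0 //.
Qed.

Lemma fixers_id : G id.
Proof.
have hid := selfmap_holomorphic (id_selfmap D M).
by split=> //; split; [|split; [|exists id; split]].
Qed.

Lemma fixers_comp g h : G g -> G h -> G (fun z => g (h z)).
Proof.
move=> [[g1 [g2 [g' [g3 g4 g5 g6]]]] gM] [[h1 [h2 [h' [h3 h4 h5 h6]]]] hM].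
split=> [|z Mz]; last by rewrite hM ?gM.
split; first exact: holomorphic_comp h1 h2 g1.
split; first by move=> z Dz; apply: g2; apply: h2.
exists (fun z => h' (g' z)); split.
- exact: holomorphic_comp g3 g4 h3.
- by move=> z Dz; apply: h4; apply: g4.
- by move=> z Dz; rewrite g5 ?h5 //; apply: h2.
by move=> z Dz; rewrite h6 ?g6 //; apply: g4.
Qed.

Lemma fixers_inv g : G g -> exists2 g', G g' & forall z, D z -> g' (g z) = z.
Proof.
move=> [[g1 [g2 [g' [g3 g4 g5 g6]]]] gM]; exists g' => //; split; last first.
  by move=> z Mz; rewrite -{1}(gM z Mz) g5 //; apply: MD.
by split=> //; split=> //; exists g.
Qed.

Lemma act_selfmap g f : G g -> S f -> S (act D g f).
Proof.
move=> [[g1 [g2 _]] gM] Sf; have hf := selfmap_holomorphic Sf.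
case: Sf => f1 f2 f3 f4; split=> [z /act_out //||z Dz|z Mz].
- apply: holomorphic_gholo => // z Dz.
  have [r r0 Hr] := (open_nrmP D).1 oD z Dz.
  apply: fr_differentiable; apply: (fr_ext r0 (f := fun z => g (f z))).
    by move=> y /Hr Dy; rewrite actE.
  exact: fr_comp (holomorphic_fr oD hf Dz) (holomorphic_fr oD g1 (f3 _ Dz)).
- by rewrite actE //; apply: g2; apply: f3.
by rewrite actE ?f4 ?gM //; apply: MD.
Qed.

Lemma fixers_jac_inv g : G g -> exists2 g', G g' & jac g p *m jac g' p = 1%:M.
Proof.
move=> Gg; have [g' Gg' gK] := fixers_inv Gg; exists g' => //.
have Dp := MD Mp; have [r r0 Hr] := (open_nrmP D).1 oD p Dp.
case: Gg => [[g1 _] gM]; case: Gg' => [[g1' _] _].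
have F := holomorphic_fr oD g1 Dp; have F' := holomorphic_fr oD g1' Dp.
apply: (fr_uniq (f := id) (b := p)); last first.
  by have := fr_mulmx (1%:M : 'M[R[i]]_n) p; rewrite (_ : (fun z => _) = id) //; apply/funext => z; rewrite mulmx1.
apply: (fr_ext r0 (f := fun z => g' (g z))); first by move=> y /Hr Dy; rewrite gK.
by apply: fr_comp F _; rewrite gM.
Qed.

(** Each [g] agrees on [D] with the self-map [act D g id], to which the Cauchy bound common to all
    self-maps applies. The lower bound is the upper bound for the inverse automorphism. *)
Lemma fixers_jac_bound : exists2 C : R, 0 < C & forall g x, G g ->
  nrm (x *m jac g p) <= C * nrm x /\ nrm x <= C * nrm (x *m jac g p).
Proof.
have Dp := MD Mp; have [r [B [r0 B0 rD H]]] := selfmaps_gvec_local Dp.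
have B1 : 0 <= 8 * B / r by rewrite divr_ge0 ?mulr_ge0 // ltW.
have bd g x : G g -> nrm (x *m jac g p) <= (8 * B / r + 1) * nrm x.
  move=> Gg; have p8 : nrm (p - p) < r / 8 by rewrite subrr nrm0 divr_gt0.
  have Hg := H _ (act_selfmap Gg (id_selfmap D M)).
  have <- : jac (act D g id) p = jac g p.
    apply: (fr_uniq (gvec_fr r0 Hg p8)); apply: (fr_ext r0 (f := g)).
      by move=> y /rD Dy; rewrite actE.
    by case: Gg => [[g1 _] _]; apply: holomorphic_fr oD g1 Dp.
  apply: le_trans (jac_bound x r0 Hg p8) _.
  by rewrite ler_wpM2r ?nrm_ge0 // lerDl.
exists (8 * B / r + 1); first by rewrite ltr_wpDl.
move=> g x Gg; split; first exact: bd.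
have [g' Gg' E] := fixers_jac_inv Gg.
by rewrite -{1}[x]mulmx1 -E mulmxA; apply: bd.
Qed.

End Action.

(** * Minimal members of a family of closed sets *)

Section MinimalClosed.

(** Zorn's lemma is available for unions of chains, so it is applied to complements relative to [K];
    compactness keeps the intersection of a chain nonempty. *)
Lemma minimal_nonempty (T : topologicalType) (K : set T) (C : set (set T)) :
  compact K -> K !=set0 -> C K -> (forall X, C X -> closed X) ->
  (forall F : set (set T), F `<=` C -> C (\bigcap_(X in F) X)) ->
  exists L, [/\ L `<=` K, L !=set0, C L &
    forall X, C X -> X !=set0 -> X `<=` L -> X = L].
Proof.
move=> cK K0 CK clC CI.
pose P (X : set T) := C (K `&` ~` X) /\ K `&` ~` X !=set0.
have [F FP tF|A [[CA A0] maxA]] := @Zorn_bigcup T P.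
  (* [K] is added to the family so that the empty chain yields [K] and not the whole space. *)
  have E : K `&` ~` (\bigcup_(X in F) X) =
      \bigcap_(Y in K |` [set K `&` ~` X | X in F]) Y.
    apply/seteqP; split=> [x [Kx nx] Y [->//|[X FX <-]]|x Hx].
      by split=> // Xx; apply: nx; exists X.
    split; first by apply: Hx; left.
    by move=> [X FX Xx]; have [|_] := Hx (K `&` ~` X); first by right; exists X.
  split.
    by rewrite E; apply: CI => Y [->//|[X FX <-]]; case: (FP _ FX).
  have [[X0 FX0]|nF] := pselect (exists X, F X); last first.
    have [x Kx] := K0; exists x; split=> // -[X FX _]; apply: nF; by exists X.
  have PF : ProperFilter (filter_from F (fun X => K `&` ~` X)).
    apply: filter_from_proper; last by move=> X /FP[].
    apply: filter_from_filter; first by exists X0.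
    move=> X Y FX FY; have [XY|YX] := tF X Y FX FY.
      by exists Y => // x [Kx nY]; split; split=> // /XY.
    by exists X => // x [Kx nX]; split; split=> // /YX.
  have [|x [Kx Hx]] := cK _ PF.
    by exists X0 => // x [].
  exists x; split=> // -[X FX Xx].
  have [CX _] := FP _ FX; have [|_] := clC _ CX x; last by [].
  move=> B /(Hx (K `&` ~` X) B); apply; by exists X.
exists (K `&` ~` A); split=> // X CX X0 XL.
apply/seteqP; split=> // x [Kx nA]; apply: contrapT => nX.
have KX : K `&` ~` (~` X) = X by rewrite setCK; apply/setIidPr => y /XL[].
apply: (maxA (~` X)); last by rewrite /P KX.
split; last by move=> /(_ x nX).
by move=> y Ay Xy; case: (XL y Xy).
Qed.

End MinimalClosed.

(** * Leading coefficients of vector-valued functions *)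

Section VectorLeading.
Context {R : realType} {n : nat}.
Notation V := 'rV[R[i]]_n.
Implicit Types (F G : R[i] -> V) (c d x y : V) (m : nat).

Definition vlead F m c := forall e : R, 0 < e -> exists2 r : R, 0 < r &
  forall t, normc t < r -> nrm (F t - t ^+ m *: c) <= e * normc t ^+ m.

Lemma vlead_lead F m c j : vlead F m c -> lead (fun t => F t ord0 j) m (c ord0 j).
Proof.
move=> H e /H[r r0 Hr]; exists r => // t /Hr; apply: le_trans.
by have := coord_nrm (F t - t ^+ m *: c) j; rewrite !mxE.
Qed.

Lemma vlead_uniq F m c d : vlead F m c -> vlead F m d -> c = d.
Proof.
by move=> Hc Hd; apply/rowP => j; exact: lead_uniq (vlead_lead j Hc) (vlead_lead j Hd).
Qed.

Lemma vlead_comb F G m c d (a b : R[i]) : vlead F m c -> vlead G m d ->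
  vlead (fun t => a *: F t + b *: G t) m (a *: c + b *: d).
Proof.
move=> HF HG e e0; pose K := normc a + normc b + 1.
have K0 : 0 < K by have := normc_ge0 a; have := normc_ge0 b; rewrite /K; lra.
have [r r0 Fr] := HF _ (divr_gt0 e0 K0); have [s s0 Gs] := HG _ (divr_gt0 e0 K0).
exists (Num.min r s); first by rewrite lt_min r0.
move=> t; rewrite lt_min => /andP[/Fr X /Gs Y].
rewrite (_ : _ - _ = a *: (F t - t ^+ m *: c) + b *: (G t - t ^+ m *: d)); last first.
  by apply/rowP => j; rewrite !mxE; ring.
apply: le_trans (nrmD _ _) _; rewrite !nrmZ.
have := ler_wpM2l (normc_ge0 a) X; have := ler_wpM2l (normc_ge0 b) Y.
have : (e / K) * (normc a + normc b) <= e.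
  by apply: divr_absorb; [exact: ltW | exact: addr_ge0 (normc_ge0 _) (normc_ge0 _)].
have := exprn_ge0 m (normc_ge0 t).
move: (normc t ^+ m) (e / K) (normc a) (normc b) => T q u w T0 Q Yb Xa.
have := ler_wpM2r T0 Q; lra.
Qed.

Lemma vlead_ext F G m c (r : R) : 0 < r -> (forall t, normc t < r -> F t = G t) ->
  vlead F m c -> vlead G m c.
Proof.
move=> r0 E H e /H[s s0 Hs]; exists (Num.min r s); first by rewrite lt_min r0.
by move=> t; rewrite lt_min => /andP[/E <- /Hs].
Qed.

Lemma vleadB F G m c d : vlead F m c -> vlead G m d ->
  vlead (fun t => F t - G t) m (c - d).
Proof.
move=> HF HG; have := vlead_comb 1 (-1) HF HG; rewrite scale1r scaleN1r.
by apply: (vlead_ext ltr01) => t _; rewrite scale1r scaleN1r.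
Qed.

(* The quantitative remainder makes leading coefficients continuous in F for
   the pointwise topology. *)
Lemma vlead_exists (r B : R) m F : 0 < r ->
  (forall j, bhol (fun t => F t ord0 j) 0 r B) ->
  (forall j k, (k < m)%N -> lead (fun t => F t ord0 j) k 0) ->
  exists c, [/\ vlead F m c, nrm c <= `|B * (8 / r) ^+ m| &
    forall t, normc t < r / 2 ->
      nrm (F t - t ^+ m *: c) <= `|8 * (B * (8 / r) ^+ m) / r| * normc t ^+ m.+1].
Proof.
move=> r0 H L; set B' := B * (8 / r) ^+ m.
have [|k Hk] := @choice _ _ (fun j k => bhol k 0 r B' /\ forall t, F t ord0 j = t ^+ m * k t).
  by move=> j; have [k Hk E] := factor_power r0 (H j) (L j); exists k.
pose c : V := \row_j k j 0.
have Q t : normc t < r / 2 -> nrm (F t - t ^+ m *: c) <= `|8 * B' / r| * normc t ^+ m.+1.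
  move=> tr; apply: nrm_le => [|j]; first by rewrite mulr_ge0 // exprn_ge0 ?normc_ge0.
  have [bk E] := Hk j; rewrite !mxE E -mulrBr Normc.normcM normcX exprSr [leRHS]mulrCA.
  apply: ler_wpM2l; first by rewrite exprn_ge0 ?normc_ge0.
  have t2 : normc (t - 0) < r / 2 by rewrite subr0.
  have z2 : normc (0 - 0 : R[i]) < r / 2 by rewrite subr0 Normc.normc0; lra.
  apply: le_trans (bhol_lip r0 bk t2 z2) _; rewrite subr0.
  by rewrite ler_wpM2r ?normc_ge0 ?ler_norm.
exists c; split=> //.
- move=> e e0; set K := `|8 * B' / r| in Q; have K0 : 0 <= K := normr_ge0 _.
  have K1 : 0 < K + 1 by rewrite ltr_wpDl.
  exists (Num.min (r / 2) (e / (K + 1))); first by rewrite lt_min !divr_gt0.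
  move=> t; rewrite lt_min => /andP[/Q X tK]; apply: le_trans X _.
  rewrite exprSr mulrA mulrAC ler_wpM2r ?exprn_ge0 ?normc_ge0 //.
  apply: le_trans (ler_wpM2l K0 (ltW tK)) _.
  by rewrite mulrC; apply: divr_absorb => //; apply: ltW.
apply: nrm_le => // j; have [bk _] := Hk j; rewrite mxE.
have [|_ X] := bk 0; first by rewrite subrr Normc.normc0.
exact: le_trans X (ler_norm _).
Qed.

(** The error is relative to [|F t|] and not to [|t|], so it is negligible at order [m] whatever [m]
    is. *)
Lemma vlead_map F G m c (A : 'M[R[i]]_n) :
  (forall e : R, 0 < e -> exists2 r : R, 0 < r & forall t, normc t < r ->
    nrm (G t - F t *m A) <= e * nrm (F t)) ->
  vlead F m c -> vlead G m (c *m A).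
Proof.
move=> HG HF e e0; have [C C0 HA] := mulmx_nrm_le A.
have c1 : 0 < nrm c + 1 by rewrite ltr_wpDl ?nrm_ge0.
have [r r0 Gr] := HG (e / 2 / (nrm c + 1)) ltac:(by rewrite !divr_gt0).
have [s s0 Fs] := HF (Num.min 1 (e / 2 / C)) ltac:(by rewrite lt_min ltr01 !divr_gt0).
exists (Num.min r s); first by rewrite lt_min r0.
move=> t; rewrite lt_min => /andP[/Gr X /Fs Y].
have T0 := exprn_ge0 m (normc_ge0 t).
have Y1 : nrm (F t - t ^+ m *: c) <= normc t ^+ m.
  by apply: le_trans Y _; rewrite ler_piMl // ge_min lexx.
have Y2 : nrm (F t - t ^+ m *: c) <= e / 2 / C * normc t ^+ m.
  by apply: le_trans Y _; rewrite ler_wpM2r // ge_min lexx orbT.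
have NF : nrm (F t) <= (nrm c + 1) * normc t ^+ m.
  rewrite -[F t](subrK (t ^+ m *: c)); apply: le_trans (nrmD _ _) _.
  by rewrite nrmZ normcX; lra.
rewrite (_ : _ - _ = (G t - F t *m A) + (F t - t ^+ m *: c) *m A); last first.
  by rewrite mulmxBl -scalemxAl addrA subrK.
apply: le_trans (nrmD _ _) _.
have X' : e / 2 / (nrm c + 1) * nrm (F t) <= e / 2 * normc t ^+ m.
  have := ler_wpM2l (ltW (divr_gt0 (divr_gt0 e0 (ltr0Sn R 1)) c1)) NF.
  by rewrite mulrA divfK // gt_eqF.
have Y' : C * nrm (F t - t ^+ m *: c) <= e / 2 * normc t ^+ m.
  by have := ler_wpM2l (ltW C0) Y2; rewrite mulrA [C * (_ / C)]mulrC divfK // gt_eqF.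
have := HA (F t - t ^+ m *: c); lra.
Qed.

Lemma sqnorm_le x : sqnorm x <= n%:R * nrm x ^+ 2.
Proof.
rewrite /sqnorm -[n in n%:R]card_ord mulr_natl -sumr_const; apply: ler_sum => j _.
by rewrite lerXn2r ?nnegrE ?nrm_ge0 ?normc_ge0 ?coord_nrm.
Qed.

Lemma sqnorm_parallelogram x y :
  sqnorm ((1 / 2 : R[i]) *: (x + y)) = (sqnorm x + sqnorm y) / 2 - sqnorm (x - y) / 4.
Proof.
rewrite /sqnorm -big_split /= !mulr_suml -sumrN -big_split; apply: eq_bigr => j _ /=.
have E (a b : R[i]) : normc (1 / 2 * (a + b)) ^+ 2 =
    (normc a ^+ 2 + normc b ^+ 2) / 2 - normc (a - b) ^+ 2 / 4.
  rewrite Normc.normcM Normc.normcM Normc.normcV Normc.normc1.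
  rewrite (_ : normc 2 = 2); last by rewrite -(@realc_nat R 2) normc_real ger0_norm.
  rewrite exprMn !sqr_normcE.
  by rewrite !(ReD, ImD, ReN, ImN); field.
by rewrite !mxE.
Qed.

End VectorLeading.

Lemma slice_arith (R : realType) (T t K e a b c : R) : a < e / 2 * T ->
  b <= K * (T * t) -> c <= K * (T * t) -> 0 <= T * t ->
  T * (t * (2 * K + 1)) <= T * (e / 2) -> a + b + c <= T * e.
Proof. lra. Qed.

(** * A holomorphic retraction invariant under [G] *)

Section Retraction.
Context {R : realType} {n : nat}.
Notation V := 'rV[R[i]]_n.
Notation pointwise := (prod_topology (fun _ : V => V)).
Variables (D M : set V) (p : V).
Hypotheses (oD : open D) (cD : rconvex D) (nl : no_line D) (Mp : M p) (MD : M `<=` D).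
Notation S := (selfmaps D M).
Notation G := (fixers D M).
Implicit Types (z v w y x : V) (f g h : V -> V).

Definition slice v f h (t : R[i]) : V := f (p + t *: v) - h (p + t *: v).

Lemma slice_bhol v : exists r B : R, 0 < r /\
  forall f h, S f -> S h -> forall j, bhol (fun t => slice v f h t ord0 j) 0 r B.
Proof.
have [r [B [r0 B0 rD H]]] := selfmaps_gvec_local oD cD nl Mp MD (MD Mp).
have v1 : 0 < nrm v + 1 by rewrite ltr_wpDl ?nrm_ge0.
exists (r / (nrm v + 1)), (B + B); split; first by rewrite divr_gt0.
have p0 : nrm (p - p) < r by rewrite subrr nrm0.
have ps : nrm (p - p) + r / (nrm v + 1) * nrm v <= r.
  by rewrite subrr nrm0 add0r; apply: divr_absorb; [exact: ltW | exact: nrm_ge0].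
move=> f h /H[_ Hf] /H[_ Hh] j.
have := bholB (gbounded_slice (Hf j) p0 ps) (gbounded_slice (Hh j) p0 ps).
by congr bhol; apply/funext => t; rewrite !mxE.
Qed.

(** The identity theorem in the complex line through [p] and [z]. The part of this line in [D] is
    convex, so it can be followed from [p] at parameter 0 to [z] at parameter 1. *)
Lemma slice_flat f h z : S f -> S h ->
  (forall m j, lead (fun t => slice (z - p) f h t ord0 j) m 0) -> f z = h z.
Proof.
move=> Sf Sh L; have [Dz|nDz] := pselect (D z); last first.
  by case: Sf => -> // _ _ _; case: Sh => ->.
apply/rowP => j; apply/eqP; rewrite -subr_eq0; apply/eqP.
pose O : set R[i] := [set t | D (p + t *: (z - p))].
have := @identity_segment R O (fun t => slice (z - p) f h t ord0 j).
rewrite /slice scale1r subrKC !mxE; apply; rewrite /O /=.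
- move=> a b t Da Db t01; have := cD Da Db t01.
  by congr (D _); apply/rowP => i; rewrite !mxE; ring.
- move=> t Dt; have [r r0 Hr] := (open_nrmP D).1 oD _ Dt.
  have v1 : 0 < nrm (z - p) + 1 by rewrite ltr_wpDl ?nrm_ge0.
  exists (r / (nrm (z - p) + 1)) => [|k]; first by rewrite divr_gt0.
  rewrite ltr_pdivlMr // => kr; apply: Hr; rewrite scalerDl addrA [X in nrm X]addrC addKr nrmZ.
  by apply: le_lt_trans kr; rewrite ler_wpM2l ?normc_ge0 // lerDl.
- move=> t Dt; case: Sf => _ gf _ _; case: Sh => _ gh _ _.
  have [d1 D1] := gf _ Dt (z - p) j; have [d2 D2] := gh _ Dt (z - p) j.
  exists (d1 - d2).
  have := cderB (cder_slice_shift (phi := fun y => f y ord0 j) D1)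
                (cder_slice_shift (phi := fun y => h y ord0 j) D2).
  by congr (cder _ _ _); apply/funext => s; rewrite !mxE.
- by rewrite scale0r addr0; apply: MD.
- by rewrite scale1r subrKC.
by move=> m; exact: L.
Qed.

Lemma selfmap_near f v (e : R) : S f -> 0 < e -> exists2 r : R, 0 < r &
  forall t : R[i], normc t < r -> nrm (f (p + t *: v) - p) < e.
Proof.
move=> Sf e0; have hf := selfmap_holomorphic oD cD nl Mp MD Sf.
have [r r0 Hr] := fr_continuous (holomorphic_fr oD hf (MD Mp)) e0.
have v1 : 0 < nrm v + 1 by rewrite ltr_wpDl ?nrm_ge0.
exists (r / (nrm v + 1)) => [|t]; first by rewrite divr_gt0.
rewrite ltr_pdivlMr // => tr; have fp : f p = p by case: Sf => _ _ _; apply.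
rewrite -{2}fp; apply: Hr.
rewrite addrC addKr nrmZ.
by apply: le_lt_trans tr; rewrite ler_wpM2l ?normc_ge0 // lerDl.
Qed.

(** Along the slice [f] and [h] both approach [p], while their difference may be of much higher
    order. Strict differentiability of [g] at [p] makes the error small relative to that
    difference. *)
Lemma slice_act g f h v m c : G g -> S f -> S h -> vlead (slice v f h) m c ->
  vlead (slice v (act D g f) (act D g h)) m (c *m jac g p).
Proof.
move=> Gg Sf Sh vL; refine (vlead_map _ vL) => e e0.
have [[g1 _] _] := Gg; have Dp := MD Mp.
have [r [B [r0 _ H]]] := differentiable_gvec oD g1 Dp.
have [s s0 Hs] := fr_strict r0 H e0.
have [r1 r10 H1] := selfmap_near v Sf s0; have [r2 r20 H2] := selfmap_near v Sh s0.
have [d d0 Hd] := (open_nrmP D).1 oD p Dp.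
have [r3 r30 H3] := selfmap_near v (id_selfmap D M) d0.
exists (Num.min r1 (Num.min r2 r3)); first by rewrite !lt_min r10 r20.
move=> t; rewrite !lt_min => /and3P[t1 t2 t3].
have Dt : D (p + t *: v) by apply: Hd; apply: H3.
by rewrite /slice !actE //; apply: Hs; [apply: H1 | apply: H2].
Qed.

Definition invariant_family (L : set pointwise) := [/\ closed L,
  forall f h, L f -> L h -> L (fun z => (1 / 2 : R[i]) *: (f z + h z)) &
  forall g f, G g -> L f -> L (act D g f)].

Lemma invariant_bigcap (F : set (set pointwise)) : F `<=` invariant_family ->
  invariant_family (\bigcap_(X in F) X).
Proof.
move=> H; split.
- by apply: closed_bigI => X /H[].
- by move=> f h Lf Lh X FX; have [_ mid _] := H X FX; apply: mid; [apply: Lf | apply: Lh].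
by move=> g f Gg Lf X FX; have [_ _ inv] := H X FX; apply: inv => //; apply: Lf.
Qed.

Lemma selfmaps_invariant : invariant_family S.
Proof.
split; first exact: selfmaps_closed oD cD nl Mp MD.
- by move=> f h; exact: selfmaps_midpoint.
by move=> g f; exact: act_selfmap oD cD nl Mp MD g f.
Qed.

(* Otherwise two elements of L differ to some order at p along a slice; at the
   least such order the leading coefficients Lam depend on f continuously,
   affinely and G-equivariantly.  The sublevels of f |-> sup_g |Lam (g f)|^2
   then belong to the family, so this function is constant on L, against the
   strict convexity of the norm. *)
Lemma minimal_singleton (L : set pointwise) : L `<=` S -> invariant_family L ->
  (forall X, invariant_family X -> X !=set0 -> X `<=` L -> X = L) ->
  forall f1 f2, L f1 -> L f2 -> f1 = f2.
Proof.
move=> LS [clL midL actL] minL f1 f2 L1 L2; apply: contrapT => ne.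
have [z zne] : exists z, f1 z <> f2 z.
  apply: contrapT => H; apply: ne; apply/funext => z; apply: contrapT => zne.
  by apply: H; exists z.
set v := z - p.
(* The least bad order is taken over all pairs in [L] at once, so below it every difference is flat,
   and at it the leading coefficient is defined on all of [L]. *)
pose bad m := `[< exists f h j, [/\ L f, L h & ~ lead (fun t => slice v f h t ord0 j) m 0] >].
have exbad : exists m, bad m.
  apply: contrapT => H; apply: zne; apply: (slice_flat (LS _ L1) (LS _ L2)) => m j.
  by apply: contrapT => nlead; apply: H; exists m; apply/asboolP; exists f1, f2, j.
case: (ex_minnP exbad) => m /asboolP[fa [fb [ja [La Lb nlead]]]] mmin.
have flat f h : L f -> L h -> forall j k, (k < m)%N ->
    lead (fun t => slice v f h t ord0 j) k 0.
  move=> Lf Lh j k km; apply: contrapT => nk; have := mmin k; rewrite leqNgt km.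
  by move=> /(_ _)/notF; apply; apply/asboolP; exists f, h, j.
have [r [B [r0 HB]]] := slice_bhol v.
have K20 : 0 <= `|8 * (B * (8 / r) ^+ m) / r| := normr_ge0 _.
set K1 := `|B * (8 / r) ^+ m|; set K2 := `|8 * (B * (8 / r) ^+ m) / r| in K20 *.
(* Coefficients are measured against the fixed base [f1]. As [G] need not fix [f1], it acts on them
   by affine maps, whose linear parts are the derivatives at [p]. *)
have [|Lam HLam] := @choice (V -> V) V (fun f c => L f ->
  [/\ vlead (slice v f f1) m c, nrm c <= K1 &
    forall t, normc t < r / 2 -> nrm (slice v f f1 t - t ^+ m *: c) <= K2 * normc t ^+ m.+1]).
  move=> f; have [Lf|nLf] := pselect (L f); last by exists 0.
  by have [c Hc] := vlead_exists r0 (HB _ _ (LS _ Lf) (LS _ L1)) (flat _ _ Lf L1); exists c.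
clearbody K1 K2.
have LamB f h : L f -> L h -> vlead (slice v f h) m (Lam f - Lam h).
  move=> /HLam[lf _ _] /HLam[lh _ _]; have := vleadB lf lh.
  by apply: (vlead_ext ltr01) => t _; rewrite /slice opprB addrA subrK.
have LamG g f h : G g -> L f -> L h ->
    Lam (act D g f) - Lam (act D g h) = (Lam f - Lam h) *m jac g p.
  move=> Gg Lf Lh; apply: vlead_uniq (LamB _ _ (actL _ _ Gg Lf) (actL _ _ Gg Lh)) _.
  exact: slice_act Gg (LS _ Lf) (LS _ Lh) (LamB _ _ Lf Lh).
pose mid f h : V -> V := fun z => (1 / 2 : R[i]) *: (f z + h z).
have LamM f h : L f -> L h -> Lam (mid f h) = (1 / 2 : R[i]) *: (Lam f + Lam h).
  move=> Lf Lh; have [lf _ _] := HLam _ Lf; have [lh _ _] := HLam _ Lh.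
  have [lm _ _] := HLam _ (midL _ _ Lf Lh).
  rewrite scalerDr; apply: vlead_uniq lm _; have := vlead_comb (1 / 2) (1 / 2) lf lh.
  by apply: (vlead_ext ltr01) => t _; apply/rowP => j; rewrite /slice !mxE; field.
(* [g] does not preserve midpoints, but it does so to leading order, where only its derivative at
   [p] counts. *)
have LamGM g f h : G g -> L f -> L h ->
    Lam (act D g (mid f h)) = (1 / 2 : R[i]) *: (Lam (act D g f) + Lam (act D g h)).
  move=> Gg Lf Lh; have := LamG _ _ _ Gg (midL _ _ Lf Lh) Lf; have := LamG _ _ _ Gg Lh Lf.
  rewrite -/(mid f h) LamM // => E1 E2.
  have E3 : (1 / 2 : R[i]) *: (Lam f + Lam h) - Lam f = (1 / 2 : R[i]) *: (Lam h - Lam f).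
    by apply/rowP => j; rewrite !mxE; field.
  rewrite E3 -scalemxAl -E1 in E2; rewrite -[LHS](subrK (Lam (act D g f))) E2.
  by apply/rowP => j; rewrite !mxE; field.
(* A single point controls [Lam]: at [p + t v] the values of [h] and [f] differ by
   [t ^+ m *: (Lam h - Lam f)] up to [2 * K2 * t ^+ m.+1], and [t] is chosen so that this remainder
   uses at most half of [e]. *)
have near f (e : R) : L f -> 0 < e -> exists (q : V) (d : R), 0 < d /\
    forall h, L h -> nrm (h q - f q) < d -> nrm (Lam h - Lam f) <= e.
  move=> Lf e0; have K21 : 0 < 2 * K2 + 1 by lra.
  pose t := Num.min (r / 4) (e / 2 / (2 * K2 + 1)).
  have t0 : 0 < t by rewrite lt_min !divr_gt0.
  have tr : t < r / 2 by have : t <= r / 4 by [rewrite ge_min lexx]; lra.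
  have te : t * (2 * K2 + 1) <= e / 2 by rewrite -ler_pdivlMr // ge_min lexx orbT.
  have nt : normc t%:C = t by rewrite normc_real gtr0_norm.
  have T0 : 0 < t ^+ m by rewrite exprn_gt0.
  exists (p + t%:C *: v), (e / 2 * t ^+ m); split=> [|h Lh hf]; first by rewrite mulr_gt0 // divr_gt0.
  have [_ _ /(_ t%:C)] := HLam _ Lf; rewrite nt => /(_ tr) Qf.
  have [_ _ /(_ t%:C)] := HLam _ Lh; rewrite nt => /(_ tr) Qh.
  rewrite -(ler_pM2l T0) -{1}nt -normcX -nrmZ.
  rewrite (_ : _ *: _ = (h (p + t%:C *: v) - f (p + t%:C *: v)) -
    (slice v h f1 t%:C - t%:C ^+ m *: Lam h) + (slice v f f1 t%:C - t%:C ^+ m *: Lam f)); last first.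
    by apply/rowP => j; rewrite /slice !mxE; ring.
  apply: le_trans (nrmD _ _) _; apply: le_trans (lerD (nrmB _ _) (lexx _)) _.
  have := ler_wpM2l (ltW T0) te; rewrite exprSr in Qf Qh.
  exact: slice_arith hf Qh Qf (mulr_ge0 (ltW T0) (ltW t0)).
have [C C0 HC] := fixers_jac_bound oD cD nl Mp MD.
pose P (c : R) : set pointwise := [set f | L f /\ forall g, G g -> sqnorm (Lam (act D g f)) <= c].
have PL c : P c `<=` L by move=> f [].
have invP c : invariant_family (P c).
  split.
  - move=> f Pf; have Lf : L f by apply: clL; exact: (closure_subset (PL c)).
    split=> // g Gg; pose Z := [set x : V | sqnorm x <= c].
    have cZ : closed Z.
      rewrite (_ : Z = (fun x => sqnorm (x - 0)) @^-1` [set s | s <= c]); last first.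
        by apply/seteqP; split=> x; rewrite /Z /= subr0.
      by apply: preimage_closed; [move=> x _; exact: sqnorm_continuous | exact: closed_le].
    apply: cZ; apply/closure_nrmP => e e0.
    have eC : 0 < e / 2 / C by rewrite !divr_gt0.
    have [q [d [d0 Hd]]] := near f _ Lf eC.
    have [h [Lh Ph] hq] := closure_pointwise [:: q] Pf d0.
    exists (Lam (act D g h)); first exact: Ph.
    rewrite LamG //; apply: le_lt_trans (HC _ _ Gg).1 _.
    have := Hd h Lh (hq q (mem_head _ _)); rewrite ler_pdivlMr // mulrC; lra.
  - move=> f h [Lf Pf] [Lh Ph]; split=> [|g Gg]; first exact: midL.
    rewrite -/(mid f h) LamGM // sqnorm_parallelogram.
    have := Pf g Gg; have := Ph g Gg; have := sqnorm_ge0 (Lam (act D g f) - Lam (act D g h)); lra.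
  move=> g f Gg [Lf Pf]; split=> [|g' Gg']; first exact: actL.
  by rewrite act_act; apply: Pf; exact: fixers_comp.
have LamAB : Lam fa != Lam fb.
  apply/eqP => E; apply: nlead; have := vlead_lead ja (LamB _ _ La Lb).
  by rewrite E subrr mxE.
have w0 : 0 < nrm (Lam fa - Lam fb) by apply: nrm_gt0; rewrite subr_eq0.
(* By the parallelogram identity the midpoint of [fa] and [fb] gains a quarter of the squared
   difference. Acting by [g] shrinks that difference by at most the factor [C], so the gain is at
   least [d] for all [g] simultaneously. *)
pose d := (nrm (Lam fa - Lam fb) / C) ^+ 2 / 4.
have d0 : 0 < d by rewrite divr_gt0 // exprn_gt0 // divr_gt0.
pose A := [set sqnorm (Lam f) | f in L].
have hs : has_sup A.
  split; first by exists (sqnorm (Lam f1)), f1.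
  exists (n%:R * K1 ^+ 2) => _ [f Lf <-]; apply: le_trans (sqnorm_le _) _.
  have [_ fK _] := HLam _ Lf; rewrite ler_wpM2l //.
  by rewrite lerXn2r ?nnegrE ?nrm_ge0 // (le_trans (nrm_ge0 _) fK).
have leA f : L f -> sqnorm (Lam f) <= sup A.
  by move=> Lf; apply: ub_le_sup; [case: hs | exists f].
have Pmid : P (sup A - d) (mid fa fb).
  split=> [|g Gg]; first exact: midL.
  rewrite LamGM // sqnorm_parallelogram.
  have := leA _ (actL _ _ Gg La); have := leA _ (actL _ _ Gg Lb).
  suff : 4 * d <= sqnorm (Lam (act D g fa) - Lam (act D g fb)) by lra.
  apply: le_trans (sqnorm_nrm _); rewrite LamG // /d mulrC divfK ?pnatr_eq0 //.
  rewrite lerXn2r ?nnegrE ?nrm_ge0 ?divr_ge0 ?nrm_ge0 ?(ltW C0) //.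
  by rewrite ler_pdivrMr // mulrC; exact: (HC _ _ Gg).2.
(* The sublevel set is a nonempty invariant subset of [L], hence all of it by minimality, and then
   every value lies [d] below the supremum. *)
have PE : P (sup A - d) = L.
  by apply: minL (invP _) _ (PL _); exists (mid fa fb).
have : sup A <= sup A - d.
  apply: ge_sup; first by case: hs.
  move=> _ [f Lf <-]; move: (Lf); rewrite -PE => -[_ /(_ id (fixers_id oD cD nl Mp MD))].
  congr (sqnorm (Lam _) <= _); apply/funext => y.
  have [Dy|nDy] := pselect (D y); first by rewrite actE.
  by rewrite act_out //; case: (LS _ Lf) => ->.
lra.
Qed.

Lemma holomorphic_retraction : exists f, S f /\
  forall g, G g -> forall z, D z -> g (f z) = f z.
Proof.
have [|||||L [LS [f Lf] invL minL]] := @minimal_nonempty pointwise S invariant_family.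
- exact: selfmaps_compact oD cD nl Mp MD.
- by exists id; exact: id_selfmap.
- exact: selfmaps_invariant.
- by move=> X [].
- exact: invariant_bigcap.
exists f; split=> [|g Gg z Dz]; first exact: LS.
have Lgf : L (act D g f) by case: invL => _ _; apply.
by rewrite -{2}(minimal_singleton LS invL minL Lgf Lf) actE.
Qed.

End Retraction.

(** * The holomorphic inverse function theorem *)

Section InverseFunction.
Context {R : realType} {n : nat}.
Notation V := 'rV[R[i]]_n.
Implicit Types (F : V -> V) (p b c w z y x h : V).

Lemma ball_open (V0 : normedModType R[i]) (a : V0) (r : R) : open [set z | nrm (z - a) < r].
Proof.
apply/open_nrmP => z /= zr; exists (r - nrm (z - a)); first by rewrite subr_gt0.
by move=> y yz; apply: le_lt_trans (nrm_dist_triangle z _ _) _; lra.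
Qed.

Lemma real_continuous_at {V0 : normedModType R[i]} (f : V0 -> R) (x : V0) :
  (forall e : R, 0 < e -> exists2 r : R, 0 < r &
    forall y : V0, nrm (y - x) < r -> `|f x - f y| <= e) -> {for x, continuous f}.
Proof.
move=> H; apply/cvgrPdist_le => e e0; apply/nbhs_nrmP.
by have [r r0 Hr] := H e e0; exists r.
Qed.

Lemma injective_unitmx (A : 'M[R[i]]_n) : (forall x, x *m A = 0 -> x = 0) -> A \in unitmx.
Proof.
move=> H; rewrite -row_free_unit -kermx_eq0; apply/eqP/row_matrixP => i.
by rewrite row0; apply: H; apply/sub_kermxP; apply: row_sub.
Qed.

Lemma near_id_sub b c (k : V) : nrm (k - (b - c)) <= 1 / 2 * nrm (b - c) ->
  nrm (b - c) <= 2 * nrm k.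
Proof.
move=> H; have := nrmD k (- (k - (b - c))); rewrite nrmN opprB addrC subrK.
by lra.
Qed.

(** In place of a fixed point iteration, [|F z - w|] is minimized on a compact ball: from a
    minimizer, one step [z - (F z - w)] would at least halve the residual, which is therefore 0. *)
Lemma near_id_surj F p w (s : R) :
  (forall b c, nrm (b - p) < s -> nrm (c - p) < s ->
     nrm (F b - F c - (b - c)) <= 1 / 2 * nrm (b - c)) ->
  nrm (w - F p) < s / 16 -> exists2 z, nrm (z - p) < s & F z = w.
Proof.
move=> H ws; have s0 : 0 < s by have := nrm_ge0 (w - F p); lra.
pose A := [set z : V | nrm (z - p) <= s / 2].
have As z : A z -> nrm (z - p) < s by rewrite /A /=; lra.
have cA : compact A.
  apply: (@nrm_bounded_compact _ _ _ (s / 2 + nrm p)) => [|x xA].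
    apply: closed_nrmP => x Hx; rewrite /A /=; apply/ler_addgt0Pl => e e0.
    have [y yA yx] := Hx e e0; rewrite /A /= in yA.
    by have := nrm_dist_triangle y x p; rewrite [nrm (x - y)]nrm_distC; lra.
  rewrite -[x](subrK p); apply: le_trans (nrmD _ _) _; by rewrite lerD2r.
have p0 : nrm (p - p) < s by rewrite subrr nrm0.
have [||z zA min] := @compact_EVT_min _ _ (fun z => nrm (F z - w)) A _ cA.
- by exists p; rewrite /A /= subrr nrm0; lra.
- apply: continuous_in_subspaceT => z /set_mem zA; apply: real_continuous_at => e e0.
  have zs := As z zA.
  exists (Num.min (s - nrm (z - p)) (e / 2)); first by rewrite lt_min subr_gt0 zs divr_gt0.
  move=> y; rewrite lt_min => /andP[y1 y2].
  have ys : nrm (y - p) < s by have := nrm_dist_triangle z y p; lra.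
  have := H y z ys zs; have := nrmD (F y - F z - (y - z)) (y - z); rewrite subrK.
  have := nrm_dist_triangle (F z) (F y) w; have := nrm_dist_triangle (F y) (F z) w.
  rewrite [nrm (F z - F y)]nrm_distC ler_norml => *; apply/andP; split; lra.
have {zA} zA : A z by apply: set_mem.
have pA : A p by rewrite /A /= subrr nrm0; lra.
have m1 := min p (mem_set pA); rewrite nrm_distC in ws.
have zp := near_id_sub (H z p (As z zA) p0).
have zFp := nrm_dist_triangle w (F z) (F p); rewrite [nrm (w - F p)]nrm_distC in zFp.
(* The minimizer has residual below [s / 16], so it lies within [s / 4] of [p], and the step stays
   in the ball of radius [s / 2]. *)
pose z' := z - (F z - w).
have z'A : A z'.
  rewrite /A /= /z' addrAC; apply: le_trans (nrmB _ _) _; lra.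
have := H z' z (As _ z'A) (As _ zA); have := min z' (mem_set z'A).
have -> : z' - z = - (F z - w) by rewrite /z' addrAC subrr add0r.
rewrite opprK subrKA nrmN => m2 m3.
exists z; first exact: As.
apply/eqP; rewrite -subr_eq0; apply/eqP/nrm_eq0/eqP; rewrite eq_le nrm_ge0 andbT.
by have := le_trans m2 m3; lra.
Qed.

Lemma fr_inverse F (g : V -> V) z w (A : 'M[R[i]]_n) (d K : R) : F z = w -> g w = z ->
  A \in unitmx -> fr F z A -> 0 < d ->
  (forall k, nrm k < d -> F (g (w + k)) = w + k /\ nrm (g (w + k) - z) <= K * nrm k) ->
  fr g w (invmx A).
Proof.
move=> Fz gw Au HF d0 H e e0; have [C C0 HC] := mulmx_nrm_le (invmx A).
have K1 : 0 < `|K| + 1 by rewrite ltr_wpDl.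
have [r r0 Hr] := HF (e / (`|K| + 1) / C) ltac:(by rewrite !divr_gt0).
exists (Num.min d (r / (`|K| + 1))); first by rewrite lt_min d0 divr_gt0.
move=> k; rewrite lt_min => /andP[/H[Fg gk]]; rewrite ltr_pdivlMr // mulrC => kr.
have {gk} gk : nrm (g (w + k) - z) <= (`|K| + 1) * nrm k.
  apply: le_trans gk _; rewrite ler_wpM2r ?nrm_ge0 //.
  by apply: le_trans (ler_norm _) _; rewrite lerDl.
have := Hr _ (le_lt_trans gk kr); rewrite subrKC Fg Fz [w + k - w]addrC addKr => X.
rewrite gw (_ : _ - _ = - ((k - (g (w + k) - z) *m A) *m invmx A)); last first.
  by rewrite mulmxBl mulmxK // opprB.
rewrite nrmN; apply: le_trans (HC _) _; apply: le_trans (ler_wpM2l (ltW C0) X) _.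
rewrite mulrA [C * _]mulrC divfK ?gt_eqF //.
have eK : 0 <= e / (`|K| + 1) by rewrite divr_ge0 // ltW.
by apply: le_trans (ler_wpM2l eK gk) _; rewrite mulrA divfK // gt_eqF.
Qed.

(** Injectivity is stated on a ball fixed in advance, while [U] can be as small as desired: the
    chart at a point of [M] compares [z] in [U] with its image under the retraction, which may lie
    outside [U]. *)
Lemma inverse_function F p (r M : R) : 0 < r -> gvec F p r M -> jac F p = 1%:M ->
  exists2 s : R, 0 < s &
    (forall y z, nrm (y - p) < s -> nrm (z - p) < s -> F y = F z -> y = z) /\
    forall e : R, 0 < e -> exists U W : set V,
      [/\ open U /\ U p, open W, biholomorphic U W F & forall z, U z -> nrm (z - p) < e].
Proof.
move=> r0 Gv J1; have h0 : 0 < 1 / 2 :> R by lra.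
have [s1 s10 Hs1] := fr_strict r0 Gv h0.
pose s := Num.min s1 (r / 8); have s0 : 0 < s by rewrite lt_min s10 divr_gt0.
have Hs b c : nrm (b - p) < s -> nrm (c - p) < s ->
    nrm (F b - F c - (b - c)) <= 1 / 2 * nrm (b - c).
  rewrite !lt_min => /andP[b1 _] /andP[c1 _].
  by have := Hs1 b c b1 c1; rewrite J1 mulmx1.
have sub b c : nrm (b - p) < s -> nrm (c - p) < s -> nrm (b - c) <= 2 * nrm (F b - F c).
  by move=> bs cs; apply: near_id_sub; apply: Hs.
have Ffr z : nrm (z - p) < s -> fr F z (jac F z).
  by rewrite lt_min => /andP[_ zr]; exact: gvec_fr r0 Gv zr.
have p0 : nrm (p - p) < s by rewrite subrr nrm0.
have inj y z : nrm (y - p) < s -> nrm (z - p) < s -> F y = F z -> y = z.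
  move=> ys zs E; apply/eqP; rewrite -subr_eq0; apply/eqP/nrm_eq0/eqP.
  rewrite eq_le nrm_ge0 andbT; apply: le_trans (sub _ _ ys zs) _.
  by rewrite E subrr nrm0 mulr0.
exists s => //; split=> // e e0.
pose t := Num.min (s / 16) (e / 2); have t0 : 0 < t by rewrite lt_min !divr_gt0.
have ts : t <= s / 16 by rewrite ge_min lexx.
have te : t <= e / 2 by rewrite ge_min lexx orbT.
pose W := [set w | nrm (w - F p) < t].
pose U := [set z | nrm (z - p) < s /\ nrm (F z - F p) < t].
have oW : open W by exact: ball_open.
have [|g Hg] := @choice V V (fun w z => W w -> nrm (z - p) < s /\ F z = w).
  move=> w; have [Ww|nW] := pselect (W w); last by exists 0.
  have [|z zs Fz] := near_id_surj (w := w) Hs; last by exists z.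
  by apply: lt_le_trans Ww ts.
exists U, W; split=> //.
- split; last by rewrite /U /= !subrr !nrm0.
  apply/open_nrmP => z [zs zt].
  have zt0 : 0 < t - nrm (F z - F p) by rewrite subr_gt0.
  have [d d0 Hd] := fr_continuous (Ffr z zs) zt0.
  exists (Num.min d (s - nrm (z - p))); first by rewrite lt_min d0 subr_gt0.
  move=> y; rewrite lt_min => /andP[/Hd y1 y2]; split.
    by have := nrm_dist_triangle z y p; lra.
  by have := nrm_dist_triangle (F z) (F y) (F p); lra.
- split; first by move=> z [zs _]; apply: fr_differentiable (Ffr z zs).
  split; first by move=> z [].
  exists g; split.
  + move=> w Ww; have [zs Fz] := Hg w Ww.
    have [d d0 Hd] := (open_nrmP W).1 oW w Ww.
    apply: fr_differentiable; apply: (fr_inverse (K := 2) Fz (erefl _) _ (Ffr _ zs) d0).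
      (* A kernel vector [x] of the Jacobian would make increments of [F] along [x] smaller than a
         quarter of the step, while [sub] makes them at least half; [k] scales [x] to fit both
         radii. *)
      apply: injective_unitmx => x xJ; apply: contrapT => /eqP/nrm_gt0 x0.
      have q0 : 0 < 1 / 4 :> R by lra.
      have [a a0 Ha] := Ffr _ zs _ q0.
      pose k := Num.min a (s - nrm (g w - p)) / (2 * nrm x).
      have m0 : 0 < Num.min a (s - nrm (g w - p)) by rewrite lt_min a0 subr_gt0.
      have k0 : 0 < k by rewrite divr_gt0 // mulr_gt0.
      have kx : nrm (k%:C *: x) = Num.min a (s - nrm (g w - p)) / 2.
        by rewrite nrmZ normc_real gtr0_norm // /k; field; rewrite gt_eqF.
      have kx0 : 0 < nrm (k%:C *: x) by rewrite kx divr_gt0.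
      have : nrm (k%:C *: x) < Num.min a (s - nrm (g w - p)) by rewrite kx; lra.
      rewrite lt_min => /andP[k1 k2].
      have := Ha _ k1; rewrite -scalemxAl xJ scaler0 subr0.
      have gs : nrm (g w + k%:C *: x - p) < s.
        by rewrite addrAC; apply: le_lt_trans (nrmD _ _) _; lra.
      have := sub _ _ gs zs; rewrite [g w + _ - _]addrC addKr; lra.
    move=> k kd; have Wk : W (w + k) by apply: Hd; rewrite addrC addKr.
    have [gs Fg] := Hg _ Wk; split=> //.
    by have := sub _ _ gs zs; rewrite Fg Fz [w + k - w]addrC addKr.
  + by move=> w Ww; have [zs Fz] := Hg w Ww; split=> //; rewrite Fz.
  + move=> z [zs zt]; have [gs Fg] := Hg (F z) zt; exact: inj.
  by move=> w Ww; have [] := Hg w Ww.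
move=> z [zs zt]; have := sub _ _ zs p0; lra.
Qed.

End InverseFunction.

(** * The image of a holomorphic retraction *)

Section RetractImage.
Context {R : realType} {n : nat}.
Notation V := 'rV[R[i]]_n.
Implicit Types (p q x y z w : V) (A B : 'M[R[i]]_n).

(** On the row space of [A] the map [A] is the identity, so a matrix at distance less than 1 has no
    kernel there. *)
Lemma idempotent_rank_le A B (k : R) : A *m A = A -> k < 1 ->
  (forall x, nrm (x *m A - x *m B) <= k * nrm x) -> (\rank A <= \rank B)%N.
Proof.
move=> AA k1 H; rewrite -(mxrank_mul_ker A B).
suff -> : (A :&: kermx B)%MS = 0 by rewrite mxrank0 addn0 mxrankM_maxr.
apply/row_matrixP => i; rewrite row0; set x := row i _.
have := row_sub i (A :&: kermx B)%MS; rewrite sub_capmx -/x.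
move=> /andP[/submxP[y xy] /sub_kermxP xB].
apply: contrapT => /eqP/nrm_gt0 x0; have := H x.
rewrite xB subr0 xy -mulmxA AA -xy ler_pMl //; lra.
Qed.

Lemma mulmx_pid_coord x (k : nat) (j : 'I_n) :
  (x *m pid_mx k) ord0 j = if (j < k)%N then x ord0 j else 0.
Proof.
rewrite mxE (bigD1 j) //= big1 => [|l lj]; last first.
  by rewrite mxE -[_ == _ :> nat]/(l == j) (negbTE lj) mulr0.
by rewrite mxE eqxx addr0; case: ifP => _; rewrite ?mulr1 ?mulr0.
Qed.

Lemma biholomorphic_mulmx (U W : set V) (F : V -> V) (E : 'M[R[i]]_n) :
  open W -> biholomorphic U W F -> E \in unitmx ->
  exists2 W' : set V, open W' & biholomorphic U W' (fun z => F z *m E).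
Proof.
move=> /open_nrmP oW [hF [FU [g [hg gW gF Fg]]]] Eu.
pose W' := [set w : V | W (w *m invmx E)]; exists W'.
  apply/open_nrmP => w Ww; have [r r0 Hr] := oW _ Ww; have [C C0 HC] := mulmx_nrm_le (invmx E).
  exists (r / C); first by rewrite divr_gt0.
  move=> y; rewrite ltr_pdivlMr // mulrC => yw; apply: Hr; rewrite -mulmxBl.
  exact: le_lt_trans (HC _) yw.
have dE (B : 'M[R[i]]_n) w : differentiable (fun x : V => x *m B) w.
  exact: fr_differentiable (fr_mulmx B w).
split; first exact: (holomorphic_comp (g := fun x => x *m E) hF FU (fun w _ => dE E w)).
split; first by move=> z Uz; rewrite /W' /= mulmxK //; exact: FU.
exists (fun w => g (w *m invmx E)); split.
- exact: (holomorphic_comp (E := W) (f := fun x => x *m invmx E) (fun w _ => dE _ w) _ hg).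
- by move=> w Ww; exact: gW.
- by move=> z Uz; rewrite mulmxK // gF.
by move=> w Ww; rewrite Fg // mulmxKV.
Qed.

Lemma connected_locally_constant (T : Type) (A : set V) (f : V -> T) : connected A ->
  (forall x, A x -> exists2 r : R, 0 < r & forall y, A y -> nrm (y - x) < r -> f y = f x) ->
  forall x y, A x -> A y -> f x = f y.
Proof.
move=> cA H x y Ax Ay; pose B := [set z | A z /\ f z = f x].
suff BA : B = A by have : B y by [rewrite BA]; case.
have opn (P : T -> Prop) : exists2 C, open C & [set z | A z /\ P (f z)] = A `&` C.
  exists [set z | exists w r, [/\ A w, P (f w), nrm (z - w) < r &
      forall y, A y -> nrm (y - w) < r -> f y = f w]].
    apply/open_nrmP => z [w [r [Aw Pw zr Hr]]]; exists (r - nrm (z - w)); first by rewrite subr_gt0.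
    move=> u uz; exists w, r; split=> //.
    by apply: le_lt_trans (nrm_dist_triangle z _ _) _; lra.
  apply/seteqP; split=> z [Az].
    move=> Pz; split=> //; have [r r0 Hr] := H z Az; exists z, r; split=> //.
    by rewrite subrr nrm0.
  by move=> [w [r [Aw Pw zr Hr]]]; split=> //; rewrite (Hr z Az zr).
apply: cA; first by exists x.
  exact: opn (fun t => t = f x).
have [C oC EC] := opn (fun t => t <> f x).
exists (~` C); first exact: open_closedC.
apply/seteqP; split=> z [Az Hz]; split=> //.
  by move=> Cz; have [_] : [set z | A z /\ f z <> f x] z by [rewrite EC].
apply: contrapT => nz; apply: Hz.
by have [] : (A `&` C) z by [rewrite -EC].
Qed.

Variables (D M : set V) (rho : V -> V).
Hypotheses (oD : open D) (MD : M `<=` D) (hr : holomorphic_on D rho).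
Hypotheses (rM : forall z, D z -> M (rho z)) (rid : forall z, M z -> rho z = z).
Notation J := (jac rho).

Lemma retraction_jac q : M q -> J q *m J q = J q.
Proof.
move=> Mq; have Dq := MD Mq; have F := holomorphic_fr oD hr Dq.
have [r r0 Hr] := (open_nrmP D).1 oD q Dq.
refine (fr_uniq _ F).
apply: (fr_ext r0 (f := fun z => rho (rho z))); first by move=> y /Hr Dy; rewrite rid //; exact: rM.
by apply: (fr_comp F); rewrite rid.
Qed.

(** At points of [M] the Jacobian is idempotent, so the rank comparison applies in both directions
    as soon as the Lipschitz bound brings two Jacobians within distance less than 1. *)
Lemma retraction_rank q : M q -> exists2 r : R, 0 < r &
  forall y, M y -> nrm (y - q) < r -> \rank (J y) = \rank (J q).
Proof.
move=> Mq; have [r [B [r0 _ G]]] := differentiable_gvec oD hr (MD Mq); have [B0 _] := G.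
set K := 128 * B / r ^+ 2; have K0 : 0 <= K by exact: cauchy_const_ge0.
have K1 : 0 < K + 1 by lra.
exists (Num.min (r / 8) (K + 1)^-1); first by rewrite lt_min divr_gt0 // invr_gt0.
move=> y My; rewrite lt_min => /andP[y8 yK].
have q8 : nrm (q - q) < r / 8 by rewrite subrr nrm0 divr_gt0.
have k1 : K * nrm (y - q) < 1.
  apply: le_lt_trans (ler_wpM2l K0 (ltW yK)) _; rewrite mulrC ltr_pdivrMl // mulr1; lra.
apply/eqP; rewrite eqn_leq; apply/andP; split.
  apply: (idempotent_rank_le (k := K * nrm (y - q))) => // [|x]; first exact: retraction_jac.
  exact: jac_lip x r0 G y8 q8.
apply: (idempotent_rank_le (k := K * nrm (y - q))) => // [|x]; first exact: retraction_jac.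
by rewrite [nrm (y - q)]nrm_distC; exact: jac_lip x r0 G q8 y8.
Qed.

Lemma retraction_chart q : M q -> exists (U W : set V) (phi : V -> V),
  [/\ open U /\ U q, U `<=` D, open W, biholomorphic U W phi &
    forall z, U z -> (M z <-> forall j : 'I_n, (\rank (J q) <= j)%N -> phi z ord0 j = 0)].
Proof.
move=> Mq; have Dq := MD Mq; set A := J q; have AA : A *m A = A := retraction_jac Mq.
pose B : 'M[R[i]]_n := 1%:M - A.
have AB : A *m B = 0 by rewrite mulmxBr mulmx1 AA subrr.
have BB : B *m B = B by rewrite {1}/B mulmxBl mul1mx AB subr0.
pose F z := (rho z - q) *m A + (z - rho z) *m B.
have frF z : D z -> fr F z ((J z - 0) *m A + (1%:M - J z) *m B).
  move=> Dz; have Hz := holomorphic_fr oD hr Dz.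
  have frid : fr id z (1%:M : 'M[R[i]]_n).
    have := fr_mulmx (1%:M : 'M[R[i]]_n) z.
    by rewrite (_ : (fun x => _) = id) //; apply/funext => x; rewrite mulmx1.
  exact: frD (fr_comp (g := fun x => x *m A) (frB Hz (fr_cst q z)) (fr_mulmx A _))
             (fr_comp (g := fun x => x *m B) (frB frid Hz) (fr_mulmx B _)).
have hF : holomorphic_on D F by move=> z Dz; exact: fr_differentiable (frF z Dz).
have JF : jac F q = 1%:M.
  by rewrite (fr_jac oD hF Dq (frF q Dq)) -/A -/B subr0 AA BB addrC subrK.
have [r [C [r0 _ GF]]] := differentiable_gvec oD hF Dq.
have [s s0 [inj chart]] := inverse_function r0 GF JF.
have [d d0 Hd] := (open_nrmP D).1 oD q Dq.
have [e e0 He] := fr_continuous (holomorphic_fr oD hr Dq) s0.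
have m0 : 0 < Num.min s (Num.min d e) by rewrite !lt_min s0 d0.
have [U [W [oU oW bF Us]]] := chart _ m0.
have Uz z : U z -> [/\ nrm (z - q) < s, D z & nrm (rho z - q) < s].
  move=> /Us; rewrite !lt_min => /and3P[zs zd ze]; split=> //; first exact: Hd.
  by have := He z ze; rewrite [rho q]rid.
(* In the basis given by [row_ebase A], the row space of [A] is spanned by the first [\rank A]
   coordinate vectors, which is the shape that [complex_submanifold] asks for. *)
pose E := invmx (row_ebase A).
have Eu : E \in unitmx by rewrite unitmx_inv row_ebase_unit.
have AE : A *m E = col_ebase A *m pid_mx (\rank A).
  by rewrite -{1}(mulmx_ebase A) mulmxK ?row_ebase_unit.
have [W' oW' bF'] := biholomorphic_mulmx oW bF Eu.
exists U, W', (fun z => F z *m E); split=> //; first by move=> z /Uz[].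
move=> z /Uz[zs Dz rs]; split=> [Mz j kj|H].
  by rewrite /F rid // subrr mul0mx addr0 -mulmxA AE mulmxA mulmx_pid_coord ltnNge kj.
(* Conversely, vanishing last coordinates put [F z] in the row space of [A], so its [B]-part
   [(z - rho z) *m B] is 0. Then [F z = F (rho z)], and injectivity yields [z = rho z]. *)
have FE : F z *m E = F z *m E *m pid_mx (\rank A).
  by apply/rowP => j; rewrite mulmx_pid_coord; case: ltnP => // /H.
have FA : F z = F z *m E *m invmx (col_ebase A) *m A.
  rewrite -{2}(mulmx_ebase A) !mulmxA mulmxKV ?col_ebase_unit // -FE.
  by rewrite mulmxKV ?row_ebase_unit.
have FB : F z *m B = 0 by rewrite FA -mulmxA AB mulmx0.
have zB : (z - rho z) *m B = 0.
  by move: FB; rewrite /F mulmxDl -!mulmxA AB BB mulmx0 add0r.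
suff -> : z = rho z by exact: rM.
apply: inj => //; rewrite /F zB addr0 [rho (rho z)]rid; last exact: rM.
by rewrite subrr mul0mx addr0.
Qed.

End RetractImage.

Theorem proposition1p2 (R : realType) (n : nat) (D : set 'rV[R[i]]_n)
    (Q : set ('rV[R[i]]_n -> 'rV[R[i]]_n)) :
  domain D ->
  convex_in_Cn D ->
  kobayashi_hyperbolic D ->
  (forall g, Q g -> automorphism D g) ->
  fixed_points D Q = set0 \/
  (connected (fixed_points D Q) /\
   exists k : nat, (k <= n)%N /\ complex_submanifold D (fixed_points D Q) k).
Proof.
move=> [_ oD connD] /convex_rconvex cD /hyperbolic_no_line nl autQ.
set M := fixed_points D Q.
have [M0|/eqP/set0P[p Mp]] := pselect (M = set0); first by left.
right; have MD : M `<=` D by move=> z [].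
have [rho [Srho fixrho]] := holomorphic_retraction oD cD nl Mp MD.
have hr := selfmap_holomorphic oD cD nl Mp MD Srho.
case: Srho => _ _ rD rid.
have rM z : D z -> M (rho z).
  move=> Dz; split=> [|g Qg]; first exact: rD.
  by apply: fixrho => //; split=> [|y [_]]; [exact: autQ | apply].
have connM : connected M.
  have -> : M = rho @` D.
    apply/seteqP; split=> [z Mz|_ [z Dz <-]]; last exact: rM.
    by exists z; [exact: MD | exact: rid].
  apply: connected_continuous_connected connD _.
  apply: continuous_in_subspaceT => z /set_mem Dz.
  exact: differentiable_continuous (hr z Dz).
(* The rank at [p] serves as dimension at every point, since the rank is locally constant along the
   connected set [M]. *)
split=> //; exists (\rank (jac rho p)); split; first exact: rank_leq_row.
split=> // q Mq; rewrite (connected_locally_constant (f := fun z => \rank (jac rho z)) connM _ Mp Mq).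
  exact: retraction_chart oD MD hr rM rid q Mq.
by move=> z Mz; exact: retraction_rank oD MD hr rM rid z Mz.
Qed.
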